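(* Fix an integer $r\ge1$, real numbers $a,b$ with $\frac1{r+1}<a<b<\frac1r$, an integer $h\ge2$, and a nonzero vector $(t_1,\dots,t_r)\in\mathbb Z^r$. For a positive integer $n$ put $$f(x)=\frac nh\sum_{j=1}^r t_j x^{-j}\qquad(x>0).$$ Then there exist $\eta>0$ and a constant $B>0$, depending only on $r,a,b,h,t_1,\dots,t_r$, such that for every positive integer $n$, every real $P\ge1$ for which $(P,2P]$ meets $(n^a,n^b]$, and every subinterval $I$ of $(P,2P]\cap(n^a,n^b]$, $$\left|\sum_{p\in I}(\log p)\,\exp(2\pi i f(p))\right|\le B\,P^{1-\eta},$$ where $p$ runs over primes, and also $$\left|\sum_{m\in I}\Lambda(m)\,\exp(2\pi i f(m))\right|\le B\,P^{1-\eta},$$ where $m$ runs over integers.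
   Context: $\Lambda$ denotes the von Mangoldt function: $\Lambda(m)=\log p$ if $m=p^k$ for a prime $p$ and an integer $k\ge1$, and $\Lambda(m)=0$ otherwise. *)

(* Defs.v *)
From HB Require Import structures.
From mathcomp Require Import all_boot all_order all_algebra.
From mathcomp Require Import complex.
From mathcomp Require Import all_classical all_reals all_analysis.

Set Implicit Arguments.
Unset Strict Implicit.
Unset Printing Implicit Defensive.

Import Order.TTheory GRing.Theory Num.Theory.

Local Open Scope classical_set_scope.
Local Open Scope ring_scope.
Local Open Scope complex_scope.

(* If m = p ^ k with p prime, then p <= m and k < m, so quantifying over
   'I_m.+1 loses nothing: see mangoldtX and mangoldt_eq0. *)
Definition mangoldt (R : realType) (m : nat) : R :=
  if [pick p : 'I_m.+1 | prime p &&
        [exists k : 'I_m.+1, (0 < k)%N && (m == p ^ k)%N]] is Some p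
  then ln p%:R else 0.

Lemma mangoldtX (R : realType) (p k : nat) :
  prime p -> (0 < k)%N -> mangoldt R (p ^ k) = ln p%:R.
Proof.
move=> pp k0; rewrite /mangoldt; case: pickP => [q|].
  case/andP=> pq /existsP[l /andP[l0 /eqP e]].
  suff -> : nat_of_ord q = p by [].
  have : (q %| p ^ k)%N by have := dvdn_exp l0 (dvdnn q); rewrite -e.
  by rewrite Euclid_dvdX// => /andP[+ _]; rewrite dvdn_prime2// => /eqP.
have p1 := prime_gt1 pp; have lk := ltn_expl k p1.
have lp : (p < (p ^ k).+1)%N by rewrite ltnS -{1}(expn1 p) leq_exp2l.
move/(_ (Ordinal lp)) => /=; rewrite pp /= => /existsP[].
by exists (Ordinal (ltnW lk : k < (p ^ k).+1)%N); rewrite /= k0 eqxx.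
Qed.

Lemma mangoldt_eq0 (R : realType) (m : nat) :
  ~ (exists p k, [/\ prime p, (0 < k)%N & m = (p ^ k)%N]) -> mangoldt R m = 0.
Proof.
move=> H; rewrite /mangoldt; case: pickP => // p.
by case/andP=> pp /existsP[k /andP[k0 /eqP e]]; case: H; exists p, k.
Qed.

(* exp (2 pi i x) *)
Definition expi2pi (R : realType) (x : R) : R[i] :=
  cos (2 * pi * x) +i* sin (2 * pi * x).

(* f(x) = (n / h) * \sum_(1 <= j <= r) t_j x^(-j); as j : 'I_r starts at 0,
   the entry t 0 j is t_(j+1). *)
Definition phase (R : realType) (r h : nat) (t : 'rV[int]_r) (n : nat)
    (x : R) : R :=
  n%:R / h%:R * \sum_(j < r) (t 0 j)%:~R * x ^- j.+1.

(* Main.v *)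
Require Import Defs.
From HB Require Import structures.
From mathcomp Require Import all_boot all_order all_algebra.
From mathcomp Require Import complex.
From mathcomp Require Import all_classical all_reals all_analysis.
From mathcomp Require Import ring lra zify.

Set Implicit Arguments.
Unset Strict Implicit.
Unset Printing Implicit Defensive.

Import Order.TTheory GRing.Theory Num.Theory.

Local Open Scope classical_set_scope.
Local Open Scope ring_scope.
Local Open Scope complex_scope.

(** Let j0 be the first index with t_j0 <> 0.  On (P, 2P] the phase behaves like
its leading term and has size T = n P^(-j0), up to constants.  As P^(1/b) <= n
with 1/b > r >= j0, and as n <= (2P)^(1/a), we have P^delta <= T <= P^A for
some fixed delta, A > 0 (phase_size): the phase always oscillates, and its speed
is polynomially bounded.

Exponential sums.  Let k run over an interval of integers of size M, and let g
be a polynomial in 1/k, without constant term, whose first nonzero coefficient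
is not small compared with the others.  If the size T of g on that interval lies
between M^delta and M^A, then the sum of exp(2 pi i g(k)) is O(M^(1-eta))
(phase_sum_bound).  For T <= M^(7/8) this is the Kusmin-Landau inequality, as the
increments of g are monotone and of size T/M.  For larger T one chooses an
order q with T/M^q between M^(-9/8) and M^(-1/8), and applies van der Corput
differencing q - 1 times before Kusmin-Landau (higher_difference_test).  The
whole argument runs on finite differences instead of derivatives: van der Corput
differencing u(x+d) - u(x) is a sum of d first differences, so hypotheses on
differences of order q + 1 become hypotheses of order q without any mean value
theorem, and the differences of x^(-j) are of exact order x^(-j-q) with
alternating signs because x^(-j) is a product of copies of 1/x and the class of
such sequences is stable under products (power_like_mul).

Primes.  Vaughan's identity (vaughan) splits the sum over Lambda into sums of
type I, where phase_sum_bound applies to the variable k of m = q k directly, and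
a sum of type II.  The latter is treated by Cauchy-Schwarz (type2_cauchy), which
leads to the phases f(uk) - f(vk).  These are again polynomials in 1/k of the
same shape (diff_coef), of size about T |u - v| / v; so they are covered by
phase_sum_bound except when u and v are very close, and those pairs are few
(type2_pairs).  The proper prime powers, finally, contribute O(P^(3/4)).

Instead of complex exponentials the estimates handle sums of cos (phi + u x)
for all real phi at once: phi = 0 and phi = - pi/2 give the real and the
imaginary part of the exponential sum. *)

(** * Summation by parts and the Kusmin-Landau inequality *)

Lemma summation_by_parts (R : realType) (a w : nat -> R) (N : nat) :
  \sum_(x < N.+1) a x * w x =
  (\sum_(x < N.+1) a x) * w N
  + \sum_(x < N) (\sum_(y < x.+1) a y) * (w x - w x.+1).
Proof.
elim: N => [|N IH]; first by rewrite !big_ord_recr !big_ord0 /=; ring.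
rewrite big_ord_recr /= IH [X in _ = X * _ + _]big_ord_recr.
by rewrite [X in _ = _ + X]big_ord_recr /=; ring.
Qed.

Definition monotone_upto (R : realType) (N : nat) (w : nat -> R) :=
  (forall x, (x.+1 < N)%N -> w x <= w x.+1) \/
  (forall x, (x.+1 < N)%N -> w x.+1 <= w x).

(** The absolute values telescope, whichever the direction of monotonicity. *)
Lemma monotone_variation (R : realType) (w : nat -> R) (N : nat) :
  monotone_upto N.+1 w -> \sum_(x < N) `|w x - w x.+1| = `|w 0 - w N|.
Proof.
case=> h.
- have -> : `|w 0 - w N| = w N - w 0.
    elim: N h => [|N IH] h; first by rewrite !subrr normr0.
    have h0 : w 0 <= w N.
      have : forall y, (y <= N)%N -> w 0 <= w y.
        elim=> // y IHy yN; apply: le_trans (IHy (ltnW yN)) _.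
        by apply: h; rewrite ltnS (leq_trans yN).
      exact.
    have h1 : w N <= w N.+1 by apply: h.
    by rewrite ler0_norm ?subr_le0 ?(le_trans h0)// opprB.
  rewrite -(telescope_sumr _ (leq0n N)) big_mkord; apply: eq_bigr => i _.
  by rewrite ler0_norm ?opprB// subr_le0; apply: h; rewrite ltnS.
- have -> : `|w 0 - w N| = w 0 - w N.
    have h0 : w N <= w 0.
      have : forall y, (y <= N)%N -> w y <= w 0.
        elim=> // y IHy yN; apply: le_trans (IHy (ltnW yN)).
        by apply: h; rewrite ltnS.
      exact.
    by rewrite ger0_norm// subr_ge0.
  rewrite -opprB -(telescope_sumr _ (leq0n N)) big_mkord -sumrN.
  apply: eq_bigr => i _.
  by rewrite opprB ger0_norm// subr_ge0; apply: h; rewrite ltnS.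
Qed.

(** Summation by parts costs the last weight plus the total variation of the
weights, and each of them is at most W for monotone weights in [0, W]. *)
Lemma abel_bound (R : realType) (a w : nat -> R) (N : nat) (B W : R) :
  0 <= W ->
  (forall n, (n <= N)%N -> `|\sum_(x < n) a x| <= B) ->
  monotone_upto N w ->
  (forall x, (x < N)%N -> 0 <= w x <= W) ->
  `|\sum_(x < N) a x * w x| <= 2 * B * W.
Proof.
move=> W0 hA hm hw.
have B0 : 0 <= B by apply: le_trans (hA 0 (leq0n _)); rewrite normr_ge0.
case: N hA hm hw => [|N] hA hm hw.
  by rewrite big_ord0 normr0 !mulr_ge0.
rewrite summation_by_parts.
have hN := hw N (ltnSn N); have h0 := hw 0 (ltn0Sn N).
have e1 : `|(\sum_(x < N.+1) a x) * w N| <= B * W.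
  rewrite normrM ler_pM ?hA// ger0_norm; lra.
apply: (le_trans (ler_normD _ _)).
have e2 : `|\sum_(x < N) (\sum_(y < x.+1) a y) * (w x - w x.+1)| <= B * W.
  apply: (le_trans (ler_norm_sum _ _ _)).
  apply: (@le_trans _ _ (\sum_(x < N) B * `|w x - w x.+1|)).
    apply: ler_sum => i _; rewrite normrM ler_wpM2r ?normr_ge0// hA//.
    by rewrite ltnS ltnW.
  rewrite -mulr_sumr monotone_variation// ler_wpM2l//.
  by rewrite ler_norml; lra.
lra.
Qed.

Section ImportTopology.
Import numFieldNormedType.Exports.

(** The slope of sin on [0, 1] is at least cos 1, by the mean value theorem. *)
Lemma sin_ge_linear (R : realType) (x : R) :
  0 <= x <= 1 -> cos 1 * x <= sin x.
Proof.
move=> /andP[x0 x1]; have [->|xn0] := eqVneq x 0; first by rewrite mulr0 sin0.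
have xp : 0 < x by rewrite lt_neqAle eq_sym xn0.
have [c cin e] : exists2 c, c \in `]0, x[%R & sin x - sin 0 = cos c * (x - 0).
  apply: (@MVT _ (@sin R) (@cos R)) => //.
  exact/continuous_subspaceT/continuous_sin.
move: e; rewrite sin0 !subr0 => ->; rewrite ler_wpM2r//.
move: cin; rewrite in_itv/= => /andP[c0 cx].
have p2 := @pi_ge2 R.
rewrite leNgt; apply/negP; rewrite ltr_cos ?in_itv/=; lra.
Qed.

End ImportTopology.

(** If u has increments 2 th, then the geometric series formula for exp (i u)
becomes, in real form, cos (u x) = ((sin (u (x+1)) - sin (u x)) cot (th x) +
cos (u x) - cos (u (x+1))) / 2. The second difference telescopes, and the
first one is summed by parts, as cot (th x) is monotone and O(1/lam). *)
Lemma kusmin_landau (R : realType) : exists2 C : R, 0 < C &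
  forall (u : nat -> R) (N : nat) (lam : R), 0 < lam ->
    (forall x, (x < N)%N -> lam <= u x.+1 - u x <= 1) ->
    monotone_upto N (fun x => u x.+1 - u x) ->
  `|\sum_(x < N) cos (u x)| <= C / lam.
Proof.
have c0 := @cos1_gt0 R.
exists (4 / cos 1 + 1) => [|u N lam l0 hl hm].
  by rewrite addr_gt0// divr_gt0.
case: N hl hm => [|N] hl hm.
  by rewrite big_ord0 normr0 divr_ge0 ?ltW// addr_gt0// divr_gt0.
have l1 : lam <= 1 by have /andP[h1 h2] := hl 0 (ltn0Sn N); exact: le_trans h2.
have hpi := @pi_ge2 R.
pose th x := (u x.+1 - u x) / 2.
have thb x : (x < N.+1)%N -> lam / 2 <= th x <= 1 / 2.
  by move=> xN; have := hl _ xN; rewrite /th; lra.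
have sp x : (x < N.+1)%N -> cos 1 * (lam / 2) <= sin (th x).
  move=> /thb h; apply: (@le_trans _ _ (cos 1 * th x)).
    by rewrite ler_pM2l//; lra.
  by apply: sin_ge_linear; lra.
have s0 x : (x < N.+1)%N -> 0 < sin (th x).
  by move=> /sp; apply: lt_le_trans; rewrite mulr_gt0// divr_gt0.
have cp x : (x < N.+1)%N -> 0 <= cos (th x) <= 1.
  move=> /thb h; rewrite cos_le1 andbT; apply: cos_ge0_pihalf; lra.
pose w x := cos (th x) / sin (th x).
(* sin th >= (cos 1) (lam / 2) and cos th <= 1 *)
pose W := 2 / (cos 1 * lam).
have W0 : 0 <= W by rewrite divr_ge0// ltW// mulr_gt0.
have hw x : (x < N.+1)%N -> 0 <= w x <= W.
  move=> xN; have /andP[c1 c2] := cp _ xN; have s1 := s0 _ xN.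
  rewrite /w divr_ge0 ?(ltW s1)//= ler_pdivrMr// /W.
  have := sp _ xN => h; apply: (le_trans c2).
  rewrite mulrAC ler_pdivlMr ?mulr_gt0//; lra.
have wle x y : (x < N.+1)%N -> (y < N.+1)%N -> th x <= th y -> w y <= w x.
  move=> xN yN xy; rewrite /w ler_pdivrMr ?s0// mulrAC ler_pdivlMr ?s0//.
  have bx := thb _ xN; have by_ := thb _ yN.
  have hc : cos (th y) <= cos (th x).
    rewrite leNgt; apply/negP; rewrite ltr_cos ?in_itv/=; lra.
  have hs : sin (th x) <= sin (th y).
    rewrite leNgt; apply/negP; rewrite ltr_sin ?in_itv/=; lra.
  have := cp _ xN; have := cp _ yN; have := s0 _ xN; have := s0 _ yN.
  nra.
have mw : monotone_upto N.+1 w.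
  case: hm => h; [right|left] => x xN; apply: wle => //; rewrite ?(ltnW xN)//;
  by rewrite /th; have := h _ xN; lra.
have key x : (x < N.+1)%N -> cos (u x) =
   ((sin (u x.+1) - sin (u x)) * w x + (cos (u x) - cos (u x.+1))) / 2.
  move=> xN; have -> : u x.+1 = u x + (th x + th x).
    by rewrite /th; field.
  have sn : sin (th x) != 0 by rewrite gt_eqF// s0.
  rewrite /w cosD sinD cosD sinD.
  have e := cos2Dsin2 (th x).
  move: e sn; set c := cos (th x); set s := sin (th x).
  set C := cos (u x); set S := sin (u x) => e sn.
  transitivity ((2 * (c ^+ 2 + s ^+ 2) * C
                 + (c ^+ 2 + s ^+ 2 - 1) * (S * (c / s) - C)) / 2).
    by rewrite e; field.
  by field.
have -> : \sum_(x < N.+1) cos (u x) =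
    (\sum_(x < N.+1) (sin (u x.+1) - sin (u x)) * w x
     + (cos (u 0) - cos (u N.+1))) / 2.
  rewrite -(opprB (cos (u N.+1))) -(telescope_sumr (fun x => cos (u x)) (leq0n N.+1)) big_mkord.
  rewrite -sumrN -big_split /= big_distrl /=.
  by apply: eq_bigr => i _; rewrite opprB -key.
have hA : `|\sum_(x < N.+1) (sin (u x.+1) - sin (u x)) * w x| <= 2 * 2 * W.
  pose ds x := sin (u x.+1) - sin (u x).
  apply: (@abel_bound _ ds w _ _ _ W0 _ mw hw) => n nN.
  rewrite -(big_mkord xpredT (fun x => sin (u x.+1) - sin (u x))).
  rewrite (telescope_sumr (fun x => sin (u x)))//.
  have := sin_le1 (u n); have := sin_geN1 (u n).
  have := sin_le1 (u 0); have := sin_geN1 (u 0).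
  by rewrite ler_norml; lra.
have hC : `|cos (u 0) - cos (u N.+1)| <= 2.
  have := cos_le1 (u N.+1); have := cos_geN1 (u N.+1).
  have := cos_le1 (u 0); have := cos_geN1 (u 0).
  by rewrite ler_norml; lra.
rewrite normrM [`|2^-1|]gtr0_norm//.
apply: (@le_trans _ _ ((2 * 2 * W + 2) / 2)).
  by rewrite ler_pM2r// (le_trans (ler_normD _ _))// lerD.
have -> : (4 / cos 1 + 1) / lam = 2 * W + 1 / lam.
  by rewrite /W; field; rewrite !gt_eqF.
have : 1 <= 1 / lam by rewrite ler_pdivlMr// mul1r.
lra.
Qed.

(** * The van der Corput inequality *)

Lemma cauchy_schwarz (R : realFieldType) (I : finType) (a b : I -> R) :
  (\sum_i a i * b i) ^+ 2 <= (\sum_i a i ^+ 2) * (\sum_i b i ^+ 2).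
Proof.
have X0 : 0 <= \sum_i \sum_j (a i * b j - a j * b i) ^+ 2.
  by rewrite sumr_ge0// => i _; rewrite sumr_ge0// => j _; rewrite sqr_ge0.
have XE : \sum_i \sum_j (a i * b j - a j * b i) ^+ 2 =
    \sum_i \sum_j a i ^+ 2 * b j ^+ 2 + \sum_i \sum_j b i ^+ 2 * a j ^+ 2
    - (\sum_i \sum_j a i * b i * (a j * b j)) * 2.
  rewrite mulr_suml -big_split -sumrB /=; apply: eq_bigr => i _.
  rewrite mulr_suml -big_split -sumrB /=; apply: eq_bigr => j _.
  ring.
rewrite -!big_distrlr /= in XE.
move: X0; rewrite XE; nra.
Qed.

(** The sum of a sequence supported in [H, H + N) does not change under a
shift h <= H; the room left below H absorbs the shift. *)
Lemma sum_shift (R : realType) (G : nat -> R) (N H h : nat) :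
  (forall x, (x < H)%N || (H + N <= x)%N -> G x = 0) -> (h <= H)%N ->
  \sum_(y < N + H) G (y + h)%N = \sum_(x < N) G (H + x)%N.
Proof.
move=> G0 hH.
rewrite -(big_mkord xpredT (fun y => G (y + h)%N)).
rewrite -(big_mkord xpredT (fun x => G (H + x)%N)).
have -> : \sum_(0 <= y < N + H) G (y + h)%N = \sum_(h <= x < N + H + h) G x.
  by rewrite -{2}[h]add0n big_addn addnK.
rewrite (big_cat_nat hH)/=; last by lia.
rewrite big_nat big1 ?add0r; last by move=> i /andP[_ iH]; rewrite G0// iH.
rewrite (@big_cat_nat _ _ _ (H + N))/=; [|by lia|by lia].
rewrite [X in _ + X]big_nat [X in _ + X]big1 ?addr0; last first.
  by move=> i /andP[iH _]; rewrite G0// iH orbT.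
rewrite -[X in \sum_(X <= _ < _) _]add0n big_addn addKn.
by apply: eq_bigr => i _; rewrite addnC.
Qed.

Lemma sum_dist_le (R : realType) (b : nat -> R) (H h : nat) :
  (forall d, (d < H)%N -> 0 <= b d) -> (h < H)%N ->
  \sum_(h' < H) b (h - h' + (h' - h))%N <= 2 * \sum_(d < H) b d.
Proof.
move=> b0 hH.
have sub n : (n <= H)%N -> \sum_(0 <= d < n) b d <= \sum_(d < H) b d.
  move=> nH; rewrite -(big_mkord xpredT b) (big_cat_nat (leq0n n) nH)/=.
  by rewrite lerDl big_nat sumr_ge0// => d /andP[_ dH]; exact: b0.
rewrite -(big_mkord xpredT (fun h' => b (h - h' + (h' - h))%N)).
rewrite (@big_cat_nat _ _ _ h.+1)//= mulr_natl mulr2n lerD//.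
  apply: le_trans (sub h.+1 hH); rewrite big_nat_rev/= add0n.
  rewrite le_eqVlt; apply/orP; left; apply/eqP; rewrite !big_nat.
  apply: eq_bigr => i /andP[_ ih]; congr b; lia.
apply: le_trans (sub (H - h)%N (leq_subr _ _)).
rewrite -[X in \sum_(X <= _ < _) _]add0n big_addn.
apply: (@le_trans _ _ (\sum_(0 <= i < H - h.+1) b i.+1)).
  rewrite le_eqVlt; apply/orP; left; apply/eqP.
  apply: eq_bigr => i _; congr b; lia.
have -> : (H - h = (H - h.+1).+1)%N by lia.
by rewrite [leRHS]big_nat_recl// lerDr b0// (leq_trans _ hH).
Qed.

(** Averaging the sum over its H shifts and applying Cauchy-Schwarz yields
products of cos (u x) at two points. The same inequality for sin, added to
it, turns the products into cos (u (x+d) - u x). *)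
Lemma van_der_corput (R : realType) (u b : nat -> R) (N H : nat) :
  (0 < H)%N ->
  (forall d, (d < H)%N ->
     `|\sum_(x < N - d) cos (u (x + d)%N - u x)| <= b d) ->
  H%:R * (\sum_(x < N) cos (u x)) ^+ 2
    <= 2 * (N + H)%:R * \sum_(d < H) b d.
Proof.
move=> H0 hb.
(* z moved to [H, H + N) and extended by zero, so that all shifts by h <= H make sense *)
pose Z (z : nat -> R) x := if (H <= x < H + N)%N then z (x - H)%N else 0.
pose S (z : nat -> R) := \sum_(x < N) z x.
have ZS z h : (h <= H)%N -> \sum_(y < N + H) Z z (y + h)%N = S z.
  move=> hH; rewrite sum_shift//.
    by apply: eq_bigr => x _; rewrite /Z leq_addr ltn_add2l ltn_ord addKn.
  by move=> x hx; rewrite /Z; case: ifP => //; lia.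
have ZZ z h d : (h + d <= H)%N ->
    \sum_(y < N + H) Z z (y + h)%N * Z z (y + (h + d))%N
      = \sum_(x < N - d) z (x + d)%N * z x.
  move=> hH; pose G x := Z z x * Z z (x + d)%N.
  transitivity (\sum_(y < N + H) G (y + h)%N).
    by apply: eq_bigr => y _; rewrite /G addnA.
  rewrite sum_shift//; [|move=> x hx|by lia]; last first.
    by rewrite /G /Z; case: ifP; rewrite ?mul0r//; lia.
  have [dN|Nd] := leqP d N; last first.
    have -> : (N - d = 0)%N by lia.
    rewrite big_ord0 big1// => x _; rewrite /G /Z mulrC.
    by case: ifP; rewrite ?mul0r//; have := ltn_ord x; lia.
  rewrite -(big_mkord xpredT (fun x => G (H + x)%N)).
  rewrite (@big_cat_nat _ _ _ (N - d))//=; last by lia.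
  rewrite [X in _ + X]big_nat [X in _ + X]big1 ?addr0; last first.
    move=> x hx; rewrite /G /Z mulrC.
    by case: ifP; rewrite ?mul0r//; lia.
  rewrite big_mkord; apply: eq_bigr => x _.
  have xN := ltn_ord x; rewrite /G /Z.
  have -> : (H <= H + x < H + N)%N by lia.
  have -> : (H <= H + x + d < H + N)%N by lia.
  by rewrite mulrC; congr (z _ * z _); lia.
pose C x := cos (u x); pose Sn x := sin (u x).
pose rho h h' := \sum_(y < N + H) (Z C (y + h)%N * Z C (y + h')%N
                                 + Z Sn (y + h)%N * Z Sn (y + h')%N).
have rhoC h h' : rho h h' = rho h' h.
  by apply: eq_bigr => y _; rewrite mulrC [X in _ + X]mulrC.
have rho_le h d : (h + d < H)%N -> rho h (h + d)%N <= b d.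
  move=> hd; apply: le_trans (hb d _); last by lia.
  rewrite /rho big_split /= !ZZ; [|by lia|by lia].
  rewrite -big_split /=; apply: le_trans (ler_norm _).
  rewrite le_eqVlt; apply/orP; left; apply/eqP.
  by apply: eq_bigr => x _; rewrite cosB.
have rho_dist h h' : (h < H)%N -> (h' < H)%N ->
    rho h h' <= b (h - h' + (h' - h))%N.
  move=> hH hH'; have [hh|/ltnW hh] := leqP h h'.
    have -> : (h - h' + (h' - h) = h' - h)%N by lia.
    by have := @rho_le h (h' - h)%N; rewrite subnKC//; apply.
  have -> : (h - h' + (h' - h) = h - h')%N by lia.
  by rewrite rhoC; have := @rho_le h' (h - h')%N; rewrite subnKC//; apply.
have CS z : (H%:R * S z) ^+ 2 <=
    (N + H)%:R * \sum_(y < N + H) (\sum_(h < H) Z z (y + h)%N) ^+ 2.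
  have -> : H%:R * S z = \sum_(y < N + H) 1 * \sum_(h < H) Z z (y + h)%N.
    under [RHS]eq_bigr do rewrite mul1r.
    rewrite exchange_big /=.
    under [RHS]eq_bigr => h _ do rewrite (ZS z _ (ltnW (ltn_ord h))).
    by rewrite sumr_const card_ord mulr_natl.
  apply: (le_trans (cauchy_schwarz _ _)); rewrite ler_wpM2r//.
    by rewrite sumr_ge0// => y _; rewrite sqr_ge0.
  under eq_bigr do rewrite expr1n.
  by rewrite sumr_const card_ord.
have sq z y : (\sum_(h < H) Z z (y + h)%N) ^+ 2 =
    \sum_(h < H) \sum_(h' < H) Z z (y + h)%N * Z z (y + h')%N.
  by rewrite expr2 big_distrlr.
have main : (H%:R * S C) ^+ 2 + (H%:R * S Sn) ^+ 2 <=
    (N + H)%:R * (H%:R * (2 * \sum_(d < H) b d)).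
  apply: (le_trans (lerD (CS C) (CS Sn))).
  rewrite -mulrDr ler_wpM2l// -big_split /=.
  under eq_bigr => y _ do rewrite !sq -big_split /=.
  rewrite exchange_big /=.
  apply: (@le_trans _ _ (\sum_(h < H) (2 * \sum_(d < H) b d))); last first.
    by rewrite sumr_const card_ord [leRHS]mulr_natl.
  apply: ler_sum => h _.
  under eq_bigr => y _ do rewrite -big_split /=.
  rewrite exchange_big /=.
  apply: le_trans (sum_dist_le _ (ltn_ord h)); last first.
    by move=> d dH; apply: le_trans (hb d dH).
  apply: ler_sum => h' _; exact: rho_dist.
have H0' : 0 < H%:R :> R by rewrite ltr0n.
have h1 : (H%:R * S C) ^+ 2 <= (N + H)%:R * (H%:R * (2 * \sum_(d < H) b d)).
  by apply: le_trans main; rewrite lerDl sqr_ge0.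
rewrite -(ler_pM2l H0'); move: h1; rewrite /S /C; lra.
Qed.

(** * Difference tests of all orders *)

Definition fdiff (R : realType) (u : nat -> R) : nat -> R :=
  fun x => u x.+1 - u x.

(** This identity replaces the mean value theorem: differencing by d costs
one order of differences and multiplies their size by d. *)
Lemma iter_fdiff_shift (R : realType) (u : nat -> R) (d k x : nat) :
  iter k (@fdiff R) (fun x => u (x + d)%N - u x) x =
  \sum_(i < d) iter k.+1 (@fdiff R) u (x + i)%N.
Proof.
have -> : iter k (@fdiff R) (fun x => u (x + d)%N - u x) x =
    iter k (@fdiff R) u (x + d)%N - iter k (@fdiff R) u x.
  by elim: k x => //= k IH x; rewrite /fdiff !IH addSn; ring.
elim: d => [|d IH]; first by rewrite big_ord0 addn0 subrr.
by rewrite big_ord_recr /= -IH /fdiff addnS; ring.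
Qed.

(** The discrete form of the hypotheses of the k-th derivative test: the
differences of order k have a fixed sign and a size known up to the factor
al, and they are monotone. *)
Definition pinched_diff (R : realType) (k : nat) (u : nat -> R) (N : nat)
    (lam al : R) :=
  (forall x, (x < N)%N -> lam <= iter k (@fdiff R) u x <= al * lam) /\
  ((forall x, (x < N)%N -> 0 <= iter k.+1 (@fdiff R) u x) \/
   (forall x, (x < N)%N -> iter k.+1 (@fdiff R) u x <= 0)).

Lemma pinched_diff_shift (R : realType) k (u : nat -> R) N lam al d :
  pinched_diff k.+1 u N lam al ->
  pinched_diff k (fun x => u (x + d)%N - u x) (N - d) (d%:R * lam) al.
Proof.
move=> [h1 h2]; split=> [x xN|].
  rewrite iter_fdiff_shift.
  have h i : (i < d)%N -> lam <= iter k.+1 (@fdiff R) u (x + i)%N <= al * lam.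
    by move=> id; apply: h1; clear -xN id; lia.
  apply/andP; split.
    have -> : d%:R * lam = \sum_(i < d) lam by rewrite sumr_const card_ord mulr_natl.
    apply: ler_sum => i _.
    by have /andP[] := h i (ltn_ord i).
  have -> : al * (d%:R * lam) = \sum_(i < d) al * lam.
    by rewrite sumr_const card_ord mulrCA mulr_natl.
  apply: ler_sum => i _.
  by have /andP[] := h i (ltn_ord i).
case: h2 => h2; [left|right] => x xN; rewrite iter_fdiff_shift.
  by rewrite sumr_ge0// => i _; apply: h2; have := ltn_ord i; clear -xN; lia.
by rewrite sumr_le0// => i _; apply: h2; have := ltn_ord i; clear -xN; lia.
Qed.

Lemma first_difference_test (R : realType) : exists2 C : R, 0 < C &
  forall (u : nat -> R) (N : nat) (lam al : R), 0 < lam -> al * lam <= 1 ->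
    pinched_diff 1 u N lam al -> `|\sum_(x < N) cos (u x)| <= C / lam.
Proof.
have [C C0 hC] := kusmin_landau R; exists C => // u N lam al l0 al1 [h1 h2].
apply: hC => // [x xN|].
  by have /andP[-> h] := h1 _ xN; apply: le_trans al1.
case: h2 => h; [left|right] => x xN.
  by rewrite -subr_ge0; apply: (h x); rewrite ltnW.
by rewrite -subr_le0; apply: (h x); rewrite ltnW.
Qed.

(** A root in place of a logarithm is good enough for second_difference_test,
where only some saving of a power matters. *)
Lemma sum_inv_le_sqrt (R : realType) (n : nat) :
  \sum_(1 <= d < n.+1) d%:R^-1 <= 2 * Num.sqrt n%:R :> R.
Proof.
elim: n => [|n IH]; first by rewrite big_geq// sqrtr0 mulr0.
rewrite big_nat_recr//=; apply: (le_trans (lerD IH (lexx _))).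
set s := Num.sqrt n%:R; set t := Num.sqrt n.+1%:R.
have s0 : 0 <= s by rewrite sqrtr_ge0.
have t0 : 0 < t by rewrite sqrtr_gt0 ltr0n.
have s2 : s ^+ 2 = n%:R by rewrite sqr_sqrtr.
have t2 : t ^+ 2 = s ^+ 2 + 1 by rewrite s2 sqr_sqrtr// natr1.
have e : n.+1%:R = t ^+ 2 :> R by rewrite sqr_sqrtr.
have t1 : 1 <= t by nra.
have st : s <= t by nra.
rewrite e.
have h : t ^- 2 <= 2 * (t - s).
  rewrite -div1r ler_pdivrMr ?exprn_gt0//.
  have : (t - s) * (t + s) = 1 by rewrite -subr_sqr t2; ring.
  nra.
lra.
Qed.

Lemma trivial_cos_bound (R : realType) (u : nat -> R) (N : nat) :
  `|\sum_(x < N) cos (u x)| <= N%:R.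
Proof.
apply: (le_trans (ler_norm_sum _ _ _)).
apply: (@le_trans _ _ (\sum_(x < N) 1)); last by rewrite sumr_const card_ord.
by apply: ler_sum => x _; exact: cos_max.
Qed.

(** The van der Corput inequality with the number of shifts H of order
lam^(-1/2): then the sums with shift d < H have differences of size d lam at
most lam^(1/2), still small, while the diagonal term gains the factor 1/H,
that is, lam^(1/2). *)
Lemma weyl_step (R : realType) (u : nat -> R) (N : nat) (M lam B : R) :
  N%:R <= M -> 1 <= M -> 0 < lam <= 1 -> 1 <= M ^+ 2 * lam ->
  (forall H, (0 < H)%N -> H%:R <= (Num.sqrt lam)^-1 ->
     \sum_(1 <= d < H) `|\sum_(x < N - d) cos (u (x + d)%N - u x)| <= B) ->
  (\sum_(x < N) cos (u x)) ^+ 2 <= 8 * M * Num.sqrt lam * (M + B).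
Proof.
move=> NM M1 /andP[l0 l1] Ml hB.
set q := Num.sqrt lam; have q0 : 0 < q by rewrite sqrtr_gt0.
have q2 : q ^+ 2 = lam by rewrite sqr_sqrtr// ltW.
have q1 : q <= 1 by rewrite -(@expr_le1 _ 2)// ?q2// ltW.
have Mq : 1 <= M * q.
  by rewrite -(@expr_ge1 _ 2)// ?exprMn ?q2// mulr_ge0 ?(ltW q0)// (le_trans _ M1).
pose H := Num.truncn q^-1.
have /andP[Hq qH] : H%:R <= q^-1 < H.+1%:R.
  by apply: truncn_itv; rewrite invr_ge0 ltW.
have H0 : (0 < H)%N.
  by rewrite -ltnS -(ltr_nat R) (le_lt_trans _ qH)// invf_ge1.
have Hr : 1 <= H%:R :> R by rewrite ler1n.
have Hi : 1 <= H%:R * (2 * q).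
  have : 1 < H.+1%:R * q by rewrite -ltr_pdivrMr// div1r.
  rewrite -natr1; nra.
have HM : H%:R <= M by apply: (le_trans Hq); rewrite -div1r ler_pdivrMr.
pose b d := `|\sum_(x < N - d) cos (u (x + d)%N - u x)|.
have := @van_der_corput R u b N H H0 (fun d _ => lexx _).
rewrite -(big_mkord xpredT b) big_ltn//.
have hB' := hB H H0 Hq.
have B0 : 0 <= B by apply: le_trans hB'; rewrite sumr_ge0.
have b0 : b 0 <= M.
  have := trivial_cos_bound (fun x => u (x + 0)%N - u x) (N - 0).
  by move=> h; apply: (le_trans h); rewrite subn0.
set S := _ ^+ 2; set T := \sum_(1 <= d < H) _ => h.
have h1 : H%:R * S <= (4 * M) * (M + B).
  apply: (le_trans h); apply: ler_pM.
  - by rewrite mulr_ge0.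
  - by rewrite addr_ge0 ?normr_ge0// sumr_ge0// => i _; rewrite normr_ge0.
  - by rewrite natrD; lra.
  - exact: lerD.
have S0 : 0 <= S by rewrite sqr_ge0.
apply: (@le_trans _ _ (H%:R * S * (2 * q))).
  by rewrite -mulrA mulrCA ler_peMr// .
have -> : 8 * M * q * (M + B) = (4 * M) * (M + B) * (2 * q) by ring.
by rewrite ler_pM2r// mulr_gt0.
Qed.

(** For K >= 1 the square root of the constant may be given away. *)
Lemma norm_le_of_sqr (R : realType) (S K z : R) :
  1 <= K -> 0 <= z -> S ^+ 2 <= K * z ^+ 2 -> `|S| <= K * z.
Proof.
move=> K1 z0 h; have Kz : 0 <= K * z by rewrite mulr_ge0// (le_trans _ K1).
rewrite -(@ler_pXn2r R 2)// ?nnegrE ?normr_ge0// real_normK ?num_real//.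
apply: (le_trans h); rewrite exprMn ler_wpM2r ?exprn_ge0//.
by rewrite expr2 ler_peMl// (le_trans _ K1).
Qed.

(** One Weyl step, after which Kusmin-Landau bounds the sum with shift d by
O(1 / (d lam)). The second term that results is M lam^(-3/4) and is
acceptable because lam is not much smaller than 1/M: this is the hypothesis 1
<= M^5 lam^4. The bound is stated with a free y >= lam^(1/40), so that the
induction of higher_difference_test never has to take roots. *)
Lemma second_difference_test (R : realType) (al : R) : 1 <= al ->
  exists2 C : R, 0 < C & forall (u : nat -> R) (N : nat) (M lam y : R),
    N%:R <= M -> 1 <= M -> 0 < lam -> 0 < y <= 1 -> lam <= y ^+ 40 ->
    1 <= M ^+ 5 * lam ^+ 4 -> pinched_diff 2 u N lam al ->
    `|\sum_(x < N) cos (u x)| <= C * (M * y).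
Proof.
move=> al1; have [C0 C00 hC0] := first_difference_test R.
pose K := 8 + 16 * C0; have K1 : 1 <= K by rewrite /K; lra.
exists (al ^+ 2 + K); first by rewrite ltr_wpDl ?sqr_ge0//; lra.
move=> u N M lam y NM M1 l0 /andP[y0 y1] ly Ml hp.
have My : 0 <= M * y by rewrite mulr_ge0 ?(ltW y0)//; lra.
have M0 : 0 <= M := le_trans ler01 M1.
have al0 : 0 <= al := le_trans ler01 al1.
have K0 : 0 <= K := le_trans ler01 K1.
have al2 : 1 <= al ^+ 2 by rewrite expr_ge1.
(* if lam is not small, then neither is y, and the trivial bound suffices *)
have [big|small] := ltP 1 (al ^+ 2 * lam).
  apply: (le_trans (trivial_cos_bound _ _)); apply: (le_trans NM).
  have : y ^+ 40 <= y by rewrite ler_iXnr// ltW.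
  move=> yy; rewrite mulrCA ler_peMr//.
  have := ltW big; have : al ^+ 2 * lam <= al ^+ 2 * y.
    by rewrite ler_wpM2l ?sqr_ge0// (le_trans ly).
  have : 0 <= K * y by rewrite mulr_ge0// ltW.
  clear; lra.
have l1 : lam <= 1 by apply: (le_trans ly); rewrite exprn_ile1// ltW.
(* with lam = s^20 every power of lam that occurs is an integral power of s *)
pose s := lam `^ (20%:R^-1).
have s0 : 0 < s by rewrite powR_gt0.
have s20 : s ^+ 20 = lam.
  by rewrite -powR_mulrn ?ltW// /s -powRrM mulVf ?powRr1 ?ltW// pnatr_eq0.
have s1 : s <= 1 by rewrite -(@expr_le1 _ 20)// ?s20// ltW.
have q : Num.sqrt lam = s ^+ 10.
  by rewrite -s20 (exprM _ 10 2) sqrtr_sqr ger0_norm// exprn_ge0// ltW.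
have sy : s <= y ^+ 2.
  rewrite -(@ler_pXn2r R 20)// ?nnegrE ?exprn_ge0 ?(ltW s0) ?(ltW y0)//.
  by rewrite -exprM s20.
have Ms : 1 <= M * s ^+ 16.
  have Ms0 : 0 <= M * s ^+ 16 by rewrite mulr_ge0// exprn_ge0// ltW.
  rewrite -(@expr_ge1 _ 5 _ _ Ms0)// exprMn.
  by have -> : (s ^+ 16) ^+ 5 = lam ^+ 4 by rewrite -s20 -[LHS]exprM -[RHS]exprM.
have Ml' : 1 <= M ^+ 2 * lam.
  rewrite -s20; apply: (le_trans Ms).
  have : s ^+ 16 <= M * s ^+ 20.
    rewrite (_ : M * s ^+ 20 = s ^+ 4 * (M * s ^+ 16)); last by ring.
    have : s ^+ 16 <= s ^+ 4 by rewrite ler_wiXn2l// ltW.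
    have : 0 <= s ^+ 4 by rewrite exprn_ge0// ltW.
    clear -Ms; nra.
  by rewrite expr2 -mulrA => h; rewrite ler_wpM2l.
have l01 : 0 < lam <= 1 by rewrite l0.
pose B := 2 * C0 * s ^- 25.
have hB H : (0 < H)%N -> H%:R <= (Num.sqrt lam)^-1 ->
   \sum_(1 <= d < H) `|\sum_(x < N - d) cos (u (x + d)%N - u x)| <= B.
  case: H => // H _; rewrite q => Hq.
  apply: (@le_trans _ _ (\sum_(1 <= d < H.+1) C0 / lam * d%:R^-1)).
    rewrite !big_nat; apply: ler_sum => d /andP[d0 dH].
    have d0' : 0 < d%:R :> R by rewrite ltr0n.
    have -> : C0 / lam * d%:R^-1 = C0 / (d%:R * lam).
      by field; rewrite !gt_eqF.
    apply: (hC0 (fun x => u (x + d)%N - u x) _ _ al); [by rewrite mulr_gt0| |exact: pinched_diff_shift].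
    have ds : d%:R <= s ^- 10 by apply: le_trans Hq; rewrite ler_nat ltnW.
    have : d%:R * lam <= s ^+ 10.
      rewrite -s20 (_ : s ^+ 10 = s ^- 10 * s ^+ 20); last first.
        by field; rewrite gt_eqF.
      by rewrite ler_wpM2r// exprn_ge0// ltW.
    move=> h; apply: (@le_trans _ _ (al * s ^+ 10)).
      by rewrite ler_wpM2l.
    rewrite -(@expr_le1 _ 2)//.
      by rewrite exprMn -exprM s20.
    by rewrite mulr_ge0// exprn_ge0// ltW.
  rewrite -mulr_sumr.
  have := sum_inv_le_sqrt R H.
  have : Num.sqrt H%:R <= s ^- 5.
    rewrite -(@ler_pXn2r R 2)// ?nnegrE ?sqrtr_ge0 ?invr_ge0 ?exprn_ge0 ?(ltW s0)//.
    rewrite sqr_sqrtr// -exprVn -exprM exprVn; apply: le_trans Hq.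
    by rewrite ler_nat.
  move=> h1 h2.
  apply: (@le_trans _ _ (C0 / lam * (2 * s ^- 5))).
    rewrite ler_wpM2l ?divr_ge0 ?(ltW l0) ?(ltW C00)//; clear -h1 h2; lra.
  rewrite le_eqVlt /B -s20; apply/orP; left; apply/eqP.
  by field; rewrite gt_eqF.
have h := weyl_step NM M1 l01 Ml' hB.
have h2 : `|\sum_(x < N) cos (u x)| <= K * (M * y).
  apply: norm_le_of_sqr => //; apply: (le_trans h); rewrite q.
  have -> : 8 * M * s ^+ 10 * (M + B) = M * (8 * M * s ^+ 10 + 16 * C0 * s ^- 15).
    by rewrite /B; field; rewrite gt_eqF.
  have -> : K * (M * y) ^+ 2 = M * (K * M * y ^+ 2) by ring.
  rewrite ler_wpM2l//.
  have hs : s ^- 15 <= M * s.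
    rewrite -[leRHS]mul1r -[X in X * _](@mulfV _ (s ^+ 15)); last first.
      by rewrite expf_neq0// gt_eqF.
    rewrite mulrAC ler_peMl ?invr_ge0 ?exprn_ge0 ?(ltW s0)//.
    by rewrite (_ : s ^+ 15 * (M * s) = M * s ^+ 16)//; ring.
  have s10 : s ^+ 10 <= s by rewrite ler_iXnr// ltW.
  apply: (@le_trans _ _ (K * M * s)).
    rewrite /K; have : M * s ^+ 10 <= M * s by rewrite ler_wpM2l.
    have : C0 * s ^- 15 <= C0 * (M * s) by rewrite ler_wpM2l// ltW.
    clear; lra.
  by rewrite ler_wpM2l// mulr_ge0.
by apply: (le_trans h2); rewrite ler_wpM2r// lerDr sqr_ge0.
Qed.

(** Induction on the order: after a Weyl step the differenced sequences
satisfy the hypotheses one order below with d lam in place of lam, and d lam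
<= lam^(1/2). The saving y thus loses a fourth root at each step. *)
Lemma higher_difference_test (R : realType) (al : R) (k : nat) : 1 <= al ->
  exists m : nat, exists2 C : R, 0 < C &
  forall (u : nat -> R) (N : nat) (M lam y : R),
    N%:R <= M -> 1 <= M -> 0 < lam -> 0 < y <= 1 -> lam <= y ^+ m.+1 ->
    1 <= M ^+ 5 * lam ^+ 4 -> pinched_diff k.+2 u N lam al ->
    `|\sum_(x < N) cos (u x)| <= C * (M * y).
Proof.
move=> al1; elim: k => [|k [m [C C0 hC]]].
  have [C C0 hC] := second_difference_test al1.
  by exists 39%N, C.
(* y^2 is used at the order below, so lam <= y^(4 (m + 1)) is what gives
   lam^(1/2) <= (y^2)^(m + 1) *)
exists (4 * m + 3)%N; pose K := 8 * (1 + C).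
have K1 : 1 <= K by rewrite /K; lra.
exists K; first lra.
move=> u N M lam y NM M1 l0 /andP[y0 y1] ly Ml hp.
have M0 : 0 <= M := le_trans ler01 M1.
have l1 : lam <= 1 by apply: (le_trans ly); rewrite exprn_ile1// ltW.
pose q := Num.sqrt lam.
have q0 : 0 < q by rewrite sqrtr_gt0.
have q2 : q ^+ 2 = lam by rewrite sqr_sqrtr// ltW.
have q1 : q <= 1 by rewrite -(@expr_le1 _ 2)// ?q2// ltW.
have y20 : 0 < y ^+ 2 by rewrite exprn_gt0.
have y21 : y ^+ 2 <= 1 by rewrite exprn_ile1// ltW.
have qy : q <= (y ^+ 2) ^+ m.+1.
  rewrite -(@ler_pXn2r R 2)// ?nnegrE ?exprn_ge0 ?(ltW y0) ?(ltW q0)//.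
  rewrite q2 -!exprM; apply: (le_trans ly); rewrite le_eqVlt.
  by apply/orP; left; apply/eqP; congr (_ ^+ _); clear; lia.
have qy2 : q <= y ^+ 2.
  by apply: (le_trans qy); rewrite ler_iXnr// ltW.
have Ml' : 1 <= M ^+ 2 * lam.
  rewrite -(@expr_ge1 _ 4)//; last by rewrite mulr_ge0 ?(ltW l0)// sqr_ge0.
  rewrite exprMn -exprM; apply: (le_trans Ml).
  by rewrite ler_wpM2r ?exprn_ge0 ?(ltW l0)// ler_weXn2l.
have l01 : 0 < lam <= 1 by rewrite l0.
pose B := C * (M * y ^+ 2) * q^-1.
have hB H : (0 < H)%N -> H%:R <= (Num.sqrt lam)^-1 ->
   \sum_(1 <= d < H) `|\sum_(x < N - d) cos (u (x + d)%N - u x)| <= B.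
  move=> H0 Hq.
  apply: (@le_trans _ _ (\sum_(1 <= d < H) C * (M * y ^+ 2))).
    rewrite !big_nat; apply: ler_sum => d /andP[d0 dH].
    have d1 : 1 <= d%:R :> R by rewrite ler1n.
    apply: (hC (fun x => u (x + d)%N - u x) _ _ (d%:R * lam)).
    - by apply: le_trans NM; rewrite ler_nat leq_subr.
    - by [].
    - by rewrite mulr_gt0// (lt_le_trans ltr01).
    - by rewrite y20.
    - apply: le_trans qy; have : d%:R * q <= 1.
        rewrite -ler_pdivlMr// div1r; apply: le_trans Hq.
        by rewrite ler_nat ltnW.
      by rewrite -q2 expr2 mulrA => h; rewrite ler_piMl// ltW.
    - apply: (le_trans Ml); rewrite ler_wpM2l ?exprn_ge0//.
      by rewrite lerXn2r ?nnegrE// ?mulr_ge0 ?(ltW l0) ?ler_peMl ?(ltW l0).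
    - exact: pinched_diff_shift.
  have CMy : 0 <= C * (M * y ^+ 2).
    by rewrite mulr_ge0 ?(ltW C0)// mulr_ge0// ltW.
  rewrite sumr_const_nat -mulr_natr ler_wpM2l//.
  by apply: le_trans Hq; rewrite ler_nat leq_subr.
have h := weyl_step NM M1 l01 Ml' hB.
have My : 0 <= M * y by rewrite mulr_ge0// ltW.
apply: norm_le_of_sqr => //; apply: (le_trans h); rewrite -/q.
have -> : 8 * M * q * (M + B) = 8 * M ^+ 2 * (q + C * y ^+ 2).
  by rewrite /B; field; rewrite gt_eqF.
have -> : K * (M * y) ^+ 2 = 8 * M ^+ 2 * (y ^+ 2 + C * y ^+ 2).
  by rewrite /K; ring.
by rewrite ler_wpM2l ?mulr_ge0 ?sqr_ge0// lerD2r.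
Qed.

(** * Finite differences of polynomials in 1/x *)

Definition bdiff (R : realType) (u : nat -> R) : nat -> R :=
  fun x => u x - u x.+1.

Lemma iter_bdiff_add (R : realType) k (u v : nat -> R) x :
  iter k (@bdiff R) (fun x => u x + v x) x
  = iter k (@bdiff R) u x + iter k (@bdiff R) v x.
Proof. by elim: k x => //= k IH x; rewrite /bdiff !IH; ring. Qed.

Lemma iter_bdiff_sum (R : realType) k n (c : nat -> R) (u : nat -> nat -> R) x :
  iter k (@bdiff R) (fun x => \sum_(j < n) c j * u j x) x
  = \sum_(j < n) c j * iter k (@bdiff R) (u j) x.
Proof.
elim: k x => //= k IH x; rewrite /bdiff !IH -sumrB.
by apply: eq_bigr => j _; ring.
Qed.

Lemma iter_bdiff_shift (R : realType) k (u : nat -> R) s x :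
  iter k (@bdiff R) (fun x => u (s + x)%N) x = iter k (@bdiff R) u (s + x)%N.
Proof. by elim: k x => //= k IH x; rewrite /bdiff !IH addnS. Qed.

(** The backward differences u x - u (x+1) of order k are positive and of
exact order (x+1)^(-j-k), as for the function x^(-j). The argument is shifted
by one so that all x are allowed. *)
Definition power_like_diff (R : realType) (j k : nat) (u : nat -> R) :=
  exists l L : R, 0 < l /\ forall x,
    l * x.+1%:R ^- (j + k) <= iter k (@bdiff R) u x <= L * x.+1%:R ^- (j + k).

Definition power_like (R : realType) (K j : nat) (u : nat -> R) :=
  forall k, (k <= K)%N -> power_like_diff j k u.

Lemma power_like_bdiff (R : realType) K j (u : nat -> R) :
  power_like K.+1 j u -> power_like K j.+1 (bdiff u).
Proof.
by move=> h k kK; have := h k.+1 kK; rewrite /power_like_diff iterSr addSnnS.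
Qed.

Lemma power_like_succ (R : realType) K j (u : nat -> R) :
  power_like K j u -> power_like K j (fun x => u x.+1).
Proof.
move=> h k kK; have [l [L [l0 hL]]] := h k kK.
exists (l * 2 ^- (j + k)), L; split=> [|x]; first by rewrite mulr_gt0// invr_gt0 exprn_gt0.
have -> : iter k (@bdiff R) (fun x => u x.+1) x = iter k (@bdiff R) u x.+1.
  exact: (iter_bdiff_shift k u 1 x).
have x0 : 0 < x.+1%:R :> R by rewrite ltr0n.
have /andP[h1 h2] := hL x.+1.
have L0 : 0 <= L.
  have := le_trans h1 h2; rewrite ler_pM2r ?invr_gt0 ?exprn_gt0//.
  by move=> lL; rewrite (le_trans _ lL)// ltW.
apply/andP; split.
  apply: le_trans h1; rewrite -mulrA ler_pM2l// -invfM -exprMn.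
  rewrite lef_pV2 ?posrE ?exprn_gt0 ?mulr_gt0//.
  by rewrite lerXn2r ?nnegrE ?mulr_ge0// -natrM ler_nat; clear; lia.
apply: (le_trans h2); rewrite ler_wpM2l//.
rewrite lef_pV2 ?posrE ?exprn_gt0//.
by rewrite lerXn2r ?nnegrE// ler_nat.
Qed.

(** By the Leibniz rule bdiff (u v) x = bdiff u x * v x + u (x+1) * bdiff v
x, a sum of two products of the same kind, so that the order k + 1 for a
product follows from the order k for two other products; no cancellation
occurs as all terms are positive. *)
Lemma power_like_mul (R : realType) k : forall (u v : nat -> R) i j,
  power_like k i u -> power_like k j v ->
  power_like_diff (i + j) k (fun x => u x * v x).
Proof.
elim: k => [|k IH] u v i j hu hv.
  have [l [L [l0 hL]]] := hu 0%N (leqnn _).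
  have [l' [L' [l'0 hL']]] := hv 0%N (leqnn _).
  exists (l * l'), (L * L'); split=> [|x]; first by rewrite mulr_gt0.
  rewrite /= addn0 exprD invfM.
  have x0 : 0 < x.+1%:R :> R by rewrite ltr0n.
  have := hL x; have := hL' x; rewrite /= !addn0 => /andP[a1 a2] /andP[b1 b2].
  have p1 : 0 <= l * x.+1%:R ^- i by rewrite mulr_ge0 ?(ltW l0)// invr_ge0 exprn_ge0.
  have p2 : 0 <= l' * x.+1%:R ^- j by rewrite mulr_ge0 ?(ltW l'0)// invr_ge0 exprn_ge0.
  rewrite !(mulrACA _ _ (_^-1)) !ler_pM//.
    exact: le_trans b1.
  exact: le_trans a1.
have weak (f : nat -> R) m : power_like k.+1 m f -> power_like k m f.
  by move=> h n nk; apply: h; rewrite (leq_trans nk).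
have [l [L [l0 hL]]] := IH (bdiff u) v i.+1 j (power_like_bdiff hu) (weak _ _ hv).
have [l' [L' [l'0 hL']]] := IH (fun x => u x.+1) (bdiff v) i j.+1
   (power_like_succ (weak _ _ hu)) (power_like_bdiff hv).
exists (l + l'), (L + L'); split=> [|x]; first by rewrite addr_gt0.
have -> : iter k.+1 (@bdiff R) (fun x => u x * v x) x =
    iter k (@bdiff R) (fun x => bdiff u x * v x) x +
    iter k (@bdiff R) (fun x => u x.+1 * bdiff v x) x.
  rewrite iterSr -iter_bdiff_add; congr (iter _ _ _ _).
  by apply/funext => y; rewrite /bdiff; ring.
have -> : (i + j + k.+1 = (i + j + k).+1)%N by rewrite addnS.
have := hL x; have := hL' x; rewrite addnS !addSn.
by move=> /andP[a1 a2] /andP[b1 b2]; rewrite !mulrDl !lerD.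
Qed.

(** Since 1/x - 1/(x+1) = 1/x * 1/(x+1), the differences of 1/x of order K +
1 are differences of order K of a product, to which power_like_mul applies. *)
Lemma power_like_inv (R : realType) K : power_like K 1 (fun x => x.+1%:R^-1 : R).
Proof.
elim: K => [|K IH] k.
  rewrite leqn0 => /eqP ->; exists 1, 1; split=> // x.
  by rewrite /= addn0 expr1 mul1r lexx.
rewrite leq_eqVlt => /orP[/eqP->|]; last by rewrite ltnS; exact: IH.
have [l [L [l0 hL]]] := power_like_mul IH (power_like_succ IH).
suff e : bdiff (fun x => x.+1%:R^-1 : R) = fun x => x.+1%:R^-1 * x.+2%:R^-1.
  by exists l, L; split=> // x; have := hL x; rewrite iterSr addSnnS e.
apply/funext => y; rewrite /bdiff.
have y1 : y.+1%:R != 0 :> R by rewrite pnatr_eq0.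
have y2 : y.+2%:R = y.+1%:R + 1 :> R by rewrite natr1.
have : y.+2%:R != 0 :> R by rewrite pnatr_eq0.
by rewrite y2 => y20; field; rewrite nat1r y1 y20.
Qed.

Lemma power_like_invX (R : realType) K j :
  power_like K j.+1 (fun x => x.+1%:R ^- j.+1 : R).
Proof.
elim: j => [|j IH]; first exact: power_like_inv.
move=> k kK; have := @power_like_mul R k _ _ _ _
   (fun n nk => power_like_inv R (leq_trans nk kK)) (fun n nk => IH n (leq_trans nk kK)).
rewrite add1n.
suff -> : (fun x => x.+1%:R ^- j.+2) = fun x => x.+1%:R^-1 * x.+1%:R ^- j.+1 :> R by [].
by apply/funext => x; rewrite [in LHS]exprS invfM.
Qed.

Lemma uniform_power_like (R : realType) (k r : nat) :
  exists l L : R, [/\ 0 < l, l <= L & forall j x, (j < r)%N ->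
    l * x.+1%:R ^- (j.+1 + k) <= iter k (@bdiff R) (fun x => x.+1%:R ^- j.+1) x
      <= L * x.+1%:R ^- (j.+1 + k)].
Proof.
elim: r => [|r [l [L [l0 lL h]]]]; first by exists 1, 1.
have [l' [L' [l'0 h']]] := @power_like_invX R k r k (leqnn k).
exists (Num.min l l'), (Num.max L L'); split.
- by rewrite lt_min l0.
- by rewrite ge_min le_max lL.
move=> j x; rewrite ltnS leq_eqVlt => /orP[/eqP->|jr].
  have /andP[h1 h2] := h' x.
  have x0 : 0 < x.+1%:R ^- (r.+1 + k) :> R by rewrite invr_gt0 exprn_gt0// ltr0n.
  apply/andP; split.
    by apply: le_trans h1; rewrite ler_pM2r// ge_min lexx orbT.
  by apply: (le_trans h2); rewrite ler_pM2r// le_max lexx orbT.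
have /andP[h1 h2] := h j x jr.
have x0 : 0 < x.+1%:R ^- (j.+1 + k) :> R by rewrite invr_gt0 exprn_gt0// ltr0n.
apply/andP; split.
  by apply: le_trans h1; rewrite ler_pM2r// ge_min lexx.
by apply: (le_trans h2); rewrite ler_pM2r// le_max lexx.
Qed.

(** The term c j0 dominates: a term c j with j > j0 contributes a quantity
smaller by the factor 1/x, which beats the constants once x >= M0. *)
Lemma dominated_phase_diff (R : realType) (k r : nat) (D : R) : 0 <= D ->
  exists l L M0 : R, [/\ 0 < l, l <= L & forall (c : nat -> R) j0 x,
    (j0 < r)%N -> (forall j, (j < j0)%N -> c j = 0) ->
    (forall j, (j < r)%N -> `|c j| <= D * c j0) -> 0 < c j0 -> M0 <= x.+1%:R ->
    l * (c j0 * x.+1%:R ^- (j0.+1 + k)) <=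
      iter k (@bdiff R) (fun x => \sum_(j < r) c j * x.+1%:R ^- j.+1) x
    <= L * (c j0 * x.+1%:R ^- (j0.+1 + k))].
Proof.
move=> D0; have [l [L [l0 lL h]]] := uniform_power_like R k r.
exists (l / 2), (L + l / 2), (2 * r%:R * D * L / l); split; [lra|lra|].
move=> c j0 x j0r cz cD c0 hx.
rewrite (iter_bdiff_sum k r c (fun j x => x.+1%:R ^- j.+1)).
rewrite (bigD1 (Ordinal j0r))//=.
set X := x.+1%:R : R in hx *.
have X1 : 1 <= X by rewrite ler1n.
have X0 : 0 < X by lra.
set d0 := iter _ _ _ _; set E := \sum_(i < r | _) _.
have /andP[d1 d2] : l * X ^- (j0.+1 + k) <= d0 <= L * X ^- (j0.+1 + k).
  exact: h.
set Y := X ^- (j0.+1 + k) in d1 d2 *.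
have Y0 : 0 < Y by rewrite invr_gt0 exprn_gt0.
have cY0 : 0 < c j0 * Y by rewrite mulr_gt0.
have hE : `|E| <= l / 2 * (c j0 * Y).
  have L0 : 0 <= L by rewrite (le_trans _ lL)// ltW.
  pose z := D * c j0 * (L * (Y / X)).
  have z0 : 0 <= z by apply: mulr_ge0; apply: mulr_ge0 => //; rewrite ?divr_ge0 ?ltW.
  apply: (@le_trans _ _ (\sum_(j < r) z)).
    rewrite [leRHS](bigD1 (Ordinal j0r))//= ler_wpDl//.
    apply: (le_trans (ler_norm_sum _ _ _)); apply: ler_sum => j jj0.
    have [jlt|jge] := ltnP j j0.
      by rewrite cz// mul0r normr0.
    have {}jge : (j0 < j)%N.
      by rewrite ltn_neqAle jge andbT eq_sym.
    rewrite normrM; apply: ler_pM; rewrite ?normr_ge0 ?cD//.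
    have /andP[e1 e2] := h j x (ltn_ord j).
    rewrite ger0_norm; last first.
      by apply: le_trans e1; rewrite mulr_ge0 ?(ltW l0)// invr_ge0 exprn_ge0.
    apply: (le_trans e2); rewrite ler_wpM2l// -invfM -exprSr.
    have je : ((j0.+1 + k).+1 <= j.+1 + k)%N.
      by rewrite -addSn leq_add2r ltnS.
    rewrite lef_pV2 ?posrE ?exprn_gt0//; exact: (ler_weXn2l X1 je).
  have -> : \sum_(j < r) z = (r%:R * D * L / X) * (c j0 * Y).
    by rewrite sumr_const card_ord -[LHS]mulr_natl /z; ring.
  rewrite ler_pM2r// ler_pdivrMr//; move: hx; rewrite ler_pdivrMr//.
  by move=> hx; lra.
have : c j0 * (l * Y) <= c j0 * d0 by rewrite ler_pM2l.
have : c j0 * d0 <= c j0 * (L * Y) by rewrite ler_pM2l.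
move: hE; rewrite ler_norml; lra.
Qed.

Definition invpoly (R : realType) (r : nat) (c : nat -> R) (x : R) : R :=
  \sum_(j < r) c j * x ^- j.+1.

Lemma iter_fdiffE (R : realType) k (u : nat -> R) x :
  iter k (@fdiff R) u x = (-1) ^+ k * iter k (@bdiff R) u x.
Proof.
elim: k x => [|k IH] x; first by rewrite expr0 mul1r.
by rewrite /= /fdiff /bdiff !IH exprS; ring.
Qed.

Lemma iter_bdiff_affine (R : realType) k (a b : R) (u : nat -> R) x :
  iter k.+1 (@bdiff R) (fun x => a + b * u x) x = b * iter k.+1 (@bdiff R) u x.
Proof.
elim: k x => [|k IH] x; first by rewrite /= /bdiff; ring.
rewrite (_ : iter k.+2 (@bdiff R) u x
  = iter k.+1 (@bdiff R) u x - iter k.+1 (@bdiff R) u x.+1)//.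
by rewrite mulrBr -!IH.
Qed.

(** The differences of order k.+1 of the phase are c j0 M^(-j0-1) M^(-k-1) in
size, up to constants, and those of the next order have the opposite sign.
The sequence v is the phase up to a sign, which the cosine does not see. *)
Lemma pinched_phase (R : realType) (r k : nat) (D Q : R) : 0 <= D -> 1 <= Q ->
  exists k1 k2 al M0 : R, [/\ 0 < k1, 0 < k2, 1 <= al & 1 <= M0] /\
  forall (c : nat -> R) j0 (M : R) s N phi, (j0 < r)%N ->
    (forall j, (j < j0)%N -> c j = 0) ->
    (forall j, (j < r)%N -> `|c j| <= D * c j0) -> 0 < c j0 -> M0 <= M ->
    M <= s%:R -> (s + N)%:R <= Q * M ->
    exists v lam, [/\ forall x,
        cos (v x) = cos (phi + 2 * pi * invpoly r c (s + x)%:R),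
      pinched_diff k.+1 v N lam al &
      k1 * (c j0 * M ^- j0.+1 * M ^- k.+1) <= lam
        <= k2 * (c j0 * M ^- j0.+1 * M ^- k.+1)].
Proof.
move=> D0 Q1; have [l [L [M0 [l0 lL h]]]] := dominated_phase_diff k.+1 r D0.
have [l' [L' [M0' [l'0 _ h']]]] := dominated_phase_diff k.+2 r D0.
have p0 := @pi_gt0 R; have Q0 : 0 < Q by lra.
pose e := (r + k.+1)%N.
exists (2 * pi * l * Q ^- e), (2 * pi * l), (L / l * Q ^+ e).
exists (Num.max 1 (Num.max M0 M0')); split.
  split.
  - by rewrite !mulr_gt0// invr_gt0 exprn_gt0.
  - by rewrite !mulr_gt0.
  - rewrite -[leLHS]mulr1 ler_pM//; last by rewrite exprn_ege1.
    by rewrite ler_pdivlMr// mul1r.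
  - by rewrite le_max lexx.
move=> c j0 M s N phi j0r cz cD c0 hM Ms sN.
move: hM; rewrite !ge_max => /and3P[M1 hM hM'].
have M00 : 0 < M by lra.
case: s Ms sN => [|s] Ms sN; first by have := le_trans M1 Ms; rewrite ler10.
pose g x := \sum_(j < r) c j * x.+1%:R ^- j.+1.
(* the sign that makes the forward differences of order k.+1 positive *)
pose sg : R := (-1) ^+ k.+1.
have sg2 : sg * sg = 1 by rewrite -expr2 -exprM mulnC exprM sqrrN expr1n expr1n.
pose v x := sg * phi + (sg * (2 * pi)) * g (s + x)%N.
pose ee := (j0.+1 + k.+1)%N.
pose lam := 2 * pi * l * (c j0 * (Q * M) ^- ee).
have dv n x : iter n.+1 (@fdiff R) v x =
    (-1) ^+ n.+1 * sg * (2 * pi) * iter n.+1 (@bdiff R) g (s + x)%N.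
  by rewrite iter_fdiffE iter_bdiff_affine iter_bdiff_shift -!mulrA.
have eE : (ee <= e)%N by rewrite /ee /e leq_add2r.
have hY x : (x < N)%N -> (Q * M) ^- ee <= (s + x).+1%:R ^- ee <= M ^- ee.
  move=> xN; have Y0 : 0 < (s + x).+1%:R :> R by rewrite ltr0n.
  rewrite !lef_pV2 ?posrE ?exprn_gt0 ?mulr_gt0//.
  rewrite !lerXn2r ?nnegrE ?mulr_ge0 ?(ltW M00) ?(ltW Q0)//.
    by apply: (le_trans Ms); rewrite ler_nat ltnS leq_addr.
  by apply: le_trans sN; rewrite ler_nat addSn ltnS leq_add2l ltnW.
exists v, lam; split.
- move=> x; rewrite /v -/(g _) -mulrA -mulrDr.
  have -> : invpoly r c (s.+1 + x)%:R = g (s + x)%N by rewrite /invpoly addSn.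
  rewrite /sg -signr_odd; case: odd; first by rewrite expr1 mulN1r cosN.
  by rewrite expr0 mul1r.
- have xM x : M <= (s + x).+1%:R by apply: (le_trans Ms); rewrite ler_nat ltnS leq_addr.
  have p20 : 0 < 2 * pi :> R by rewrite mulr_gt0.
  split=> [x xN|].
    rewrite dv sg2 mul1r.
    have /andP[h1 h2] := h c j0 (s + x)%N j0r cz cD c0 (le_trans hM (xM x)).
    have := hY x xN; rewrite {}/lam; set Z := (Q * M) ^- ee => /andP[y1 y2].
    have -> : 2 * pi * l * (c j0 * Z) = 2 * pi * (l * (c j0 * Z)) by ring.
    have -> : L / l * Q ^+ e * (2 * pi * (l * (c j0 * Z))) =
       2 * pi * (L * (c j0 * (Q ^+ e * Z))).
      by field; rewrite gt_eqF.
    rewrite !ler_pM2l//; apply/andP; split.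
      by apply: le_trans h1; rewrite !ler_pM2l.
    apply: (le_trans h2); rewrite !ler_pM2l//; last by rewrite (lt_le_trans l0).
    apply: (le_trans y2); rewrite /Z exprMn invfM mulrA.
    rewrite ler_peMl ?invr_ge0 ?exprn_ge0 ?(ltW M00)//.
    by rewrite ler_pdivlMr ?exprn_gt0// mul1r (ler_weXn2l Q1 eE).
  right=> x xN; rewrite dv exprS -/sg mulN1r mulNr sg2 mulN1r mulNr oppr_le0.
  have /andP[h1 _] := h' c j0 (s + x)%N j0r cz cD c0 (le_trans hM' (xM x)).
  rewrite mulr_ge0 ?(ltW p20)//; apply: le_trans h1.
  by rewrite !mulr_ge0 ?(ltW l'0) ?(ltW c0)// invr_ge0 exprn_ge0.
- have eM : M ^- ee = M ^- j0.+1 * M ^- k.+1 by rewrite exprD invfM.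
  rewrite /lam exprMn invfM eM.
  have z0 : 0 <= c j0 * (M ^- j0.+1 * M ^- k.+1).
    by rewrite !mulr_ge0 ?(ltW c0)// invr_ge0 exprn_ge0// ltW.
  have pl0 : 0 < 2 * pi * l by rewrite !mulr_gt0.
  have -> : 2 * pi * l * (c j0 * (Q ^- ee * (M ^- j0.+1 * M ^- k.+1)))
    = 2 * pi * l * (Q ^- ee * (c j0 * (M ^- j0.+1 * M ^- k.+1))) by ring.
  rewrite -!(mulrA (2 * pi * l)) -!(mulrA (c j0)) !ler_pM2l//.
  rewrite ler_wpM2r//=.
    by rewrite ler_piMl// invf_le1 ?exprn_ege1// exprn_gt0.
  by rewrite lef_pV2 ?posrE ?exprn_gt0// (ler_weXn2l Q1 eE).
Qed.

(** * Power savings for phases that are polynomials in 1/x *)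

Lemma powR_unbounded (R : realType) (K e : R) : 0 < e ->
  exists2 M0 : R, 1 <= M0 & forall M, M0 <= M -> K <= M `^ e.
Proof.
move=> e0; set K1 := Num.max 1 K; exists (K1 `^ e^-1).
  by rewrite -(powRr0 K1) ler_powR ?invr_ge0 ?(ltW e0)// le_max lexx.
move=> M hM; have K10 : 0 <= K1 by rewrite le_max ler01.
apply: (@le_trans _ _ K1); first by rewrite le_max lexx orbT.
rewrite -[leLHS]powRr1// -(mulVf (lt0r_neq0 e0)) powRrM.
by rewrite ge0_ler_powR ?(ltW e0)// nnegrE ?powR_ge0// (le_trans _ hM)// powR_ge0.
Qed.

Lemma powR_split (R : realType) (M x y : R) : 0 < M ->
  M `^ (x + y) = M `^ x * M `^ y.
Proof. by move=> M0; rewrite powRD ?(gt_eqF M0) ?implybT. Qed.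

Lemma powR_ge1 (R : realType) (M x : R) : 1 <= M -> 0 <= x -> 1 <= M `^ x.
Proof. by move=> M1 x0; rewrite -(powRr0 M) ler_powR. Qed.

(** The case of phases of size at most M^(7/8): their increments are small,
and Kusmin-Landau gives M / T, which is at most M^(1 - de). *)
Lemma phase_sum_slow (R : realType) (r : nat) (D Q de : R) :
  0 <= D -> 1 <= Q -> 0 < de <= 1 -> exists2 C : R, 0 < C &
  forall (c : nat -> R) j0 (M : R) s N phi, (j0 < r)%N ->
    (forall j, (j < j0)%N -> c j = 0) ->
    (forall j, (j < r)%N -> `|c j| <= D * c j0) -> 0 < c j0 -> 1 <= M ->
    M <= s%:R -> (s + N)%:R <= Q * M ->
    M `^ de <= c j0 * M ^- j0.+1 -> c j0 * M ^- j0.+1 <= M `^ (7 / 8) ->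
    `|\sum_(x < N) cos (phi + 2 * pi * invpoly r c (s + x)%:R)|
      <= C * M `^ (1 - de).
Proof.
move=> D0 Q1 /andP[de0 de1]; have Q0 : 0 < Q := lt_le_trans ltr01 Q1.
have [k1 [k2 [al [M0 [[k10 k20 al1 M01] h]]]]] := pinched_phase r 0 D0 Q1.
have [C0 C00 hC0] := first_difference_test R.
have e8 : 0 < 1 / 8 :> R by lra.
have [M1 M11 hM1] := powR_unbounded (al * k2) e8.
exists (C0 / k1 + Q * (M0 + M1)).
  by rewrite addr_gt0 ?divr_gt0// mulr_gt0//; clear -M01 M11; lra.
move=> c j0 M s N phi j0r cz cD c0 M1' Ms sN T1 T2.
have Mp : 0 < M := lt_le_trans ltr01 M1'.
have Mde : 1 <= M `^ (1 - de) by apply: powR_ge1; rewrite ?subr_ge0.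
have [small|big] := ltP M (M0 + M1).
  apply: (le_trans (trivial_cos_bound
    (fun x => phi + 2 * pi * invpoly r c (s + x)%:R) N)).
  have : N%:R <= (s + N)%:R :> R by rewrite ler_nat leq_addl.
  have : Q * M <= Q * (M0 + M1) by rewrite ler_pM2l// ltW.
  have : 0 <= C0 / k1 * M `^ (1 - de) by rewrite !mulr_ge0 ?invr_ge0 ?powR_ge0 ?ltW.
  have : Q * (M0 + M1) <= Q * (M0 + M1) * M `^ (1 - de).
    by rewrite ler_peMr// mulr_ge0 ?(ltW Q0)//; clear -M01 M11; lra.
  rewrite mulrDl; clear -sN; lra.
have hM0 : M0 <= M by clear -big M11; lra.
have hM1' : M1 <= M by clear -big M01; lra.
have [v [lam [vE vp /andP[l1 l2]]]] := h c j0 M s N phi j0r cz cD c0 hM0 Ms sN.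
have -> : \sum_(x < N) cos (phi + 2 * pi * invpoly r c (s + x)%:R)
    = \sum_(x < N) cos (v x) by apply: eq_bigr => x _; rewrite vE.
move: l1 l2; rewrite expr1; set T := c j0 * M ^- j0.+1 in T1 T2 * => l1 l2.
have T0 : 0 < T by rewrite mulr_gt0// invr_gt0 exprn_gt0.
have TM0 : 0 < T / M by rewrite divr_gt0.
have l0 : 0 < lam by apply: lt_le_trans l1; rewrite mulr_gt0.
apply: (@le_trans _ _ (C0 / lam)).
  apply: (hC0 v _ _ al) => //.
  apply: (@le_trans _ _ (al * (k2 * (T / M)))); first by rewrite ler_pM2l// (lt_le_trans ltr01).
  have : T / M <= M `^ (- (1 / 8)).
    rewrite ler_pdivrMr//; apply: (le_trans T2).
    rewrite -{3}(powRr1 (ltW Mp)) -powR_split// le_eqVlt.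
    by apply/orP; left; apply/eqP; congr (_ `^ _); clear; lra.
  rewrite powRN => h1; rewrite mulrA.
  have := hM1 _ hM1' => h2.
  apply: (@le_trans _ _ (M `^ (1 / 8) * (M `^ (1 / 8))^-1)).
    apply: ler_pM => //; last exact: ltW.
    by rewrite mulr_ge0 ?(ltW k20)// (le_trans ler01).
  by rewrite mulfV// gt_eqF// powR_gt0.
apply: (@le_trans _ _ (C0 / k1 * M `^ (1 - de))); last first.
  by rewrite ler_wpM2r ?powR_ge0// lerDl mulr_ge0 ?(ltW Q0)//; clear -M01 M11; lra.
apply: (@le_trans _ _ (C0 / (k1 * (T / M)))).
  by rewrite ler_pM2l// lef_pV2 ?posrE// mulr_gt0.
rewrite invfM -mulrA ler_pM2l// ler_pM2l ?invr_gt0// invf_div.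
rewrite ler_pdivrMr//.
have {1}-> : M = M `^ (1 - de) * M `^ de.
  by rewrite -powR_split// subrK powRr1// ltW.
by rewrite ler_pM2l ?powR_gt0.
Qed.

(** The differences of order k.+2 are of size T / M^(k+2), between M^(-9/8)
and M^(-1/8) up to constants. The lower end is within the reach of the
hypothesis 1 <= M^5 lam^4, and the upper end provides the saving. *)
Lemma phase_sum_fast (R : realType) (r k : nat) (D Q : R) :
  0 <= D -> 1 <= Q -> exists C eta : R, [/\ 0 < C, 0 < eta <= 1 &
  forall (c : nat -> R) j0 (M : R) s N phi, (j0 < r)%N ->
    (forall j, (j < j0)%N -> c j = 0) ->
    (forall j, (j < r)%N -> `|c j| <= D * c j0) -> 0 < c j0 -> 1 <= M ->
    M <= s%:R -> (s + N)%:R <= Q * M ->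
    M `^ (k%:R + 7 / 8) <= c j0 * M ^- j0.+1 ->
    c j0 * M ^- j0.+1 <= M `^ (k.+1%:R + 7 / 8) ->
    `|\sum_(x < N) cos (phi + 2 * pi * invpoly r c (s + x)%:R)|
      <= C * M `^ (1 - eta)].
Proof.
move=> D0 Q1; have Q0 : 0 < Q := lt_le_trans ltr01 Q1.
have [k1 [k2 [al [M0 [[k10 k20 al1 M01] h]]]]] := pinched_phase r k.+1 D0 Q1.
have [m [C0 C00 hC0]] := higher_difference_test k al1.
have e16 : 0 < 1 / 16 :> R by lra.
have [M1 M11 hM1] := powR_unbounded k2 e16.
have e2 : 0 < 1 / 8 :> R by lra.
have [M2 M21 hM2] := powR_unbounded k1^-1 e2.
pose eta : R := (16 * m.+1%:R)^-1.
have m1 : 1 <= m.+1%:R :> R by rewrite ler1n.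
have eta0 : 0 < eta by rewrite invr_gt0; clear -m1; lra.
have eta1 : eta <= 1 by rewrite invf_le1; clear -m1; lra.
exists (C0 * Q + Q * (M0 + M1 + M2)), eta; split.
- by rewrite addr_gt0 ?mulr_gt0//; clear -M01 M11 M21; lra.
- by rewrite eta0.
move=> c j0 M s N phi j0r cz cD c0 M1' Ms sN T1 T2.
have Mp : 0 < M := lt_le_trans ltr01 M1'.
have Mde : 1 <= M `^ (1 - eta) by apply: powR_ge1; rewrite ?subr_ge0.
have [small|big] := ltP M (M0 + M1 + M2).
  apply: (le_trans (trivial_cos_bound
    (fun x => phi + 2 * pi * invpoly r c (s + x)%:R) N)).
  have : N%:R <= (s + N)%:R :> R by rewrite ler_nat leq_addl.
  have : Q * M <= Q * (M0 + M1 + M2) by rewrite ler_pM2l// ltW.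
  have : 0 <= C0 * Q * M `^ (1 - eta) by rewrite !mulr_ge0 ?powR_ge0 ?(ltW C00) ?(ltW Q0).
  have : Q * (M0 + M1 + M2) <= Q * (M0 + M1 + M2) * M `^ (1 - eta).
    by rewrite ler_peMr// mulr_ge0 ?(ltW Q0)//; clear -M01 M11 M21; lra.
  rewrite (mulrDl (C0 * Q)); clear -sN; lra.
have hM0 : M0 <= M by clear -big M11 M21; lra.
have hM1' : M1 <= M by clear -big M01 M21; lra.
have hM2' : M2 <= M by clear -big M01 M11; lra.
have [v [lam [vE vp /andP[l1 l2]]]] := h c j0 M s N phi j0r cz cD c0 hM0 Ms sN.
have -> : \sum_(x < N) cos (phi + 2 * pi * invpoly r c (s + x)%:R)
    = \sum_(x < N) cos (v x) by apply: eq_bigr => x _; rewrite vE.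
move: l1 l2; set T := c j0 * M ^- j0.+1 in T1 T2 * => l1 l2.
have Mk : M ^- k.+2 = M `^ (- (k.+1%:R + 1)) by rewrite natr1 powRN powR_mulrn// ltW.
have u1 : M `^ (- (9 / 8)) <= T * M ^- k.+2.
  rewrite Mk; have -> : - (9 / 8) = (k%:R + 7 / 8) + - (k.+1%:R + 1) :> R.
    by rewrite -natr1; clear; lra.
  by rewrite powR_split// ler_pM2r ?powR_gt0.
have u2 : T * M ^- k.+2 <= M `^ (- (1 / 8)).
  rewrite Mk; have -> : - (1 / 8) = (k.+1%:R + 7 / 8) + - (k.+1%:R + 1) :> R.
    by clear; lra.
  by rewrite powR_split// ler_pM2r ?powR_gt0.
pose y := M `^ (- eta).
have y0 : 0 < y by rewrite powR_gt0.
have l0 : 0 < lam.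
  by apply: lt_le_trans l1; rewrite mulr_gt0// (lt_le_trans _ u1)// powR_gt0.
have -> : (C0 * Q + Q * (M0 + M1 + M2)) * M `^ (1 - eta) =
    C0 * (Q * M * y) + Q * (M0 + M1 + M2) * M `^ (1 - eta).
  by rewrite powR_split// powRr1 ?(ltW Mp)// /y; ring.
rewrite ler_wpDr//.
  rewrite mulr_ge0 ?powR_ge0// mulr_ge0 ?(ltW Q0)//.
  by clear -M01 M11 M21; lra.
apply: (hC0 v _ _ lam) => //.
- by apply: le_trans sN; rewrite ler_nat leq_addl.
- by rewrite -[leLHS]mulr1 ler_pM.
- by rewrite y0 /y powRN invf_le1 ?powR_gt0// powR_ge1// ltW.
- apply: (le_trans l2).
  have -> : y ^+ m.+1 = M `^ (- (1 / 16)).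
    rewrite -powR_mulrn ?(ltW y0)// /y -powRrM; congr (_ `^ _).
    by rewrite /eta; field; rewrite gt_eqF//; clear -m1; lra.
  apply: (@le_trans _ _ (M `^ (1 / 16) * M `^ (- (1 / 8)))).
    apply: ler_pM => //; [exact: ltW| |exact: hM1].
    by apply: le_trans u1; rewrite powR_ge0.
  rewrite -powR_split// le_eqVlt; apply/orP; left; apply/eqP.
  by congr (_ `^ _); clear; lra.
- have hl : k1 * M `^ (- (9 / 8)) <= lam.
    by apply: le_trans l1; rewrite ler_pM2l.
  have hl4 : k1 ^+ 4 * M `^ (- (9 / 2)) <= lam ^+ 4.
    have -> : k1 ^+ 4 * M `^ (- (9 / 2)) = (k1 * M `^ (- (9 / 8))) ^+ 4.
      rewrite exprMn -[X in _ = _ * X]powR_mulrn ?powR_ge0// -powRrM.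
      by congr (_ * _ `^ _); clear; lra.
    by rewrite lerXn2r ?nnegrE ?mulr_ge0 ?powR_ge0 ?(ltW k10) ?(ltW l0).
  have hk : 1 <= (k1 * M `^ (1 / 8)) ^+ 4.
    by rewrite exprn_ege1// -ler_pdivrMl// mulr1; exact: hM2.
  apply: (le_trans hk).
  have -> : (k1 * M `^ (1 / 8)) ^+ 4 = M ^+ 5 * (k1 ^+ 4 * M `^ (- (9 / 2))).
    rewrite exprMn -[X in _ * X = _]powR_mulrn ?powR_ge0// -powRrM.
    rewrite mulrCA -[M ^+ 5]powR_mulrn ?(ltW Mp)// -powR_split//.
    by congr (_ * _ `^ _); clear; lra.
  apply: ler_pM => //; rewrite ?exprn_ge0 ?(ltW Mp)//.
    by rewrite mulr_ge0 ?powR_ge0// exprn_ge0// ltW.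
  rewrite exprMn ler_peMl ?exprn_ge0 ?(ltW Mp)//.
  by rewrite exprn_ege1.
Qed.

(** The ranges of phase_sum_slow and of phase_sum_fast for successive orders
cover [M^de, M^(k + 7/8)] without gaps. *)
Lemma phase_sum_bound_pos (R : realType) (r k : nat) (D Q de : R) :
  0 <= D -> 1 <= Q -> 0 < de <= 1 ->
  exists C eta : R, [/\ 0 < C, 0 < eta <= 1 &
  forall (c : nat -> R) j0 (M : R) s N phi, (j0 < r)%N ->
    (forall j, (j < j0)%N -> c j = 0) ->
    (forall j, (j < r)%N -> `|c j| <= D * c j0) -> 0 < c j0 -> 1 <= M ->
    M <= s%:R -> (s + N)%:R <= Q * M ->
    M `^ de <= c j0 * M ^- j0.+1 ->
    c j0 * M ^- j0.+1 <= M `^ (k%:R + 7 / 8) ->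
    `|\sum_(x < N) cos (phi + 2 * pi * invpoly r c (s + x)%:R)|
      <= C * M `^ (1 - eta)].
Proof.
move=> D0 Q1 hde; elim: k => [|k [C1 [e1 [C10 e10 h1]]]].
  have [C C0 hC] := phase_sum_slow r D0 Q1 hde.
  by exists C, de; split=> //; rewrite add0r.
have [C2 [e2 [C20 e20 h2]]] := phase_sum_fast r k D0 Q1.
exists (C1 + C2), (Num.min e1 e2); split.
- exact: addr_gt0.
- move: e10 e20 => /andP[p1 q1] /andP[p2 q2].
  by rewrite lt_min p1 p2 ge_min q1.
move=> c j0 M s N phi j0r cz cD c0 M1 Ms sN T1 T2.
have mono e : Num.min e1 e2 <= e -> M `^ (1 - e) <= M `^ (1 - Num.min e1 e2).
  by move=> h; rewrite ler_powR// lerD2l lerN2.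
have [T3|T3] := leP (c j0 * M ^- j0.+1) (M `^ (k%:R + 7 / 8)).
  apply: (le_trans (h1 c j0 M s N phi j0r cz cD c0 M1 Ms sN T1 T3)).
  apply: ler_pM; rewrite ?powR_ge0 ?(ltW C10)//; first by rewrite lerDl ltW.
  by apply: mono; rewrite ge_min lexx.
apply: (le_trans (h2 c j0 M s N phi j0r cz cD c0 M1 Ms sN (ltW T3) T2)).
apply: ler_pM; rewrite ?powR_ge0 ?(ltW C20)//; first by rewrite lerDr ltW.
by apply: mono; rewrite ge_min lexx orbT.
Qed.

Lemma phase_sum_bound (R : realType) (r k : nat) (D Q de : R) :
  0 <= D -> 1 <= Q -> 0 < de <= 1 ->
  exists C eta : R, [/\ 0 < C, 0 < eta <= 1 &
  forall (c : nat -> R) j0 (M : R) s N phi, (j0 < r)%N ->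
    (forall j, (j < j0)%N -> c j = 0) ->
    (forall j, (j < r)%N -> `|c j| <= D * `|c j0|) -> 1 <= M ->
    M <= s%:R -> (s + N)%:R <= Q * M ->
    M `^ de <= `|c j0| * M ^- j0.+1 ->
    `|c j0| * M ^- j0.+1 <= M `^ (k%:R + 7 / 8) ->
    `|\sum_(x < N) cos (phi + 2 * pi * invpoly r c (s + x)%:R)|
      <= C * M `^ (1 - eta)].
Proof.
move=> D0 Q1 hde.
have [C [e [C0 e0 h]]] := phase_sum_bound_pos r k D0 Q1 hde.
exists C, e; split=> // c j0 M s N phi j0r cz cD M1 Ms sN T1 T2.
have Mp : 0 < M by rewrite (lt_le_trans _ M1).
have cn0 : c j0 != 0.
  apply/eqP => c0; move: T1; rewrite c0 normr0 mul0r leNgt.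
  by rewrite powR_gt0.
have [cneg|cpos] := ltP (c j0) 0; last first.
  rewrite ger0_norm// in cD T1 T2.
  by apply: (h c j0) => //; rewrite lt_neqAle eq_sym cn0.
rewrite ltr0_norm// in cD T1 T2.
have := h (fun j => - c j) j0 M s N (- phi) j0r.
have -> : \sum_(x < N) cos (- phi + 2 * pi * invpoly r (fun j => - c j) (s + x)%:R)
    = \sum_(x < N) cos (phi + 2 * pi * invpoly r c (s + x)%:R).
  apply: eq_bigr => x _; rewrite -cosN opprD opprK -mulrN; congr (cos (_ + _ * _)).
  by rewrite /invpoly -sumrN; apply: eq_bigr => j _; rewrite mulNr opprK.
apply=> //.
- by move=> j jj0; rewrite cz// oppr0.
- by move=> j jr; rewrite normrN cD.
- by rewrite oppr_gt0.
Qed.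

(** * The Moebius, von Mangoldt and divisor functions *)

(** A term G (d l) is the sum of G k over the single k = d l. For d = 0 both
sides vanish as G 0 = 0. *)
Lemma sum_multiples (R : realType) (G : nat -> R) (X d : nat) :
  G 0 = 0 -> (forall m, (X < m)%N -> G m = 0) ->
  \sum_(l < X.+1) G (d * l)%N = \sum_(k < X.+1 | (d %| k)%N) G k.
Proof.
move=> G0 GX; have [->|d0] := posnP d.
  rewrite big1; last by move=> i _; rewrite mul0n.
  by rewrite big1// => i; rewrite dvd0n => /eqP ->.
have E l : G (d * l)%N = \sum_(k < X.+1 | k == (d * l)%N :> nat) G k.
  have [h|h] := ltnP (d * l) X.+1.
    by rewrite (big_pred1 (Ordinal h)).
  rewrite GX// big1// => k /eqP kE; have := ltn_ord k.
  by rewrite kE ltnNge h.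
under eq_bigr => l _ do rewrite E.
rewrite (exchange_big_dep (fun k : 'I_X.+1 => (d %| k)%N)) /=; last first.
  by move=> l k _ /eqP ->; rewrite dvdn_mulr.
apply: eq_bigr => k dk.
have h : (k %/ d < X.+1)%N by rewrite (leq_ltn_trans (leq_div _ _)).
rewrite (big_pred1 (Ordinal h))//= => l /=.
by rewrite -[RHS]val_eqE /= eqn_div// eq_sym mulnC.
Qed.

(** Dirichlet convolutions with 1 only ever occur tested against a function
G. The two conditions on G make the range [0, X] valid for all variables at
once: products beyond X do not count, and neither does 0. *)
Lemma sum_dvd_conv (R : realType) (a G : nat -> R) (X : nat) :
  G 0 = 0 -> (forall m, (X < m)%N -> G m = 0) ->
  \sum_(d < X.+1) \sum_(l < X.+1) a d * G (d * l)%N =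
  \sum_(k < X.+1) (\sum_(d <- divisors k) a d) * G k.
Proof.
move=> G0 GX.
under eq_bigr => d _ do rewrite -mulr_sumr sum_multiples// mulr_sumr.
rewrite (exchange_big_dep xpredT)//=; apply: eq_bigr => k _.
have [->|k0] := posnP k.
  by rewrite G0 mulr0 big1// => i _; rewrite mulr0.
rewrite mulr_suml.
have -> : \sum_(d <- divisors k) a d * G k = \sum_(d <- iota 0 X.+1 | (d %| k)%N) a d * G k.
  rewrite -[RHS]big_filter; apply: perm_big; apply: uniq_perm.
  - exact: divisors_uniq.
  - by rewrite filter_uniq// iota_uniq.
  - move=> d; rewrite mem_filter mem_iota add0n -dvdn_divisors//=.
    have [dk|//] := boolP (d %| k)%N.
    by rewrite (leq_ltn_trans (dvdn_leq k0 dk)).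
have -> : iota 0 X.+1 = index_iota 0 X.+1 by rewrite /index_iota subn0.
by rewrite big_mkord.
Qed.

Definition mobius (R : realType) (n : nat) : R :=
  \prod_(q <- primes n) (if logn q n == 1%N then -1 else 0).

Lemma mobius_norm (R : realType) n : `|mobius R n| <= 1.
Proof.
rewrite /mobius normr_prod; elim: (primes n) => [|q s IH]; first by rewrite big_nil.
rewrite big_cons; apply: (@le_trans _ _ (1 * 1)); last by rewrite mulr1.
apply: ler_pM => //; first by rewrite prodr_ge0.
by case: (logn q n == 1)%N; rewrite ?normrN1 ?normr0.
Qed.

(** The prime p has exponent 1 in p d exactly when it does not divide d. *)
Lemma mobius_prime_mul (R : realType) p d : prime p -> (0 < d)%N ->
  mobius R (p * d) = if (p %| d)%N then 0 else - mobius R d.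
Proof.
move=> pp d0; have p0 := prime_gt0 pp.
have plog q : logn q (p * d) = ((q == p) + logn q d)%N.
  by rewrite lognM// logn_prime// eq_sym.
have [pd|pd] := boolP (p %| d)%N.
  apply/eqP; rewrite /mobius prodf_seq_eq0; apply/hasP; exists p.
    by rewrite mem_primes pp muln_gt0 p0 d0 dvdn_mulr.
  have : (0 < logn p d)%N by rewrite logn_gt0 mem_primes pp d0.
  by rewrite /= plog eqxx; case: (logn p d).
have pr : perm_eq (primes (p * d)) (p :: primes d).
  apply: uniq_perm; rewrite ?primes_uniq//=.
    by rewrite primes_uniq mem_primes (negPf pd) !andbF.
  by move=> q; rewrite primesM// primes_prime// !inE.
rewrite /mobius (perm_big _ pr) big_cons plog eqxx.
have -> : logn p d = 0%N by apply/eqP; rewrite -leqn0 leqNgt logn_gt0 mem_primes (negPf pd) !andbF.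
rewrite addn0 /= mulN1r; congr (- _); apply: eq_big_seq => q qd.
have qp : q != p.
  by apply: contraTneq qd => ->; rewrite mem_primes (negPf pd) !andbF.
by rewrite plog (negPf qp).
Qed.

(** For a prime p dividing n, the divisors of n that are multiples of p are
the p d with d dividing n / p; mobius vanishes on them if p divides d, and
otherwise cancels the value at the divisor d of n. *)
Lemma mobius_sum (R : realType) n : (0 < n)%N ->
  \sum_(d <- divisors n) mobius R d = (n == 1%N)%:R.
Proof.
move=> n0; have [->|n1] := eqVneq n 1%N.
  by rewrite (_ : divisors 1 = [:: 1%N])// big_seq1 /mobius big_nil.
have n2 : (1 < n)%N by case: n n0 n1 => [|[|]].
have pp := pdiv_prime n2; have pn := pdiv_dvd n; move: (pdiv n) pp pn => p pp pn.
have p0 := prime_gt0 pp.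
have np0 : (0 < n %/ p)%N by rewrite divn_gt0// dvdn_leq.
rewrite (bigID (fun d => (p %| d)%N))/=.
have -> : \sum_(d <- divisors n | (p %| d)%N) mobius R d =
    \sum_(d <- divisors (n %/ p)) mobius R (p * d).
  rewrite -big_filter -(big_map (muln p) xpredT); apply: perm_big.
  apply: uniq_perm.
  - by rewrite filter_uniq// divisors_uniq.
  - rewrite map_inj_uniq ?divisors_uniq// => x y /eqP.
    by rewrite eqn_pmul2l// => /eqP.
  move=> d; rewrite mem_filter -dvdn_divisors//; apply/andP/mapP.
    move=> [pd dn]; exists (d %/ p)%N; last by rewrite mulnC divnK.
    by rewrite -dvdn_divisors// dvdn_divRL// divnK.
  move=> [e]; rewrite -dvdn_divisors// => en ->; rewrite dvdn_mulr//; split=> //.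
  by rewrite mulnC -dvdn_divRL.
have -> : \sum_(d <- divisors (n %/ p)) mobius R (p * d) =
    - \sum_(d <- divisors (n %/ p) | ~~ (p %| d)%N) mobius R d.
  rewrite -sumrN [RHS]big_mkcond /=; apply: eq_big_seq => d.
  rewrite -dvdn_divisors// => dn; rewrite mobius_prime_mul//.
    by case: ifP.
  exact: dvdn_gt0 dn.
apply/eqP; rewrite addrC subr_eq0; apply/eqP.
rewrite -[LHS]big_filter -[RHS]big_filter; apply: perm_big; apply: uniq_perm.
- by rewrite filter_uniq// divisors_uniq.
- by rewrite filter_uniq// divisors_uniq.
move=> d; rewrite !mem_filter; have [//|pd] := boolP (p %| d)%N.
rewrite /= -!dvdn_divisors//.
have cpd : coprime d p by rewrite coprime_sym prime_coprime.
by rewrite -{1}(divnK pn) Gauss_dvdl.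
Qed.

Lemma mangoldt_le_ln (R : realType) m : 0 <= mangoldt R m <= ln m%:R.
Proof.
have [[p [k [pp k0 ->]]]|h] := EM (exists p k, [/\ prime p, (0 < k)%N & m = (p ^ k)%N]).
  have p1 : 1 <= p%:R :> R by rewrite ler1n prime_gt0.
  rewrite mangoldtX// ln_ge0//= ler_ln ?posrE ?ltr0n ?expn_gt0 ?prime_gt0//.
  by rewrite ler_nat -{1}(expn1 p) leq_exp2l// prime_gt1.
rewrite mangoldt_eq0// lexx /=; case: m h => [|m] _.
  by rewrite ln0.
by rewrite ln_ge0// ler1n.
Qed.

(** By induction on n = m p: the only prime power dividing n but not m is
p^(v+1), v being the exponent of p in m, and it contributes ln p. *)
Lemma mangoldt_sum (R : realType) n : (0 < n)%N ->
  \sum_(d <- divisors n) mangoldt R d = ln n%:R.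
Proof.
elim/ltn_ind: n => n IH n0; have [->|n1] := eqVneq n 1%N.
  rewrite (_ : divisors 1 = [:: 1%N])// big_seq1 ln1.
  by apply/eqP; rewrite eq_le; have := mangoldt_le_ln R 1; rewrite ln1 andbC.
have n2 : (1 < n)%N by case: n n0 n1 {IH} => [|[|]].
have pp := pdiv_prime n2; have pn := pdiv_dvd n; move: (pdiv n) pp pn => p pp pn.
have p0 := prime_gt0 pp; have p1 := prime_gt1 pp.
pose m := (n %/ p)%N.
have m0 : (0 < m)%N by rewrite divn_gt0// dvdn_leq.
have mn : (m < n)%N by rewrite ltn_Pdiv.
have nE : n = (m * p)%N by rewrite divnK.
have mdn : (m %| n)%N by rewrite nE dvdn_mulr.
rewrite nE natrM lnM ?posrE ?ltr0n// -(IH m)//.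
rewrite -nE (bigID (fun d => (d %| m)%N))/=; congr (_ + _).
  rewrite -[LHS]big_filter; apply: perm_big; apply: uniq_perm.
  - by rewrite filter_uniq// divisors_uniq.
  - exact: divisors_uniq.
  move=> d; rewrite mem_filter -!dvdn_divisors//.
  by have [dm|//] := boolP (d %| m)%N; rewrite (dvdn_trans dm).
pose v := logn p m; pose q := (p ^ v.+1)%N.
have qn : (q %| n)%N.
  by rewrite pfactor_dvdn// nE lognM// (logn_prime _ pp) eqxx addn1.
have qm : ~~ (q %| m)%N by rewrite pfactor_dvdn// ltnn.
rewrite -big_filter (bigD1_seq q)/=; last 2 first.
- by rewrite mem_filter qm -dvdn_divisors.
- by rewrite filter_uniq// divisors_uniq.
rewrite mangoldtX// big_filter_cond big1_seq ?addr0//= => d.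
rewrite -dvdn_divisors// => /andP[/andP[dm dq] dn].
apply: mangoldt_eq0 => -[l [k [pl k0 dE]]].
have [lp|lp] := eqVneq l p.
  move: dm dq dn; rewrite dE lp !pfactor_dvdn// nE lognM// (logn_prime _ pp) eqxx addn1 -ltnNge -/v.
  by move=> vk kq kv; case/eqP: kq; congr (p ^ _)%N; apply/eqP; rewrite eqn_leq kv.
move: dm dn; rewrite dE nE Gauss_dvdl ?coprimeXl//; first by move=> /negPf->.
by rewrite prime_coprime// dvdn_prime2.
Qed.

Definition tau (R : realType) (k : nat) : R := (size (divisors k))%:R.

(** Each divisor d of m n is a product of the divisor gcd (d, m) of m and of
a divisor of n. *)
Lemma tauM (R : realType) (m n : nat) : (0 < m)%N -> (0 < n)%N ->
  tau R (m * n) <= tau R m * tau R n.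
Proof.
move=> m0 n0; rewrite /tau -natrM ler_nat -(size_allpairs muln).
apply: uniq_leq_size; first exact: divisors_uniq.
move=> d; rewrite -dvdn_divisors ?muln_gt0 ?m0// => dmn.
apply/allpairsP; exists (gcdn d m, d %/ gcdn d m)%N => /=.
have d0 : (0 < d)%N by rewrite (dvdn_gt0 _ dmn)// muln_gt0 m0.
have g0 : (0 < gcdn d m)%N by rewrite gcdn_gt0 m0 orbT.
rewrite -!dvdn_divisors// dvdn_gcdr mulnC divnK ?dvdn_gcdl//; split=> //.
have cop : coprime (d %/ gcdn d m) (m %/ gcdn d m).
  by rewrite /coprime -(eqn_pmul2r g0) mul1n muln_gcdl !divnK ?dvdn_gcdl ?dvdn_gcdr.
rewrite -(Gauss_dvdr _ cop) -(dvdn_pmul2r g0) divnK ?dvdn_gcdl//.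
by rewrite mulnAC divnK ?dvdn_gcdr.
Qed.

(** The term k = 0 is 0^-1 = 0. *)
Definition harmonic_sum (R : realType) (X : nat) : R := \sum_(k < X.+1) k%:R^-1.

Lemma harmonic_sum_le (R : realType) X : (0 < X)%N -> harmonic_sum R X <= 1 + ln X%:R.
Proof.
case: X => // X _; elim: X => [|X IH].
  by rewrite /harmonic_sum !big_ord_recr big_ord0 /= invr0 invr1 ln1 !add0r addr0.
rewrite /harmonic_sum big_ord_recr /=; apply: (le_trans (lerD IH (lexx _))).
rewrite -addrA lerD2l.
have x0 : 0 < X.+1%:R :> R by rewrite ltr0n.
have y0 : 0 < X.+2%:R :> R by rewrite ltr0n.
have : ln (1 + (- X.+2%:R^-1)) <= - X.+2%:R^-1 :> R.
  by apply: le_ln1Dx; rewrite ltrN2 invf_lt1// ltr1n.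
have -> : 1 + - X.+2%:R^-1 = X.+1%:R / X.+2%:R :> R.
  by rewrite -[X.+2%:R]natr1; field; rewrite nat1r natr1 gt_eqF.
rewrite ln_div ?posrE//.
move: (ln X.+1%:R) (ln X.+2%:R) (X.+2%:R^-1) => u v w; lra.
Qed.

(** Writing tau k as a sum over k = d l and using tau (d l) <= tau d * tau l
bounds the sum by the square of the sum of tau k / k, which in turn is at
most the square of the harmonic sum. *)
Lemma sum_tau2 (R : realType) X :
  \sum_(k < X.+1) tau R k ^+ 2 / k%:R <= harmonic_sum R X ^+ 4.
Proof.
pose G (w : nat -> R) m := if (m <= X)%N then w m / m%:R else 0.
have G0 w : G w 0%N = 0 by rewrite /G /= invr0 mulr0.
have GX w m : (X < m)%N -> G w m = 0 by rewrite /G ltnNge => /negPf->.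
have conv w : (forall m, 0 <= w m) ->
    \sum_(d < X.+1) \sum_(l < X.+1) 1 * G w (d * l)%N =
    \sum_(k < X.+1) tau R k * w k / k%:R.
  move=> w0; rewrite (sum_dvd_conv (fun=> 1) (G0 w) (GX w)); apply: eq_bigr => k _.
  by rewrite big_const_seq count_predT iter_addr_0 /tau /G -ltnS ltn_ord mulrA.
have tau0 m : 0 <= tau R m by rewrite ler0n.
have S1 : \sum_(k < X.+1) tau R k / k%:R <= harmonic_sum R X ^+ 2.
  have -> : \sum_(k < X.+1) tau R k / k%:R = \sum_(k < X.+1) tau R k * 1 / k%:R.
    by apply: eq_bigr => k _; rewrite mulr1.
  rewrite -(conv (fun=> 1))// /harmonic_sum expr2 big_distrlr /=.
  apply: ler_sum => d _; apply: ler_sum => l _.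
  rewrite mul1r /G; case: ifP => _; last by rewrite mulr_ge0 ?invr_ge0.
  by rewrite natrM invfM mul1r.
have -> : \sum_(k < X.+1) tau R k ^+ 2 / k%:R = \sum_(k < X.+1) tau R k * tau R k / k%:R.
  by apply: eq_bigr => k _; rewrite expr2.
rewrite -(conv (tau R))//.
apply: (@le_trans _ _ ((\sum_(k < X.+1) tau R k / k%:R) ^+ 2)).
  rewrite expr2 big_distrlr /=; apply: ler_sum => d _; apply: ler_sum => l _.
  have z0 : 0 <= tau R d / d%:R * (tau R l / l%:R).
    by rewrite !mulr_ge0 ?invr_ge0.
  rewrite mul1r /G; case: ifP => // _.
  have [d0|d0] := posnP d; first by rewrite d0 mul0n invr0 mulr0 mul0r.
  have [l0|l0] := posnP l; first by rewrite l0 muln0 invr0 !mulr0.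
  rewrite mulrACA natrM -invfM ler_wpM2r ?invr_ge0 ?mulr_ge0//.
  exact: tauM.
have S0 : 0 <= \sum_(k < X.+1) tau R k / k%:R.
  by rewrite sumr_ge0// => k _; rewrite mulr_ge0 ?invr_ge0.
rewrite (_ : harmonic_sum R X ^+ 4 = (harmonic_sum R X ^+ 2) ^+ 2); last by rewrite -exprM.
by rewrite lerXn2r ?nnegrE// exprn_ge0// /harmonic_sum sumr_ge0.
Qed.

(** A prime power p^k <= X with k >= 2 has p < s and k < e. *)
Lemma sum_nonprime_mangoldt (R : realType) X s e :
  (X < s ^ 2)%N -> (X < 2 ^ e)%N ->
  \sum_(m < X.+1 | ~~ prime m) mangoldt R m <= (s * e)%:R * ln X%:R.
Proof.
move=> Xs Xe.
have [X0|X0] := posnP X.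
  rewrite X0 big_mkcond big_ord_recr big_ord0 /= add0r ln0// mulr0.
  have /andP[_] := mangoldt_le_ln R 0; by rewrite ln0.
pose L := [seq (x.1 ^ x.2)%N | x <- [seq (p, k) | p <- iota 0 s, k <- iota 0 e]].
pose P := [seq m <- iota 0 X.+1 | ~~ prime m & mangoldt R m != 0].
have lX : 0 <= ln X%:R :> R by rewrite ln_ge0// ler1n.
have PL : (size P <= s * e)%N.
  have -> : (s * e = size L)%N by rewrite size_map size_allpairs !size_iota.
  apply: uniq_leq_size; first by rewrite filter_uniq// iota_uniq.
  move=> m; rewrite mem_filter mem_iota add0n /= ltnS => /andP[/andP[np lm] mX].
  have [[p [k [pp k0 mE]]]|h] := EM (exists p k, [/\ prime p, (0 < k)%N & m = (p ^ k)%N]); last first.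
    by rewrite mangoldt_eq0 ?eqxx in lm.
  have k2 : (1 < k)%N.
    by case: k k0 mE => [|[|]]// _ mE; move: np; rewrite mE expn1 pp.
  apply/mapP; exists (p, k) => //; apply/allpairsP; exists (p, k) => /=.
  rewrite !mem_iota !add0n /=; split=> //.
    rewrite -ltn_sqr; apply: leq_ltn_trans Xs; apply: leq_trans mX.
    by rewrite mE leq_pexp2l// prime_gt0.
  rewrite -(@ltn_exp2l 2)//; apply: leq_ltn_trans Xe; apply: leq_trans mX.
  by rewrite mE leq_exp2r ?prime_gt1.
have -> : \sum_(m < X.+1 | ~~ prime m) mangoldt R m = \sum_(m <- P) mangoldt R m.
  rewrite big_filter -(big_mkord (fun m => ~~ prime m)) /index_iota subn0.
  rewrite big_mkcond [RHS]big_mkcond /=; apply: eq_bigr => m _.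
  by case: (prime m) => //=; case: eqP.
apply: (@le_trans _ _ (\sum_(m <- P) ln X%:R)).
  rewrite big_seq [leRHS]big_seq; apply: ler_sum => m.
  rewrite mem_filter mem_iota add0n /= ltnS => /andP[_ mX].
  have /andP[_ h] := mangoldt_le_ln R m; apply: (le_trans h).
  have [->|m0] := posnP m; first by rewrite ln0.
  by rewrite ler_ln ?posrE ?ltr0n// ler_nat.
by rewrite big_const_seq count_predT iter_addr_0 -[leLHS]mulr_natl ler_wpM2r// ler_nat.
Qed.

(** * Vaughan's identity *)

Definition mobius_tail (R : realType) (V d : nat) : R :=
  if (V < d)%N then mobius R d else 0.

Definition mobius_head (R : realType) (V d : nat) : R :=
  if (d <= V)%N then mobius R d else 0.

Definition mangoldt_head (R : realType) (U d : nat) : R :=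
  if (d <= U)%N then mangoldt R d else 0.

Definition mangoldt_tail (R : realType) (U d : nat) : R :=
  if (U < d)%N then mangoldt R d else 0.

(** With Lambda = mangoldt_head + mangoldt_tail and mobius = mobius_head +
mobius_tail, as F vanishes up to U only the values of mangoldt_tail matter on
the left; convolve it with mobius * 1 = delta and split mobius. In the part
mobius_head * mangoldt_tail * 1 write mangoldt_tail = Lambda - mangoldt_head
and use Lambda * 1 = ln. *)
Lemma vaughan (R : realType) (F : nat -> R) (X U V : nat) :
  F 0 = 0 -> (forall m, (X < m)%N -> F m = 0) ->
  (forall m, (m <= U)%N -> F m = 0) ->
  \sum_(m < X.+1) mangoldt R m * F m =
    \sum_(d < X.+1) mobius_head R V d * (\sum_(k < X.+1) F (d * k)%N * ln k%:R)
  - \sum_(d < X.+1) \sum_(c < X.+1) mobius_head R V d * mangoldt_head R U c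
      * (\sum_(l < X.+1) F (d * c * l)%N)
  + \sum_(k < X.+1) (\sum_(d <- divisors k) mobius_tail R V d)
      * (\sum_(c < X.+1) mangoldt_tail R U c * F (c * k)%N).
Proof.
move=> F0 FX FU.
have FM q m : (0 < q)%N -> (X < m)%N -> F (q * m)%N = 0.
  by move=> q0 Xm; rewrite FX// (leq_trans Xm)// leq_pmull.
have FM' q m : (X < m)%N -> F (q * m)%N = 0.
  by case: (posnP q) => [->|q0]; [rewrite mul0n F0|exact: FM].
have FM0 q : F (q * 0)%N = 0 by rewrite muln0.
have S0 : \sum_(m < X.+1) mangoldt R m * F m =
    \sum_(c < X.+1) mangoldt_tail R U c *
      \sum_(d < X.+1) \sum_(l < X.+1) mobius R d * F (c * (d * l))%N.
  apply: eq_bigr => c _; rewrite /mangoldt_tail.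
  case: ltnP => [Uc|cU]; last by rewrite FU// mulr0 mul0r.
  congr (_ * _); have c0 : (0 < c)%N by exact: leq_ltn_trans Uc.
  rewrite (sum_dvd_conv (mobius R) (FM0 c) (FM' c)).
  have X1 : (1 < X.+1)%N by exact: leq_ltn_trans (ltn_ord c).
  rewrite (bigD1 (Ordinal X1))//= mobius_sum// eqxx mul1r muln1.
  rewrite big1 ?addr0// => k k1; have [->|k0] := posnP k.
    by rewrite FM0 mulr0.
  rewrite mobius_sum//; have -> : (k == 1%N :> nat) = false.
    by apply/negbTE; apply: contraNneq k1 => h; apply/eqP/val_inj.
  by rewrite mul0r.
rewrite S0.
have S1 : \sum_(d < X.+1) mobius_head R V d * (\sum_(k < X.+1) F (d * k)%N * ln k%:R)
  = \sum_(d < X.+1) \sum_(c < X.+1) \sum_(l < X.+1)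
      mobius_head R V d * mangoldt R c * F (c * (d * l))%N.
  apply: eq_bigr => d _.
  have -> : \sum_(k < X.+1) F (d * k)%N * ln k%:R =
      \sum_(k < X.+1) (\sum_(e <- divisors k) mangoldt R e) * F (d * k)%N.
    apply: eq_bigr => k _; have [->|k0] := posnP k.
      by rewrite FM0 mulr0 mul0r.
    by rewrite mangoldt_sum// mulrC.
  rewrite -(sum_dvd_conv (mangoldt R) (FM0 d) (FM' d)) mulr_sumr.
  apply: eq_bigr => c _; rewrite mulr_sumr; apply: eq_bigr => l _.
  by rewrite -mulrA mulnCA.
have S3 : \sum_(k < X.+1) (\sum_(d <- divisors k) mobius_tail R V d)
      * (\sum_(c < X.+1) mangoldt_tail R U c * F (c * k)%N)
  = \sum_(d < X.+1) \sum_(c < X.+1) \sum_(l < X.+1)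
      mobius_tail R V d * mangoldt_tail R U c * F (c * (d * l))%N.
  under eq_bigr => k _ do rewrite mulr_sumr.
  rewrite exchange_big [RHS]exchange_big /=; apply: eq_bigr => c _.
  under eq_bigr => k _ do rewrite mulrCA.
  rewrite -mulr_sumr -(sum_dvd_conv (mobius_tail R V) (FM0 c) (FM' c)) mulr_sumr.
  apply: eq_bigr => d _; rewrite mulr_sumr; apply: eq_bigr => l _.
  by rewrite mulrA [X in X * _]mulrC.
rewrite S1 S3 -sumrB -big_split /=.
under eq_bigr do rewrite mulr_sumr.
rewrite exchange_big /=; apply: eq_bigr => d _.
rewrite -sumrB -big_split /=; apply: eq_bigr => c _.
rewrite !mulr_sumr -sumrB -big_split /=; apply: eq_bigr => l _.
have -> : (d * c * l = c * (d * l))%N by rewrite -mulnA mulnCA.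
have -> : mangoldt R c = mangoldt_head R U c + mangoldt_tail R U c.
  by rewrite /mangoldt_head /mangoldt_tail; case: leqP; rewrite ?addr0 ?add0r.
have -> : mobius R d = mobius_head R V d + mobius_tail R V d.
  by rewrite /mobius_head /mobius_tail; case: leqP; rewrite ?addr0 ?add0r.
ring.
Qed.

Definition ceildiv (i q : nat) : nat := ((i + q.-1) %/ q)%N.

(** Hence the k with i1 <= q k < i2 form the interval [ceildiv i1 q, ceildiv
i2 q). *)
Lemma ceildiv_le i q k : (0 < q)%N -> (ceildiv i q <= k)%N = (i <= q * k)%N.
Proof.
move=> q0; rewrite /ceildiv -ltnS ltn_divLR// mulSn mulnC.
by rewrite -(prednK q0) [RHS]/= -ltnS; apply/idP/idP; lia.
Qed.

Lemma ceildiv_gt i q k : (0 < q)%N -> (k < ceildiv i q)%N = (q * k < i)%N.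
Proof. by move=> q0; rewrite ltnNge ceildiv_le// -ltnNge. Qed.

Lemma sum_interval (R : realType) (g : nat -> R) (n s1 s2 : nat) :
  \sum_(k < n) (if (s1 <= k < s2)%N then g k else 0)
  = \sum_(x < minn n s2 - s1) g (s1 + x)%N.
Proof.
rewrite -(big_mkord xpredT (fun k => if (s1 <= k < s2)%N then g k else 0)).
rewrite -(big_mkord xpredT (fun x => g (s1 + x)%N)).
have [h|h] := leqP (minn n s2) s1.
  have -> : (minn n s2 - s1 = 0)%N by apply/eqP; rewrite subn_eq0.
  rewrite [RHS]big_geq// big_nat big1// => i /andP[_ ni].
  by case: ifP => //; move: h; rewrite geq_min; lia.
rewrite (@big_cat_nat _ _ _ s1)//=; last by move: h; rewrite leq_min; lia.
rewrite big_nat big1 ?add0r; last first.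
  by move=> i /andP[_ hi]; rewrite leqNgt hi.
rewrite (@big_cat_nat _ _ _ (minn n s2))//=; [|exact: ltnW|exact: geq_minl].
rewrite [X in _ + X]big_nat [X in _ + X]big1 ?addr0; last first.
  by move=> i /andP[]; rewrite geq_min => hi ni; case: ifP => //; lia.
rewrite -[X in \sum_(X <= _ < _) _]add0n big_addn !big_nat.
apply: eq_bigr => i /andP[_ hi].
have -> : (s1 <= i + s1 < s2)%N by move: hi; lia.
by rewrite addnC.
Qed.

Lemma count_below (R : realType) (z : R) (n : nat) : 0 <= z ->
  \sum_(d < n | d%:R < z) 1 <= z + 1.
Proof.
move=> z0; have : \sum_(d < n | d%:R < z) 1 <= z + 1 /\ \sum_(d < n | d%:R < z) 1 <= n%:R :> R.
  elim: n => [|n [h1 h2]]; first by rewrite big_ord0; split; lra.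
  rewrite !big_mkcond !big_ord_recr -!big_mkcond /=.
  case: ifP => nz; split; rewrite -?natr1; lra.
by case.
Qed.

(** * Exponential sums of type I and type II *)

(** phase_sum_bound for all M between P^(1/4) and P, with the saving
expressed as a power of P; both the interval and the truncation k < n are
arbitrary, as required by summation by parts. *)
Lemma interval_phase (R : realType) (r A : nat) (D de : R) :
  0 <= D -> 0 < de <= 1 -> exists C eta : R, [/\ 0 < C, 0 < eta <= 1 &
  forall (c : nat -> R) j0 (M P phi : R) (s1 s2 n : nat), (j0 < r)%N ->
    (forall j, (j < j0)%N -> c j = 0) ->
    (forall j, (j < r)%N -> `|c j| <= D * `|c j0|) ->
    1 <= P -> P `^ (1 / 4) <= M -> M <= P ->
    M <= s1%:R -> s2%:R <= 2 * M + 1 ->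
    P `^ de <= `|c j0| * M ^- j0.+1 -> `|c j0| * M ^- j0.+1 <= P ^+ A ->
    `|\sum_(k < n) (if (s1 <= k < s2)%N
        then cos (phi + 2 * pi * invpoly r c k%:R) else 0)|
      <= C * (M * P `^ (- eta))].
Proof.
move=> D0 hde; have Q1 : 1 <= 3 :> R by lra.
have [C [e [C0 /andP[e0 e1] h]]] := phase_sum_bound r (4 * A) D0 Q1 hde.
exists C, (e / 4); split; [by []|by lra|].
move=> c j0 M P phi s1 s2 n j0r cz cD P1 PM MP Ms sM T1 T2.
have P0 : 0 < P by lra.
have M1 : 1 <= M by apply: le_trans PM; apply: powR_ge1 => //; lra.
have M0 : 0 < M by lra.
have PM4 : P <= M ^+ 4.
  have -> : P = (P `^ (1 / 4)) ^+ 4.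
    rewrite -powR_mulrn ?powR_ge0// -powRrM.
    have -> : 1 / 4 * 4%:R = 1 :> R by lra.
    by rewrite powRr1// ltW.
  by rewrite lerXn2r ?nnegrE ?powR_ge0// ltW.
rewrite (sum_interval (fun k => cos (phi + 2 * pi * invpoly r c k%:R))).
set N := (minn n s2 - s1)%N.
have [N0|Npos] := posnP N.
  by rewrite N0 big_ord0 normr0 !mulr_ge0 ?powR_ge0// ltW.
have sN : (s1 + N)%:R <= 3 * M.
  apply: (@le_trans _ _ (2 * M + 1)); last lra.
  apply: le_trans sM; rewrite ler_nat /N subnKC ?geq_minr//.
  by rewrite ltnW// -subn_gt0.
apply: (le_trans (h c j0 M s1 N phi j0r cz cD M1 Ms sN _ _)).
- apply: le_trans T1; case/andP: hde => de0 _.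
  by rewrite ge0_ler_powR ?nnegrE ?(ltW de0) ?(ltW M0) ?(ltW P0).
- apply: (le_trans T2); apply: (@le_trans _ _ ((M ^+ 4) ^+ A)).
    by rewrite lerXn2r ?nnegrE ?exprn_ge0 ?(ltW P0) ?(ltW M0).
  rewrite -exprM -powR_mulrn ?(ltW M0)//; apply: ler_powR => //; lra.
rewrite ler_pM2l// powR_split// powRr1 ?(ltW M0)// ler_pM2l//.
rewrite !powRN lef_pV2 ?posrE ?powR_gt0//.
have -> : e / 4 = 1 / 4 * e by lra.
by rewrite powRrM ge0_ler_powR ?nnegrE ?powR_ge0 ?(ltW e0) ?(ltW M0).
Qed.

Lemma invpoly_scale (R : realType) r (c : nat -> R) (q k : R) :
  invpoly r c (q * k) = invpoly r (fun j => c j * q ^- j.+1) k.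
Proof. by apply: eq_bigr => j _; rewrite exprMn invfM mulrA. Qed.

Lemma subrX_le (R : realType) (y z : R) n : 0 <= z -> z <= y ->
  y ^+ n.+1 - z ^+ n.+1 <= n.+1%:R * (y - z) * y ^+ n.
Proof.
move=> z0 zy; have y0 : 0 <= y := le_trans z0 zy.
elim: n => [|n IH]; first by rewrite !expr1 expr0 !mulr1 mul1r.
have -> : y ^+ n.+2 - z ^+ n.+2 = y * (y ^+ n.+1 - z ^+ n.+1) + (y - z) * z ^+ n.+1.
  by rewrite ![_ ^+ n.+2]exprS; ring.
have h1 : z ^+ n.+1 <= y ^+ n.+1 by rewrite lerXn2r ?nnegrE.
have := ler_wpM2l y0 IH; have yz0 : 0 <= y - z by rewrite subr_ge0.
have := ler_wpM2l yz0 h1.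
have -> : y * (n.+1%:R * (y - z) * y ^+ n) = n.+1%:R * ((y - z) * y ^+ n.+1).
  by rewrite exprS; ring.
have -> : n.+2%:R * (y - z) * y ^+ n.+1 = n.+1%:R * ((y - z) * y ^+ n.+1) + (y - z) * y ^+ n.+1.
  by rewrite -[n.+2%:R]natr1; ring.
lra.
Qed.

Lemma subrX_ge (R : realType) (y z : R) n : 0 <= z -> z <= y ->
  (y - z) * y ^+ n <= y ^+ n.+1 - z ^+ n.+1.
Proof.
move=> z0 zy; have y0 : 0 <= y := le_trans z0 zy.
have h : z ^+ n <= y ^+ n by rewrite lerXn2r ?nnegrE.
rewrite !exprS mulrBl lerB// ler_wpM2l//.
Qed.

(** Both sides are of order (y - z) times a power of y, and y <= 1. *)
Lemma subrX_dominated (R : realType) (y z : R) i j : 0 <= z -> z <= y -> y <= 1 ->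
  (i <= j)%N -> y ^+ j.+1 - z ^+ j.+1 <= j.+1%:R * (y ^+ i.+1 - z ^+ i.+1).
Proof.
move=> z0 zy y1 ij; have y0 : 0 <= y := le_trans z0 zy.
apply: (le_trans (subrX_le _ z0 zy)); rewrite -mulrA ler_wpM2l//.
apply: le_trans (subrX_ge _ z0 zy); rewrite ler_wpM2l ?subr_ge0//.
by rewrite ler_wiXn2l.
Qed.

Definition twisted (R : realType) r (c : nat -> R) (phi : R) (i1 i2 m : nat) : R :=
  if (i1 <= m < i2)%N then cos (phi + 2 * pi * invpoly r c m%:R) else 0.

(** The phase k |-> f (q k) has the coefficients c j q^(-j-1), and the same
size on the interval of k, around P / q, as f has around P. *)
Lemma type1_sum (R : realType) (r A : nat) (D de : R) :
  0 <= D -> 0 < de <= 1 -> exists C eta : R, [/\ 0 < C, 0 < eta <= 1 &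
  forall (c : nat -> R) j0 (P phi : R) (i1 i2 q n : nat), (j0 < r)%N ->
    (forall j, (j < j0)%N -> c j = 0) ->
    (forall j, (j < r)%N -> `|c j| <= D * `|c j0|) ->
    1 <= P -> P < i1%:R -> i2%:R <= 2 * P + 1 ->
    P `^ de <= `|c j0| * P ^- j0.+1 -> `|c j0| <= P ^+ A ->
    (0 < q)%N -> P `^ (1 / 4) <= P / q%:R ->
    `|\sum_(k < n) twisted r c phi i1 i2 (q * k)| <= C * (P / q%:R * P `^ (- eta))].
Proof.
move=> D0 hde; have [C [e [C0 e0 h]]] := interval_phase r A D0 hde.
exists C, e; split=> // c j0 P phi i1 i2 q n j0r cz cD P1 Pi iP T1 T2 q0 Pq.
have P0 : 0 < P by lra.
have qr0 : 0 < q%:R :> R by rewrite ltr0n.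
have qr1 : 1 <= q%:R :> R by rewrite ler1n.
pose s1 := ceildiv i1 q; pose s2 := ceildiv i2 q.
pose c' j := c j * q%:R ^- j.+1.
have -> : \sum_(k < n) twisted r c phi i1 i2 (q * k) =
    \sum_(k < n) (if (s1 <= k < s2)%N
        then cos (phi + 2 * pi * invpoly r c' k%:R) else 0).
  apply: eq_bigr => k _; rewrite /twisted /s1 /s2 ceildiv_le// ceildiv_gt//.
  by rewrite natrM invpoly_scale.
have nc' j : `|c' j| = `|c j| * q%:R ^- j.+1.
  by rewrite normrM [X in _ * X]ger0_norm// invr_ge0 exprn_ge0.
have E : `|c' j0| * (P / q%:R) ^- j0.+1 = `|c j0| * P ^- j0.+1.
  by rewrite nc' exprMn exprVn; field; rewrite !expf_neq0// gt_eqF.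
apply: (h c' j0) => //.
- by move=> j jj0; rewrite /c' cz// mul0r.
- move=> j jr; rewrite !nc'; have [jj0|jj0] := ltnP j j0.
    by rewrite cz// normr0 mul0r !mulr_ge0// invr_ge0 exprn_ge0.
  rewrite mulrA; apply: ler_pM => //; first exact: cD.
  by rewrite lef_pV2 ?posrE ?exprn_gt0// (ler_weXn2l qr1).
- by rewrite ler_pdivrMr// ler_peMr// ltW.
- rewrite ler_pdivrMr// -natrM; apply: (le_trans (ltW Pi)).
  by rewrite ler_nat mulnC -ceildiv_le.
- have [s20|s20] := posnP s2.
    by rewrite s20 addr_ge0// mulr_ge0// divr_ge0// ltW.
  have : (q * s2.-1 < i2)%N by rewrite -ceildiv_gt// prednK.
  rewrite -(ltr_nat R) natrM => hs.
  have hs2 : (s2.-1)%:R <= 2 * (P / q%:R).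
    rewrite mulrA ler_pdivlMr// mulrC.
    have : (q * s2.-1 < i2)%N by rewrite -ceildiv_gt// prednK.
    rewrite -(ler_nat R) -natr1 natrM => hs'; lra.
  by rewrite -(prednK s20) -natr1; lra.
- by rewrite E.
- rewrite E; apply: le_trans T2; rewrite ler_piMr// invf_le1 ?exprn_gt0//.
  by rewrite exprn_ege1.
Qed.

(** The sum over k of k exp (2 pi i (f (u k) - f (v k))), in real form. The
weight k is the one for which Cauchy-Schwarz needs no dyadic decomposition of
the range of k. *)
Definition correlation (R : realType) r (c : nat -> R) (phi : R)
    (i1 i2 n u v : nat) : R :=
  \sum_(k < n) k%:R * (twisted r c phi i1 i2 (u * k) * twisted r c phi i1 i2 (v * k)
    + twisted r c (phi - pi / 2) i1 i2 (u * k) * twisted r c (phi - pi / 2) i1 i2 (v * k)).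

(** The coefficients of k |-> f (u k) - f (v k). *)
Definition diff_coef (R : realType) (c : nat -> R) (u v j : nat) : R :=
  c j * (u%:R ^- j.+1 - v%:R ^- j.+1).

Lemma correlationE (R : realType) r (c : nat -> R) phi i1 i2 n u v :
  (0 < u)%N -> (u <= v)%N ->
  correlation r c phi i1 i2 n u v =
  \sum_(k < n) (if (ceildiv i1 u <= k < ceildiv i2 v)%N
     then cos (0 + 2 * pi * invpoly r (diff_coef c u v) k%:R) else 0) * k%:R.
Proof.
move=> u0 uv; have v0 : (0 < v)%N := leq_trans u0 uv.
apply: eq_bigr => k _; rewrite mulrC; congr (_ * _).
rewrite ceildiv_le// ceildiv_gt// /twisted.
have uvk : (u * k <= v * k)%N by rewrite leq_mul2r uv orbT.
have [h1|h1] := leqP i1 (u * k) => /=; last by rewrite !mul0r addr0.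
have [h2|h2] := ltnP (v * k) i2 => /=; last by rewrite andbF !mulr0 addr0.
rewrite (leq_ltn_trans uvk h2) (leq_trans h1 uvk) /=.
have E : invpoly r (diff_coef c u v) k%:R =
    invpoly r c (u * k)%:R - invpoly r c (v * k)%:R.
  rewrite !natrM !invpoly_scale /invpoly -sumrB; apply: eq_bigr => j _.
  by rewrite /diff_coef; ring.
rewrite E; set a := 2 * pi * invpoly r c (u * k)%:R.
set b := 2 * pi * invpoly r c (v * k)%:R.
have -> (x : R) : phi - pi / 2 + x = (phi + x) - pi / 2 by ring.
have -> : phi - pi / 2 + b = (phi + b) - pi / 2 by ring.
rewrite !cosBpihalf -cosB; congr cos; rewrite /a /b; ring.
Qed.

(** P / v is the natural unit of length for the k with u k and v k both in
(P, 2P], although their interval starts above P / u. *)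
Lemma type2_interval (R : realType) (P : R) (i1 i2 u v : nat) :
  P < i1%:R -> i2%:R <= 2 * P + 1 -> (0 < u)%N -> (u <= v)%N -> 1 <= P / v%:R ->
  P / v%:R <= (ceildiv i1 u)%:R /\ (ceildiv i2 v)%:R <= 2 * (P / v%:R) + 1.
Proof.
move=> Pi iP u0 uv M1; have v0 : (0 < v)%N := leq_trans u0 uv.
have vr0 : 0 < v%:R :> R by rewrite ltr0n.
split.
  rewrite ler_pdivrMr// -natrM; apply: (le_trans (ltW Pi)); rewrite ler_nat.
  apply: (@leq_trans (u * ceildiv i1 u)); first by rewrite -ceildiv_le.
  by rewrite mulnC leq_mul2l uv orbT.
set s2 := ceildiv i2 v; have [s20|s20] := posnP s2.
  by rewrite s20; lra.
have hs2 : (s2.-1)%:R <= 2 * (P / v%:R).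
  rewrite mulrA ler_pdivlMr// mulrC.
  have : (v * s2.-1 < i2)%N by rewrite -ceildiv_gt// prednK.
  rewrite -(ler_nat R) -natr1 natrM => hs'; lra.
by rewrite -(prednK s20) -natr1; lra.
Qed.

(** The interval of k has length and endpoints at most 3 P / v. *)
Lemma correlation_trivial (R : realType) r (c : nat -> R) (P phi : R) i1 i2 n u v :
  P < i1%:R -> i2%:R <= 2 * P + 1 -> (0 < u)%N -> (u <= v)%N -> 1 <= P / v%:R ->
  `|correlation r c phi i1 i2 n u v| <= 9 * (P / v%:R) ^+ 2.
Proof.
move=> Pi iP u0 uv M1; have [_ s2M] := type2_interval Pi iP u0 uv M1.
rewrite correlationE//; move: s2M M1.
set M := P / v%:R; set s2 := ceildiv i2 v; set s1 := ceildiv i1 u => s2M M1.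
have s3 : s2%:R <= 3 * M by lra.
apply: (le_trans (ler_norm_sum _ _ _)).
apply: (@le_trans _ _ (\sum_(k < n) if (s1 <= k < s2)%N then s2%:R else 0)).
  apply: ler_sum => k _; case: ifP => [/andP[_ ks]|_]; last by rewrite mul0r normr0.
  rewrite normrM [X in _ * X]ger0_norm// -[leRHS]mul1r ler_pM ?cos_max//.
  by rewrite ler_nat ltnW.
rewrite (sum_interval (fun=> s2%:R)) sumr_const card_ord -[leLHS]mulr_natl.
apply: (@le_trans _ _ (s2%:R * s2%:R)).
  by rewrite ler_wpM2r// ler_nat (leq_trans (leq_subr _ _))// geq_minr.
have s0 : 0 <= s2%:R :> R by [].
nra.
Qed.

(** The phase f (u k) - f (v k) has size T (v - u) / v at least, T being the
size of f. Under the last hypothesis this is at least P^(de/2), so that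
interval_phase applies; the weight k is removed by summation by parts. *)
Lemma correlation_bound (R : realType) (r A : nat) (D de : R) :
  0 <= D -> 0 < de <= 1 -> exists C eta : R, [/\ 0 < C, 0 < eta <= 1 &
  forall (c : nat -> R) j0 (P phi : R) (i1 i2 n u v : nat), (j0 < r)%N ->
    (forall j, (j < j0)%N -> c j = 0) ->
    (forall j, (j < r)%N -> `|c j| <= D * `|c j0|) ->
    1 <= P -> P < i1%:R -> i2%:R <= 2 * P + 1 ->
    P `^ de <= `|c j0| * P ^- j0.+1 -> `|c j0| <= P ^+ A ->
    (0 < u)%N -> (u <= v)%N -> P `^ (1 / 4) <= P / v%:R ->
    v%:R * P `^ (- (de / 2)) <= v%:R - u%:R ->
    `|correlation r c phi i1 i2 n u v|
      <= C * ((P / v%:R) ^+ 2 * P `^ (- eta))].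
Proof.
move=> D0 hde.
have Dr0 : 0 <= D * r%:R by rewrite mulr_ge0.
have hde2 : 0 < de / 2 <= 1 by lra.
have [C [e [C0 e0 h]]] := interval_phase r A Dr0 hde2.
exists (6 * C), e; split=> //; first lra.
move=> c j0 P phi i1 i2 n u v j0r cz cD P1 Pi iP T1 T2 u0 uv PM far.
have P0 : 0 < P by lra.
have v0 : (0 < v)%N := leq_trans u0 uv.
have vr0 : 0 < v%:R :> R by rewrite ltr0n.
have vr1 : 1 <= v%:R :> R by rewrite ler1n.
have ur0 : 0 < u%:R :> R by rewrite ltr0n.
have ur1 : 1 <= u%:R :> R by rewrite ler1n.
have uvr : u%:R <= v%:R :> R by rewrite ler_nat.
have M1 : 1 <= P / v%:R by apply: le_trans PM; apply: powR_ge1 => //; lra.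
have [s1M s2M] := type2_interval Pi iP u0 uv M1.
rewrite correlationE//.
pose y : R := u%:R^-1; pose z : R := v%:R^-1.
have z0 : 0 < z by rewrite invr_gt0.
have zy : z <= y by rewrite lef_pV2.
have y1 : y <= 1 by rewrite invf_le1.
have y0 : 0 < y by rewrite (lt_le_trans z0).
have dE j : diff_coef c u v j = c j * (y ^+ j.+1 - z ^+ j.+1).
  by rewrite /diff_coef !exprVn.
have d0 j : 0 <= y ^+ j.+1 - z ^+ j.+1.
  by rewrite subr_ge0 lerXn2r ?nnegrE// ltW.
have nd j : `|diff_coef c u v j| = `|c j| * (y ^+ j.+1 - z ^+ j.+1).
  by rewrite dE normrM [X in _ * X]ger0_norm.
have base nn : `|\sum_(k < nn) (if (ceildiv i1 u <= k < ceildiv i2 v)%N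
     then cos (0 + 2 * pi * invpoly r (diff_coef c u v) k%:R) else 0)|
     <= C * (P / v%:R * P `^ (- e)).
  apply: (h (diff_coef c u v) j0) => //.
  - by move=> j jj0; rewrite dE cz// mul0r.
  - move=> j jr; rewrite !nd; have [jj0|jj0] := ltnP j j0.
      by rewrite cz// normr0 mul0r !mulr_ge0.
    have := subrX_dominated (ltW z0) zy y1 jj0 => h1.
    have h2 : `|c j| * (y ^+ j.+1 - z ^+ j.+1) <=
        D * `|c j0| * (r%:R * (y ^+ j0.+1 - z ^+ j0.+1)).
      apply: ler_pM => //; first exact: cD.
      by apply: (le_trans h1); rewrite ler_wpM2r// ler_nat.
    by apply: (le_trans h2); rewrite le_eqVlt; apply/orP; left; apply/eqP; ring.
  - by rewrite ler_pdivrMr// ler_peMr// ltW.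
  - rewrite nd.
    have hd : (v%:R - u%:R) / v%:R * z ^+ j0.+1 <= y ^+ j0.+1 - z ^+ j0.+1.
      apply: le_trans (subrX_ge _ (ltW z0) zy).
      have -> : (v%:R - u%:R) / v%:R * z ^+ j0.+1 = (z * (1 - u%:R * z)) * z ^+ j0.
        by rewrite /z exprS; field; rewrite gt_eqF.
      have -> : y - z = y * (1 - u%:R * z).
        by rewrite /y /z; field; rewrite !gt_eqF.
      apply: ler_pM; rewrite ?exprn_ge0 ?(ltW z0)//.
        rewrite mulr_ge0 ?(ltW z0)// subr_ge0 /z ler_pdivrMr// mul1r//.
        rewrite ler_wpM2r// subr_ge0 /z ler_pdivrMr// mul1r//.
      by rewrite lerXn2r ?nnegrE ?(ltW z0) ?(ltW y0).
    have hT : `|c j0| * P ^- j0.+1 * ((v%:R - u%:R) / v%:R) <=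
        `|c j0| * (y ^+ j0.+1 - z ^+ j0.+1) * (P / v%:R) ^- j0.+1.
      have -> : `|c j0| * P ^- j0.+1 * ((v%:R - u%:R) / v%:R) =
         `|c j0| * ((v%:R - u%:R) / v%:R * z ^+ j0.+1) * (P / v%:R) ^- j0.+1.
        by rewrite /z !exprMn !exprVn; field; rewrite !expf_neq0// !gt_eqF.
      rewrite ler_wpM2r ?invr_ge0 ?exprn_ge0 ?divr_ge0 ?(ltW P0)//.
      by rewrite ler_wpM2l.
    apply: le_trans hT.
    have -> : P `^ (de / 2) = P `^ de * P `^ (- (de / 2)).
      by rewrite -powR_split//; congr (_ `^ _); clear; lra.
    apply: ler_pM; rewrite ?powR_ge0//.
    by rewrite ler_pdivlMr// mulrC.
  - rewrite nd; apply: le_trans T2.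
    rewrite -mulrA ler_piMr//.
    apply: (@le_trans _ _ (y ^+ j0.+1 - z ^+ j0.+1)).
      by rewrite ler_piMr// invf_le1 ?exprn_gt0 ?exprn_ege1// (lt_le_trans ltr01).
    apply: (@le_trans _ _ (y ^+ j0.+1)).
      by rewrite lerBlDr lerDl exprn_ge0// ltW.
    by rewrite exprn_ile1// ltW.
pose a k := (if (ceildiv i1 u <= k < ceildiv i2 v)%N
     then cos (0 + 2 * pi * invpoly r (diff_coef c u v) k%:R) else 0).
(* capped at the end of the interval of k, where the sum stops, to be bounded *)
pose w k : R := (minn k (ceildiv i2 v))%:R.
have -> : \sum_(k < n) (if (ceildiv i1 u <= k < ceildiv i2 v)%N
     then cos (0 + 2 * pi * invpoly r (diff_coef c u v) k%:R) else 0) * k%:R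
  = \sum_(k < n) a k * w k.
  apply: eq_bigr => k _; rewrite /a /w; case: ifP; rewrite ?mul0r//.
  by move=> /andP[_ ks]; rewrite (minn_idPl (ltnW ks)).
have M0 : 0 <= P / v%:R := le_trans ler01 M1.
apply: (@le_trans _ _ (2 * (C * (P / v%:R * P `^ (- e))) * (3 * (P / v%:R)))).
  apply: abel_bound => //.
  - by rewrite mulr_ge0.
  - left=> x _; rewrite /w ler_nat leq_min geq_minr andbT.
    by rewrite (leq_trans (geq_minl _ _)).
  - move=> x _; rewrite /w ler0n /=; apply: (@le_trans _ _ (ceildiv i2 v)%:R).
      by rewrite ler_nat geq_minr.
    clear -s2M M1; lra.
rewrite le_eqVlt; apply/orP; left; apply/eqP; ring.
Qed.

(** * The three sums of Vaughan's identity *)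

Lemma mobius_head_norm (R : realType) V d : `|mobius_head R V d| <= 1.
Proof. by rewrite /mobius_head; case: ifP; rewrite ?normr0// mobius_norm. Qed.

Lemma mangoldt_head_norm (R : realType) U X d : (d <= X)%N ->
  `|mangoldt_head R U d| <= ln X%:R.
Proof.
move=> dX; rewrite /mangoldt_head.
have [d0|d0] := posnP d.
  have L0 : 0 <= ln X%:R :> R.
    by case: X {dX} => [|X]; [rewrite ln0|rewrite ln_ge0// ler1n].
  case: ifP; rewrite ?normr0// d0 => _.
  have := mangoldt_le_ln R 0; rewrite ln0// => /andP[h1 h2].
  by rewrite ger0_norm// (le_trans h2).
have h : ln d%:R <= ln X%:R :> R.
  by rewrite ler_ln ?posrE ?ltr0n ?(leq_trans d0)// ler_nat.
have /andP[h1 h2] := mangoldt_le_ln R d.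
case: ifP; rewrite ?normr0 => _; last by rewrite (le_trans _ h)// (le_trans h1).
by rewrite ger0_norm// (le_trans h2).
Qed.

Lemma type1_log (R : realType) (F : nat -> R) (X V : nat) (B : R) :
  F 0 = 0 -> 0 <= B -> (0 < X)%N ->
  (forall q n, (0 < q)%N -> (q <= V)%N -> `|\sum_(k < n) F (q * k)%N| <= B / q%:R) ->
  `|\sum_(d < X.+1) mobius_head R V d * (\sum_(k < X.+1) F (d * k)%N * ln k%:R)|
    <= 2 * B * ln X%:R * harmonic_sum R X.
Proof.
move=> F0 B0 X0 h; apply: (le_trans (ler_norm_sum _ _ _)).
have L0 : 0 <= ln X%:R :> R by rewrite ln_ge0// ler1n.
rewrite /harmonic_sum mulr_sumr; apply: ler_sum => d _.
have rhs0 : 0 <= 2 * B * ln X%:R / d%:R by rewrite !mulr_ge0 ?invr_ge0.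
have [d0|d0] := posnP d.
  rewrite d0 big1 ?mulr0 ?normr0 ?invr0 ?mulr0// => k _.
  by rewrite mul0n F0 mul0r.
have [dV|dV] := leqP d V; last first.
  by rewrite /mobius_head leqNgt dV /= mul0r normr0.
rewrite normrM -[leRHS]mul1r ler_pM ?mobius_head_norm//.
have -> : 2 * B * ln X%:R / d%:R = 2 * (B / d%:R) * ln X%:R by ring.
apply: (@abel_bound _ (fun k => F (d * k)%N) (fun k => ln k%:R)) => //.
- by move=> n _; exact: h.
- left=> -[|x] _; first by rewrite ln0// ln1.
  by rewrite ler_ln ?posrE ?ltr0n// ler_nat.
- move=> [|x] xX; first by rewrite ln0// lexx.
  by rewrite ln_ge0 ?ler1n//= ler_ln ?posrE ?ltr0n// ler_nat -ltnS.
Qed.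

Lemma type1_double (R : realType) (F : nat -> R) (X U V : nat) (B : R) :
  F 0 = 0 -> 0 <= B -> (0 < X)%N ->
  (forall q n, (0 < q)%N -> (q <= V * U)%N -> `|\sum_(k < n) F (q * k)%N| <= B / q%:R) ->
  `|\sum_(d < X.+1) \sum_(c < X.+1) mobius_head R V d * mangoldt_head R U c
      * (\sum_(l < X.+1) F (d * c * l)%N)|
    <= B * ln X%:R * harmonic_sum R X ^+ 2.
Proof.
move=> F0 B0 X0 h; apply: (le_trans (ler_norm_sum _ _ _)).
have L0 : 0 <= ln X%:R :> R by rewrite ln_ge0// ler1n.
rewrite /harmonic_sum expr2 big_distrlr mulr_sumr; apply: ler_sum => d _.
apply: (le_trans (ler_norm_sum _ _ _)); rewrite mulr_sumr; apply: ler_sum => c _.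
have rhs0 : 0 <= B * ln X%:R * (d%:R^-1 * c%:R^-1).
  by rewrite !mulr_ge0 ?invr_ge0.
have [q0|q0] := posnP (d * c).
  rewrite q0 big1 ?mulr0 ?normr0// => k _.
have [dV|dV] := leqP d V; last first.
  by rewrite /mobius_head leqNgt dV /= !mul0r normr0.
have [cU|cU] := leqP c U; last first.
  by rewrite /mangoldt_head leqNgt cU /= mulr0 mul0r normr0.
rewrite !normrM.
have -> : B * ln X%:R * (d%:R^-1 * c%:R^-1) = 1 * ln X%:R * (B / (d * c)%:R).
  by rewrite natrM invfM; ring.
apply: ler_pM; rewrite ?mulr_ge0 ?normr_ge0//.
  by apply: ler_pM => //; rewrite ?mobius_head_norm// mangoldt_head_norm// -ltnS.
by apply: h => //; rewrite leq_mul.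
Qed.

(** The diagonal is counted twice on the right. *)
Lemma sum_symmetric (R : realType) (f : nat -> nat -> R) n :
  (forall u v, 0 <= f u v) -> (forall u v, f u v = f v u) ->
  \sum_(u < n) \sum_(v < n) f u v <= 2 * \sum_(v < n) \sum_(u < v.+1) f u v.
Proof.
move=> f0 fC; elim: n => [|n IH]; first by rewrite !big_ord0 mulr0.
rewrite big_ord_recr /=.
under eq_bigr => u _ do rewrite big_ord_recr /=.
rewrite big_split /= [X in _ <= 2 * X]big_ord_recr /=.
have -> : \sum_(v < n.+1) f n v = \sum_(u < n.+1) f u n.
  by apply: eq_bigr => v _; rewrite fC.
rewrite big_ord_recr /=.
have := f0 n n.
move: IH; set x := \sum_(_ < n) _; set y := \sum_(_ < n) _; set z := \sum_(_ < n) _.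
lra.
Qed.

Lemma mobius_tail_sum_le (R : realType) V k :
  `|\sum_(d <- divisors k) mobius_tail R V d| <= tau R k.
Proof.
apply: (le_trans (ler_norm_sum _ _ _)).
apply: (@le_trans _ _ (\sum_(d <- divisors k) 1)).
  apply: ler_sum => d _; rewrite /mobius_tail.
  by case: ifP; rewrite ?normr0// mobius_norm.
by rewrite big_const_seq count_predT iter_addr_0.
Qed.

Lemma mobius_tail_sum0 (R : realType) V k : (0 < k)%N -> (k <= V)%N ->
  \sum_(d <- divisors k) mobius_tail R V d = 0.
Proof.
move=> k0 kV; rewrite big1_seq// => d /andP[_].
rewrite -dvdn_divisors// => dk; rewrite /mobius_tail ltnNge.
by rewrite (leq_trans (dvdn_leq k0 dk) kV).
Qed.

(** Cauchy-Schwarz in the form (sum b_k E_k)^2 <= (sum b_k^2 / k) (sum k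
E_k^2); the first factor is bounded by sum_tau2. In the second one the square
of a cosine sum is completed by that of the sine sum, represented by G, and
opened. *)
Lemma type2_cauchy (R : realType) (F G : nat -> R) (X U V W : nat) :
  F 0 = 0 -> (0 < X)%N ->
  (forall c k, (W < c)%N -> (V < k)%N -> F (c * k)%N = 0) ->
  (\sum_(k < X.+1) (\sum_(d <- divisors k) mobius_tail R V d)
      * (\sum_(c < X.+1) mangoldt_tail R U c * F (c * k)%N)) ^+ 2
  <= harmonic_sum R X ^+ 4 * (2 * ln X%:R ^+ 2 *
     \sum_(v < X.+1) \sum_(u < v.+1) (if (U < u)%N && (v <= W)%N then
       `|\sum_(k < X.+1) k%:R * (F (u * k)%N * F (v * k)%N + G (u * k)%N * G (v * k)%N)|
        else 0)).
Proof.
move=> F0 X0 FW.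
have L0 : 0 <= ln X%:R :> R by rewrite ln_ge0// ler1n.
pose be k := \sum_(d <- divisors k) mobius_tail R V d.
(* for k > V the terms with c > W vanish, and for k <= V the first factor does *)
pose la c : R := if (U < c <= W)%N then mangoldt R c else 0.
pose E (H : nat -> R) k := \sum_(c < X.+1) la c * H (c * k)%N.
have la0 c : 0 <= la c by rewrite /la; case: ifP => // _; have /andP[] := mangoldt_le_ln R c.
have laL c : (c < X.+1)%N -> la c <= if (U < c <= W)%N then ln X%:R else 0.
  rewrite ltnS => cX; rewrite /la; case: ifP => // /andP[Uc _].
  have /andP[_ h] := mangoldt_le_ln R c; apply: (le_trans h).
  have c0 : (0 < c)%N := leq_ltn_trans (leq0n _) Uc.
  by rewrite ler_ln ?posrE ?ltr0n// ler_nat.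
have -> : \sum_(k < X.+1) (\sum_(d <- divisors k) mobius_tail R V d)
      * (\sum_(c < X.+1) mangoldt_tail R U c * F (c * k)%N)
  = \sum_(k < X.+1) (be k / Num.sqrt k%:R) * (Num.sqrt k%:R * E F k).
  apply: eq_bigr => k _; have [k0|k0] := posnP k.
    rewrite k0 sqrtr0 mul0r mulr0 [X in _ * X]big1 ?mulr0// => c _.
    by rewrite muln0 F0 mulr0.
  rewrite mulrA divfK; last by rewrite sqrtr_eq0 -ltNge ltr0n.
  have [kV|Vk] := leqP k V; first by rewrite /be mobius_tail_sum0// !mul0r.
  congr (_ * _); apply: eq_bigr => c _; rewrite /mangoldt_tail /la.
  case: (U < c)%N => //=; case: leqP => // Wc.
  by rewrite FW// !mulr0.
apply: (le_trans (cauchy_schwarz _ _)); apply: ler_pM.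
- by rewrite sumr_ge0// => k _; rewrite sqr_ge0.
- by rewrite sumr_ge0// => k _; rewrite sqr_ge0.
- apply: le_trans (sum_tau2 R X); apply: ler_sum => k _.
  rewrite exprMn exprVn sqr_sqrtr// ler_wpM2r ?invr_ge0//.
  rewrite -[leLHS](@real_normK _ (be k)) ?num_real//.
  by rewrite lerXn2r ?nnegrE ?mobius_tail_sum_le// ler0n.
pose K u v := \sum_(k < X.+1) k%:R * (F (u * k)%N * F (v * k)%N + G (u * k)%N * G (v * k)%N).
have KC u v : K u v = K v u by apply: eq_bigr => k _; ring.
have EE H k : E H k ^+ 2 = \sum_(u < X.+1) \sum_(v < X.+1) la u * la v * (H (u * k)%N * H (v * k)%N).
  rewrite expr2 big_distrlr; apply: eq_bigr => u _; apply: eq_bigr => v _ /=; ring.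
apply: (@le_trans _ _ (\sum_(u < X.+1) \sum_(v < X.+1) la u * la v * K u v)).
  have -> : \sum_(u < X.+1) \sum_(v < X.+1) la u * la v * K u v =
     \sum_(k < X.+1) k%:R * (E F k ^+ 2 + E G k ^+ 2).
    under eq_bigr => u _ do under eq_bigr => v _ do rewrite mulr_sumr.
    under eq_bigr => u _ do rewrite exchange_big /=.
    rewrite exchange_big /=; apply: eq_bigr => k _.
    rewrite !EE -big_split mulr_sumr /=; apply: eq_bigr => u _.
    rewrite -big_split mulr_sumr /=; apply: eq_bigr => v _; ring.
  apply: ler_sum => k _; rewrite exprMn sqr_sqrtr// ler_wpM2l// lerDl sqr_ge0//.
(* the coefficients mangoldt u * mangoldt v are bounded by (ln X)^2 from here on *)
pose f u v := if [&& (U < u)%N, (u <= W)%N, (U < v)%N & (v <= W)%N]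
   then ln X%:R ^+ 2 * `|K u v| else 0.
have f0 u v : 0 <= f u v by rewrite /f; case: ifP => // _; rewrite mulr_ge0 ?exprn_ge0.
have fC u v : f u v = f v u by rewrite /f KC andbA andbC -andbA.
apply: (@le_trans _ _ (\sum_(u < X.+1) \sum_(v < X.+1) f u v)).
  apply: ler_sum => u _; apply: ler_sum => v _.
  have := laL u (ltn_ord u); have := laL v (ltn_ord v); have := la0 u; have := la0 v.
  rewrite /f; case: (U < u)%N => /=; last first.
    move=> _ h1 _ h2; have -> : la u = 0 by apply/eqP; rewrite eq_le h2.
    by rewrite !mul0r.
  case: (u <= W)%N => /=; last first.
    move=> _ h1 _ h2; have -> : la u = 0 by apply/eqP; rewrite eq_le h2.
    by rewrite !mul0r.
  case: ifP => _; last first.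
    move=> h1 _ h2 _; have -> : la v = 0 by apply/eqP; rewrite eq_le h2.
    by rewrite mulr0 !mul0r.
  move=> a1 a2 a3 a4; apply: (le_trans (ler_norm _)).
  rewrite normrM ger0_norm ?mulr_ge0// ler_wpM2r// expr2 ler_pM//.
apply: (le_trans (sum_symmetric _ f0 fC)).
rewrite -mulrA ler_wpM2l// mulr_sumr; apply: ler_sum => v _.
rewrite mulr_sumr; apply: ler_sum => u _; rewrite /f -/(K u v).
have [Uu|Uu] /= := ltnP U u; last by rewrite mulr0.
case: (leqP v W) => vW; last by rewrite !andbF mulr0.
by case: ifP => // _; rewrite mulr_ge0 ?exprn_ge0.
Qed.

(** For given v there are at most v z + 1 values of u too close to v for the
second hypothesis, and at most v in total; summing (P / v)^2 times these
numbers over v > U yields the result. *)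
Lemma type2_pairs (R : realType) (K : nat -> nat -> R) (P z B : R) (X U W : nat) :
  (0 < U)%N -> 0 <= z -> 0 <= B ->
  (forall u v, (U < u)%N -> (u <= v)%N -> (v <= W)%N -> `|K u v| <= 9 * (P / v%:R) ^+ 2) ->
  (forall u v, (U < u)%N -> (u <= v)%N -> (v <= W)%N -> v%:R * z <= v%:R - u%:R ->
    `|K u v| <= B * (P / v%:R) ^+ 2) ->
  \sum_(v < X.+1) \sum_(u < v.+1) (if (U < u)%N && (v <= W)%N then `|K u v| else 0)
   <= P ^+ 2 * harmonic_sum R X * (9 * z + 9 / U%:R + B).
Proof.
move=> U0 z0 B0 ha hb; rewrite mulrAC /harmonic_sum mulr_sumr; apply: ler_sum => v _.
have U0r : 0 < U%:R :> R by rewrite ltr0n.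
have rhs0 : 0 <= P ^+ 2 * (9 * z + 9 / U%:R + B) / v%:R.
  have s0 : 0 <= 9 * z + 9 / U%:R + B.
    have : 0 <= 9 / U%:R :> R by rewrite divr_ge0.
    lra.
  by rewrite divr_ge0// mulr_ge0// sqr_ge0.
have [vW|vW] := leqP v W; last by rewrite big1// => u _; rewrite andbF.
have [vU|Uv] := leqP v U.
  rewrite big1// => u _; have [Uu|//] := ltnP U u.
  by have := leq_trans Uu (leq_trans (ltn_ord u : u <= v)%N vU); rewrite ltnn.
have v0 : 0 < v%:R :> R by rewrite ltr0n (leq_ltn_trans _ Uv).
set M2 := (P / v%:R) ^+ 2; have M20 : 0 <= M2 by rewrite sqr_ge0.
apply: (@le_trans _ _ (\sum_(u < v.+1) ((if (v - u)%:R < v%:R * z then 9 * M2 else 0)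
     + (if (0 < u)%N then B * M2 else 0)))).
  apply: ler_sum => u _; have uv : (u <= v)%N by rewrite -ltnS.
  have t0 : 0 <= (if (v - u)%:R < v%:R * z then 9 * M2 else 0).
    by case: ifP => // _; rewrite mulr_ge0.
  have t1 : 0 <= (if (0 < u)%N then B * M2 else 0).
    by case: ifP => // _; rewrite mulr_ge0.
  have [Uu|Uu] /= := ltnP U u; last by rewrite addr_ge0.
  have u0 : (0 < u)%N := leq_ltn_trans (leq0n _) Uu.
  rewrite u0; case: ltP => near.
    by apply: (le_trans (ha u v Uu uv vW)); rewrite lerDl mulr_ge0.
  by rewrite add0r; apply: (hb u v Uu uv vW); rewrite -natrB.
rewrite big_split /=.
have -> : \sum_(u < v.+1) (if (0 < u)%N then B * M2 else 0) = v%:R * (B * M2).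
  by rewrite big_ord_recl /= add0r sumr_const card_ord mulr_natl.
have h1 : \sum_(u < v.+1) (if (v - u)%:R < v%:R * z then 9 * M2 else 0)
    <= (v%:R * z + 1) * (9 * M2).
  rewrite (reindex_inj rev_ord_inj) /=.
  have -> : \sum_(u < v.+1) (if (v - (v.+1 - u.+1))%:R < v%:R * z then 9 * M2 else 0)
     = (\sum_(u < v.+1 | u%:R < v%:R * z) 1) * (9 * M2).
    rewrite mulr_suml [RHS]big_mkcond /=; apply: eq_bigr => u _.
    by rewrite subSS subKn ?mul1r// -ltnS.
  have M29 : 0 <= 9 * M2 by rewrite mulr_ge0.
  rewrite ler_wpM2r//; apply: count_below.
  by rewrite mulr_ge0// ltW.
apply: (le_trans (lerD h1 (lexx _))).
have -> : (v%:R * z + 1) * (9 * M2) + v%:R * (B * M2)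
  = P ^+ 2 * (9 * z + 9 / v%:R + B) / v%:R.
  by rewrite /M2; field; rewrite gt_eqF.
rewrite ler_wpM2r ?invr_ge0 ?(ltW v0)// ler_wpM2l ?sqr_ge0// lerD2r lerD2l.
rewrite ler_pM2l// lef_pV2 ?posrE// ler_nat; exact: ltnW.
Qed.

(** * The exponential sum weighted by the von Mangoldt function *)

(** Comes from ln y < y at y = x^e. *)
Lemma log_le_powR (R : realType) (e x P : R) : 0 < e <= 1 -> 1 <= P -> 1 <= x ->
  x <= 3 * P -> 1 + ln x <= (1 + 3 / e) * P `^ e.
Proof.
move=> /andP[e0 e1] P1 x1 xP; have x0 : 0 < x by lra.
have Pe : 1 <= P `^ e by apply: powR_ge1 => //; lra.
have h1 : ln x <= x `^ e / e.
  by rewrite ler_pdivlMr// mulrC -ln_powR ltW// ln_sublinear// powR_gt0.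
have h2 : x `^ e <= 3 * P `^ e.
  apply: (@le_trans _ _ ((3 * P) `^ e)).
    by rewrite ge0_ler_powR ?nnegrE//; lra.
  rewrite powRM//; last lra.
  by rewrite ler_wpM2r ?powR_ge0// ler1_powR//; lra.
have h3 : x `^ e / e <= 3 / e * P `^ e.
  by rewrite mulrAC ler_pM2r ?invr_gt0.
lra.
Qed.

Lemma mangoldt_phase_sum_trivial (R : realType) r (c : nat -> R) phi i1 i2 :
  `|\sum_(m < i2) mangoldt R m * twisted r c phi i1 i2 m| <= i2%:R ^+ 2.
Proof.
apply: (le_trans (ler_norm_sum _ _ _)).
apply: (@le_trans _ _ (\sum_(m < i2) i2%:R)); last first.
  by rewrite sumr_const card_ord -[leLHS]mulr_natl -expr2.
apply: ler_sum => m _; rewrite normrM -[leRHS]mulr1.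
have /andP[h1 h2] := mangoldt_le_ln R m.
apply: ler_pM; rewrite ?normr_ge0//.
  rewrite ger0_norm//; apply: (le_trans h2).
  have [->|m0] := posnP m; first by rewrite ln0.
  apply: (@le_trans _ _ m%:R); first by rewrite ltW// ln_sublinear// ltr0n.
  by rewrite ler_nat ltnW.
by rewrite /twisted; case: ifP; rewrite ?normr0// cos_max.
Qed.

(** Vaughan's identity with U = V of order P^(1/3): the sums of type I have q
<= P^(2/3), those of type II have both variables at least U, so all inner
sums have length at least P^(1/4), as required by interval_phase. *)
Lemma mangoldt_phase_sum_large (R : realType) (r A : nat) (D de : R) :
  0 <= D -> 0 < de <= 1 -> exists P0 C eta : R, [/\ 1 <= P0, 0 < C, 0 < eta <= 1 &
  forall (c : nat -> R) j0 (P phi : R) (i1 i2 : nat), (j0 < r)%N ->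
    (forall j, (j < j0)%N -> c j = 0) ->
    (forall j, (j < r)%N -> `|c j| <= D * `|c j0|) ->
    P0 <= P -> P < i1%:R -> i2%:R <= 2 * P + 1 ->
    P `^ de <= `|c j0| * P ^- j0.+1 -> `|c j0| <= P ^+ A ->
    (0 < i2)%N ->
    `|\sum_(m < i2) mangoldt R m * twisted r c phi i1 i2 m|
      <= C * ((1 + ln i2%:R) ^+ 4 * (P * P `^ (- eta)))].
Proof.
move=> D0 hde.
have [C1 [e1 [C10 /andP[e10 e11] h1]]] := type1_sum r A D0 hde.
have [C2 [e2 [C20 /andP[e20 e21] h2]]] := correlation_bound r A D0 hde.
have e12 : 0 < 1 / 12 :> R by lra.
(* from P0 on P^(1/3) >= 6 P^(1/4), which leaves room for the rounding of P^(1/3) *)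
have [P0 P01 hP0] := powR_unbounded 6 e12.
pose e := Num.min (Num.min (1 / 3) (de / 2)) (Num.min e1 e2).
have e0 : 0 < e by rewrite /e !lt_min e10 e20 andbT; apply/andP; split; clear -hde; lra.
have ee1 : e <= e1 by rewrite /e !ge_min lexx orbT.
have ee2 : e <= e2 by rewrite /e !ge_min lexx !orbT.
have ee3 : e <= 1 / 3 by rewrite /e !ge_min lexx.
have ee4 : e <= de / 2 by rewrite /e !ge_min lexx !orbT.
pose K3 := 2 * (27 + C2).
exists P0, (3 * C1 + K3), (e / 2); split; [by []|rewrite /K3; clear -C10 C20; lra|clear -e0 ee3; lra|].
move=> c j0 P phi i1 i2 j0r cz cD hP Pi iP T1 T2 i20.
have P1 : 1 <= P := le_trans P01 hP.
have Pp : 0 < P by apply: lt_le_trans P1.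
have mono x : e <= x -> P `^ (- x) <= P `^ (- e).
  by move=> ex; rewrite ler_powR// lerN2.
pose y := P `^ (1 / 3).
have y1 : 1 <= y by apply: powR_ge1; rewrite ?divr_ge0.
have y0 : 0 < y by apply: lt_le_trans y1.
pose U := Num.truncn y.
have /andP[Uy yU] : U%:R <= y < U.+1%:R by apply: truncn_itv; exact: ltW.
have U0 : (0 < U)%N.
  by rewrite -ltnS -(ltr_nat R) (le_lt_trans _ yU).
have Ur : 1 <= U%:R :> R by rewrite ler1n.
have yU2 : y <= 2 * U%:R by move: yU; rewrite -natr1; clear -Ur; lra.
have y3 : y * y * y = P.
  rewrite -!powR_split//; have -> : 1 / 3 + 1 / 3 + 1 / 3 = 1 :> R by clear; lra.
  by rewrite powRr1// ltW.
have P14 : P `^ (1 / 4) * 6 <= y.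
  have -> : y = P `^ (1 / 4) * P `^ (1 / 12).
    by rewrite -powR_split//; congr (_ `^ _); clear; lra.
  by rewrite ler_pM2l ?powR_gt0// hP0.
have P140 := powR_ge0 P (1 / 4).
pose F := twisted r c phi i1 i2; pose G := twisted r c (phi - pi / 2) i1 i2.
have i1U : (U < i1)%N.
  rewrite -(ltr_nat R); apply: le_lt_trans Pi; apply: (le_trans Uy).
  by rewrite -y3 -mulrA ler_peMr ?(ltW y0)// mulr_ege1.
have F0 : F 0%N = 0.
  by rewrite /F /twisted leqn0 (gtn_eqF (leq_ltn_trans (leq0n _) i1U)).
have FX m : (i2 < m)%N -> F m = 0.
  by move=> im; rewrite /F /twisted [(m < i2)%N]ltnNge (ltnW im) andbF.
have FU m : (m <= U)%N -> F m = 0.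
  by move=> mU; rewrite /F /twisted [(i1 <= m)%N]leqNgt (leq_ltn_trans mU i1U).
have -> : \sum_(m < i2) mangoldt R m * twisted r c phi i1 i2 m =
    \sum_(m < i2.+1) mangoldt R m * F m.
  have Fi2 : F i2 = 0 by rewrite /F /twisted ltnn andbF.
  by rewrite [RHS]big_ord_recr /= Fi2 mulr0 addr0.
rewrite (vaughan U F0 FX FU).
set H := 1 + ln i2%:R; pose L : R := ln i2%:R.
have L0 : 0 <= L by rewrite ln_ge0// ler1n.
have H1 : 1 <= H by rewrite /H lerDl.
have H0 : 0 <= H := le_trans ler01 H1.
have LH : L <= H by rewrite /H -/L lerDr.
have hsH : harmonic_sum R i2 <= H := harmonic_sum_le R i20.
have hs0 : 0 <= harmonic_sum R i2 by rewrite sumr_ge0.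
pose B := C1 * (P * P `^ (- e1)).
have B0 : 0 <= B by rewrite !mulr_ge0 ?powR_ge0 ?(ltW C10) ?(ltW Pp).
have hF q n : (0 < q)%N -> (q <= U * U)%N -> `|\sum_(k < n) F (q * k)%N| <= B / q%:R.
  move=> q0 qUU; have qr0 : 0 < q%:R :> R by rewrite ltr0n.
  have := h1 c j0 P phi i1 i2 q n j0r cz cD P1 Pi iP T1 T2 q0.
  have -> : B / q%:R = C1 * (P / q%:R * P `^ (- e1)) by rewrite /B; ring.
  apply; rewrite ler_pdivlMr//.
  have : q%:R <= y * y.
    apply: (@le_trans _ _ (U%:R * U%:R)); first by rewrite -natrM ler_nat.
    by rewrite ler_pM.
  move=> hq; rewrite -[leRHS]y3 mulrC; apply: ler_pM => //.
  clear -P14 P140; lra.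
have hF' q n : (0 < q)%N -> (q <= U)%N -> `|\sum_(k < n) F (q * k)%N| <= B / q%:R.
  by move=> q0 qU; apply: hF => //; rewrite (leq_trans qU)// leq_pmulr.
have S1 := type1_log F0 B0 i20 hF'.
have S2 := type1_double F0 B0 i20 hF.
(* a > W and k > U imply a k > i2 *)
pose W := (i2 %/ U)%N.
have FW a k : (W < a)%N -> (U < k)%N -> F (a * k)%N = 0.
  move=> Wa Uk; apply: FX; rewrite ltn_divLR// in Wa.
  by rewrite (leq_trans Wa)// leq_mul2l ltnW// orbT.
have S3 := type2_cauchy G U F0 i20 FW.
have PW v : (0 < v)%N -> (v <= W)%N -> P `^ (1 / 4) <= P / v%:R.
  move=> v0 vW; have vr0 : 0 < v%:R :> R by rewrite ltr0n.
  rewrite ler_pdivlMr//.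
  have : v%:R * U%:R <= i2%:R :> R by rewrite -natrM ler_nat -leq_divRL.
  move=> hv.
  have hv2 : v%:R * y <= 6 * P.
    have : v%:R * y <= v%:R * (2 * U%:R) by rewrite ler_wpM2l.
    clear -hv iP P1; lra.
  have : v%:R * (P `^ (1 / 4) * 6) <= v%:R * y by rewrite ler_wpM2l.
  clear -hv2; lra.
pose K u v := correlation r c phi i1 i2 i2.+1 u v.
pose z := P `^ (- (de / 2)); pose B2 := C2 * P `^ (- e2).
have z0 : 0 <= z by exact: powR_ge0.
have B20 : 0 <= B2 by rewrite mulr_ge0 ?powR_ge0// ltW.
have P4ge1 : 1 <= P `^ (1 / 4) by apply: powR_ge1; rewrite ?divr_ge0.
have Ka u v : (U < u)%N -> (u <= v)%N -> (v <= W)%N -> `|K u v| <= 9 * (P / v%:R) ^+ 2.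
  move=> Uu uv vW; have u0 : (0 < u)%N := leq_ltn_trans (leq0n _) Uu.
  apply: correlation_trivial => //.
  by apply: (le_trans P4ge1); rewrite PW// (leq_trans u0).
have Kb u v : (U < u)%N -> (u <= v)%N -> (v <= W)%N -> v%:R * z <= v%:R - u%:R ->
    `|K u v| <= B2 * (P / v%:R) ^+ 2.
  move=> Uu uv vW far; have u0 : (0 < u)%N := leq_ltn_trans (leq0n _) Uu.
  have := h2 c j0 P phi i1 i2 i2.+1 u v j0r cz cD P1 Pi iP T1 T2 u0 uv.
  have -> : B2 * (P / v%:R) ^+ 2 = C2 * ((P / v%:R) ^+ 2 * P `^ (- e2)).
    by rewrite /B2; ring.
  by apply=> //; rewrite PW// (leq_trans u0).
have S4 := type2_pairs i2 U0 z0 B20 Ka Kb.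
set s1 := (X in X - _ + _) in S1 *; set s2 := (X in _ - X + _) in S2 *.
set s3 := (X in _ - _ + X) in S3 *.
have Pe0 := powR_ge0 P (- e).
have Pe20 := powR_ge0 P (- (e / 2)).
have PeE : P `^ (- e) = P `^ (- (e / 2)) ^+ 2.
  by rewrite -powR_mulrn// -powRrM; congr (_ `^ _); clear; lra.
have bnd : 9 * z + 9 / U%:R + B2 <= (27 + C2) * P `^ (- e).
  have b1 : z <= P `^ (- e) by exact: mono.
  have b2 : C2 * P `^ (- e2) <= C2 * P `^ (- e) by rewrite ler_pM2l// mono.
  have b3 : 1 / U%:R <= 2 * P `^ (- e).
    apply: (@le_trans _ _ (2 * P `^ (- (1 / 3)))); last by rewrite ler_pM2l// mono.
    have U0r : 0 < U%:R :> R by rewrite ltr0n.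
    by rewrite powRN -/y ler_pdivrMr// mulrAC ler_pdivlMr// mul1r.
  rewrite /B2; clear -b1 b2 b3; lra.
have S3' : `|s3| <= K3 * (H ^+ 4 * (P * P `^ (- (e / 2)))).
  have H40 : 0 <= H ^+ 4 by rewrite exprn_ge0.
  apply: norm_le_of_sqr.
  - by rewrite /K3; clear -C20; lra.
  - by rewrite mulr_ge0// mulr_ge0// ltW.
  apply: (le_trans S3).
  have -> : K3 * (H ^+ 4 * (P * P `^ (- (e / 2)))) ^+ 2 =
    H ^+ 4 * (2 * H ^+ 2 * (P ^+ 2 * H ^+ 2 * ((27 + C2) * P `^ (- e)))).
    by rewrite PeE /K3; ring.
  have L2 : L ^+ 2 <= H ^+ 2 by rewrite lerXn2r ?nnegrE.
  have H2 : harmonic_sum R i2 <= H ^+ 2 by apply: (le_trans hsH); rewrite expr2 ler_peMr.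
  apply: ler_pM.
  - by rewrite exprn_ge0.
  - rewrite mulr_ge0 ?mulr_ge0 ?sqr_ge0// sumr_ge0// => v _; rewrite sumr_ge0// => u _.
    by case: ifP.
  - by rewrite lerXn2r ?nnegrE.
  apply: ler_pM.
  - by rewrite mulr_ge0 ?sqr_ge0.
  - rewrite sumr_ge0// => v _; rewrite sumr_ge0// => u _.
    by case: ifP.
  - by rewrite ler_pM2l.
  apply: (le_trans S4); apply: ler_pM => //.
  - by rewrite mulr_ge0 ?sqr_ge0.
  - by rewrite !addr_ge0// ?mulr_ge0 ?invr_ge0.
  - by rewrite ler_wpM2l ?sqr_ge0.
have PP : P * P `^ (- e1) <= P * P `^ (- (e / 2)).
  by rewrite ler_pM2l// ler_powR// lerN2; clear -ee1 e0; lra.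
have BB : B <= C1 * (P * P `^ (- (e / 2))) by rewrite ler_pM2l.
set Z := P * P `^ (- (e / 2)) in S3' BB PP *.
have Z0 : 0 <= Z by rewrite mulr_ge0 ?(ltW Pp).
have H24 : H ^+ 2 <= H ^+ 4 by rewrite ler_weXn2l.
have H34 : H ^+ 3 <= H ^+ 4 by rewrite ler_weXn2l.
have S1' : `|s1| <= 2 * (C1 * (H ^+ 4 * Z)).
  apply: (le_trans S1); have LL : L * harmonic_sum R i2 <= H ^+ 4.
    by apply: le_trans H24; rewrite expr2 ler_pM.
  have -> : 2 * B * ln i2%:R * harmonic_sum R i2 = 2 * (B * (L * harmonic_sum R i2)).
    by rewrite /L; ring.
  rewrite ler_pM2l// (_ : C1 * (H ^+ 4 * Z) = (C1 * Z) * H ^+ 4); last by ring.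
  by apply: ler_pM => //; rewrite mulr_ge0.
have S2' : `|s2| <= C1 * (H ^+ 4 * Z).
  apply: (le_trans S2); have LL : L * harmonic_sum R i2 ^+ 2 <= H ^+ 4.
    apply: le_trans H34; rewrite [leRHS]exprS ler_pM ?sqr_ge0//.
    by rewrite lerXn2r ?nnegrE.
  rewrite -mulrA (_ : C1 * (H ^+ 4 * Z) = (C1 * Z) * H ^+ 4); last by ring.
  by apply: ler_pM => //; rewrite mulr_ge0 ?sqr_ge0.
apply: (le_trans (ler_normD _ _)).
apply: (le_trans (lerD (ler_normB _ _) (lexx _))).
rewrite mulrDl; clear -S1' S2' S3'; lra.
Qed.

(** It remains to absorb the logarithms into the power saving, and the small
P into the constant. *)
Lemma mangoldt_phase_sum (R : realType) (r A : nat) (D de : R) :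
  0 <= D -> 0 < de <= 1 -> exists C eta : R, [/\ 0 < C, 0 < eta <= 1 / 4 &
  forall (c : nat -> R) j0 (P phi : R) (i1 i2 : nat), (j0 < r)%N ->
    (forall j, (j < j0)%N -> c j = 0) ->
    (forall j, (j < r)%N -> `|c j| <= D * `|c j0|) ->
    1 <= P -> P < i1%:R -> i2%:R <= 2 * P + 1 ->
    P `^ de <= `|c j0| * P ^- j0.+1 -> `|c j0| <= P ^+ A ->
    `|\sum_(m < i2) mangoldt R m * twisted r c phi i1 i2 m| <= C * P `^ (1 - eta)].
Proof.
move=> D0 hde.
have [P0 [C [e [P01 C0 /andP[e0 e1] h]]]] := mangoldt_phase_sum_large r A D0 hde.
have e8 : 0 < e / 8 <= 1 by apply/andP; split; lra.
pose Ch := 1 + 3 / (e / 8).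
have e80 : 0 < e / 8 by lra.
have Ch0 : 1 <= Ch by rewrite /Ch lerDl divr_ge0// ltW.
exists (C * Ch ^+ 4 + 9 * P0 ^+ 2), (e / 4); split.
- by rewrite addr_gt0 ?mulr_gt0 ?exprn_gt0//; clear -Ch0 P01; lra.
- by apply/andP; split; clear -e0 e1; lra.
move=> c j0 P phi i1 i2 j0r cz cD P1 Pi iP T1 T2.
have Pp : 0 < P := lt_le_trans ltr01 P1.
have Pe : 1 <= P `^ (1 - e / 4) by apply: powR_ge1 => //; clear -e1; lra.
have a0 : 0 <= C * Ch ^+ 4 by rewrite mulr_ge0 ?(ltW C0)// exprn_ge0// (le_trans ler01).
have b0 : 0 <= 9 * P0 ^+ 2 by rewrite mulr_ge0 ?sqr_ge0.
have [i20|i20] := posnP i2.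
  apply: (le_trans (mangoldt_phase_sum_trivial _ _ _ _ _)).
  by rewrite i20 expr0n /= mulr_ge0 ?powR_ge0// addr_ge0.
have i2r : 1 <= i2%:R :> R by rewrite ler1n.
have [big|small] := leP P0 P; last first.
  apply: (le_trans (mangoldt_phase_sum_trivial _ _ _ _ _)).
  have : i2%:R ^+ 2 <= 9 * P0 ^+ 2.
    have -> : 9 * P0 ^+ 2 = (3 * P0) ^+ 2 by ring.
    by rewrite lerXn2r ?nnegrE//; clear -P01 P1 small iP; lra.
  move=> hh; apply: (le_trans hh).
  apply: (@le_trans _ _ (9 * P0 ^+ 2 * P `^ (1 - e / 4))).
    by rewrite ler_peMr.
  by rewrite ler_wpM2r ?powR_ge0// lerDr.
apply: (le_trans (h c j0 P phi i1 i2 j0r cz cD big Pi iP T1 T2 i20)).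
apply: (@le_trans _ _ (C * Ch ^+ 4 * P `^ (1 - e / 4))); last first.
  by rewrite ler_wpM2r ?powR_ge0// lerDl.
rewrite -(mulrA C) ler_pM2l//.
have HH : 1 + ln i2%:R <= Ch * P `^ (e / 8) by apply: log_le_powR => //; clear -iP P1; lra.
have H0 : 0 <= 1 + ln i2%:R :> R by rewrite addr_ge0// ln_ge0.
apply: (@le_trans _ _ ((Ch * P `^ (e / 8)) ^+ 4 * (P * P `^ (- e)))).
  apply: ler_wpM2r; first by rewrite mulr_ge0 ?powR_ge0 ?(ltW Pp).
  by rewrite lerXn2r ?nnegrE// (le_trans H0).
rewrite exprMn -[X in _ * X * _ <= _]powR_mulrn ?powR_ge0// -powRrM -mulrA.
rewrite ler_wpM2l//; first by rewrite exprn_ge0// (le_trans ler01).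
rewrite -{2}(powRr1 (ltW Pp)) -!powR_split//; apply: ler_powR => //; clear -e0; lra.
Qed.

(** * From prime powers to primes, and from cosines to exponentials *)

Lemma ln2_ge (R : realType) : 1 / 2 <= ln 2 :> R.
Proof.
have : ln (1 + (- (1 / 2))) <= - (1 / 2) :> R by apply: le_ln1Dx; lra.
have -> : 1 + - (1 / 2) = 2^-1 :> R by lra.
by rewrite lnV ?posrE//; lra.
Qed.

Lemma nonprime_mangoldt_bound (R : realType) : exists2 C : R, 0 < C &
  forall (P : R) (X : nat), 1 <= P -> X%:R <= 3 * P ->
    \sum_(m < X.+1 | ~~ prime m) mangoldt R m <= C * P `^ (3 / 4).
Proof.
have e8 : 0 < (1 / 8 : R) <= 1 by lra.
pose Ch : R := 1 + 3 / (1 / 8).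
have Ch0 : 0 < Ch by rewrite /Ch; lra.
exists (8 * Ch ^+ 2); first by rewrite mulr_gt0// exprn_gt0.
move=> P X P1 XP.
have P0 : 0 < P by lra.
have rhs0 : 0 <= 8 * Ch ^+ 2 * P `^ (3 / 4).
  by rewrite mulr_ge0 ?powR_ge0// mulr_ge0// sqr_ge0.
have [X0|X0] := posnP X.
  apply: le_trans rhs0; have := @sum_nonprime_mangoldt R X 1 1.
  by rewrite X0 ln0// mulr0; apply.
have X1 : 1 <= X%:R :> R by rewrite ler1n.
pose L : R := ln X%:R; have L0 : 0 <= L by rewrite ln_ge0.
have LH : 1 + L <= Ch * P `^ (1 / 8) by apply: log_le_powR.
pose q : R := Num.sqrt X%:R.
have q1 : 1 <= q by rewrite -sqrtr1 ler_wsqrtr.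
have q2 : q ^+ 2 = X%:R by rewrite sqr_sqrtr.
pose s := (Num.truncn q).+1; pose e := (Num.truncn (2 * L)).+1.
have /andP[s1 s2] : (Num.truncn q)%:R <= q < s%:R by apply: truncn_itv; lra.
have /andP[e1 e2] : (Num.truncn (2 * L))%:R <= 2 * L < e%:R.
  by apply: truncn_itv; rewrite mulr_ge0.
have Xs : (X < s ^ 2)%N.
  rewrite -(ltr_nat R) natrX -q2 ltrXn2r//; lra.
have Xe : (X < 2 ^ e)%N.
  rewrite -(ltr_nat R) natrX -ltr_ln ?posrE ?exprn_gt0 ?ltr0n//.
  rewrite lnXn// -/L -[ltRHS]mulr_natl.
  have := ln2_ge R; have : 0 < e%:R :> R by rewrite ltr0n.
  move: e2; set E : R := e%:R; set l2 := ln 2 => h1 h2 h3.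
  have : E * (1 / 2) <= E * l2 by rewrite ler_pM2l.
  clear -h1; lra.
apply: (le_trans (sum_nonprime_mangoldt R Xs Xe)).
have sb : s%:R <= 2 * q by rewrite /s -natr1; lra.
have eb : e%:R <= 2 * (1 + L) by rewrite /e -natr1; lra.
have qP : q <= 2 * P `^ (1 / 2).
  rewrite -(@ler_pXn2r R 2)// ?nnegrE ?mulr_ge0 ?powR_ge0//; last by rewrite (le_trans _ q1).
  rewrite q2 exprMn -[X in _ <= _ * X]powR_mulrn ?powR_ge0// -powRrM.
  have -> : 1 / 2 * 2%:R = 1 :> R by lra.
  rewrite powRr1 ?(ltW P0)//; lra.
have q0 : 0 <= q by lra.
have L1 : 0 <= 1 + L by lra.
rewrite natrM -/L.
apply: (@le_trans _ _ (2 * q * (2 * (1 + L)) * (1 + L))).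
  apply: ler_pM => //; [exact: ler_pM|by rewrite lerDr].
apply: (@le_trans _ _ (2 * (2 * P `^ (1 / 2)) * (2 * (Ch * P `^ (1 / 8))) * (Ch * P `^ (1 / 8)))).
  have h1 : 2 * q <= 2 * (2 * P `^ (1 / 2)) by rewrite ler_pM2l.
  have h2 : 2 * (1 + L) <= 2 * (Ch * P `^ (1 / 8)) by rewrite ler_pM2l.
  have z1 : 0 <= 2 * q by rewrite mulr_ge0.
  have z2 : 0 <= 2 * (1 + L) by rewrite mulr_ge0.
  by apply: (ler_pM (mulr_ge0 z1 z2) L1 (ler_pM z1 z2 h1 h2) LH).
have -> : P `^ (3 / 4) = P `^ (1 / 2) * P `^ (1 / 8) * P `^ (1 / 8).
  by rewrite -!powR_split//; congr (_ `^ _); lra.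
by rewrite le_eqVlt; apply/orP; left; apply/eqP; ring.
Qed.

(** The difference between the sums over primes and over prime powers is
estimated trivially. *)
Lemma prime_phase_sum_le (R : realType) r (c : nat -> R) phi i1 i2 :
  `|\sum_(m < i2) (if prime m then mangoldt R m else 0) * twisted r c phi i1 i2 m|
  <= `|\sum_(m < i2) mangoldt R m * twisted r c phi i1 i2 m|
     + \sum_(m < i2.+1 | ~~ prime m) mangoldt R m.
Proof.
have -> : \sum_(m < i2) (if prime m then mangoldt R m else 0) * twisted r c phi i1 i2 m
   = \sum_(m < i2) mangoldt R m * twisted r c phi i1 i2 m
   - \sum_(m < i2) (if prime m then 0 else mangoldt R m) * twisted r c phi i1 i2 m.
  by rewrite -sumrB; apply: eq_bigr => m _; case: ifP => _; ring.
apply: (le_trans (ler_normB _ _)); rewrite lerD2l.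
apply: (le_trans (ler_norm_sum _ _ _)); rewrite [leRHS]big_mkcond [leRHS]big_ord_recr /=.
have L0 m : 0 <= mangoldt R m by have /andP[] := mangoldt_le_ln R m.
rewrite ler_wpDr//; first by case: ifP.
apply: ler_sum => m _; case: ifP => _ /=; first by rewrite mul0r normr0.
rewrite normrM ger0_norm// ler_piMr// /twisted.
by case: ifP; rewrite ?normr0// cos_max.
Qed.

(** An interval I without integers is represented by i1 = i2. *)
Lemma nat_interval (R : realType) (I : interval R) (P : R) :
  1 <= P -> [set` I] `<=` `]P, 2 * P] ->
  exists i1 i2 : nat, [/\ P < i1%:R, i2%:R <= 2 * P + 1 &
    forall m : nat, (m%:R \in I) = (i1 <= m < i2)%N].
Proof.
move=> P1 IP.
have bnd m : m%:R \in I -> P < m%:R <= 2 * P.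
  by move=> mI; have := IP m%:R mI; rewrite /= in_itv.
have P0 : 0 <= P by lra.
have [[m0 m0I]|noI] := EM (exists m : nat, m%:R \in I); last first.
  exists (Num.truncn P).+1, (Num.truncn P).+1; have /andP[h1 h2] := truncn_itv P0.
  split=> //; first by rewrite -natr1; lra.
  move=> m; case: (boolP (m%:R \in I)) => mI.
    by case: noI; exists m.
  apply/esym/negP => /andP[k1 k2].
  by have := leq_trans k2 k1; rewrite ltnn.
have ex : exists m : nat, m%:R \in I by exists m0.
have ub m : m%:R \in I -> (m <= Num.truncn (2 * P))%N.
  by move=> /bnd /andP[_ h]; rewrite truncn_ge_nat// mulr_ge0.
case: (ex_minnP ex) => i1 i1I i1m; case: (ex_maxnP ex ub) => i2 i2I i2m.
have /andP[b1 _] := bnd _ i1I; have /andP[_ b2] := bnd _ i2I.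
exists i1, i2.+1; split=> //; first by rewrite -natr1; lra.
move=> m; apply/idP/idP => [mI|/andP[h1 h2]].
  by rewrite i1m// ltnS i2m.
apply: (@interval_is_interval R I i1%:R i2%:R) => //=.
by rewrite !ler_nat h1 -ltnS.
Qed.

Lemma fsbig_nat_bounded (V : nmodType) (A : set nat) (p : pred nat) (n : nat)
    (f : nat -> V) :
  (forall m, A m <-> p m) -> (forall m, p m -> (m < n)%N) ->
  \sum_(m \in A) f m = \sum_(m < n) (if p m then f m else 0).
Proof.
move=> Ap pn; rewrite (fsbig_ord _ n (fun m => if p m then f m else 0)).
rewrite -(@fsbig_widen _ _ _ _ A)//=.
- by apply: eq_fsbigr => m; rewrite inE => /Ap ->.
- by move=> m /Ap /pn.
- by move=> m [_ mA] /=; case: ifP => // /Ap.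
Qed.

Lemma complex_norm_le (R : realType) (x y B : R) : `|x| <= B -> `|y| <= B ->
  `|x +i* y| <= (2 * B)%:C.
Proof.
move=> hx hy; rewrite normc_def lecR /=.
have B0 : 0 <= B by rewrite (le_trans _ hx).
rewrite -(@ler_pXn2r R 2)// ?nnegrE ?sqrtr_ge0 ?mulr_ge0// sqr_sqrtr ?addr_ge0 ?sqr_ge0//.
rewrite -(@real_normK _ x) ?num_real// -(@real_normK _ y) ?num_real//.
have h1 : `|x| ^+ 2 <= B ^+ 2 by rewrite lerXn2r ?nnegrE.
have h2 : `|y| ^+ 2 <= B ^+ 2 by rewrite lerXn2r ?nnegrE.
rewrite exprMn -natrX; move: (sqr_ge0 B) h1 h2; clear; lra.
Qed.

Lemma complex_sum (R : realType) n (x y : 'I_n -> R) :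
  \sum_i (x i +i* y i) = (\sum_i x i) +i* (\sum_i y i).
Proof.
by elim/big_rec3: _ => // i z1 z2 z3 _ ->.
Qed.

(** * The size of the phase, and the theorem *)

(** The entry of t as a function on nat, zero beyond r, as needed by invpoly. *)
Definition coef (R : realType) (r : nat) (t : 'rV[int]_r) (j : nat) : R :=
  if insub j is Some i then (t 0 i)%:~R else 0.

Lemma coefE (R : realType) r (t : 'rV[int]_r) (i : 'I_r) :
  coef R t i = (t 0 i)%:~R.
Proof. by rewrite /coef valK. Qed.

Lemma phaseE (R : realType) r h (t : 'rV[int]_r) n (x : R) :
  phase h t n x = invpoly r (fun j => n%:R / h%:R * coef R t j) x.
Proof.
rewrite /phase mulr_sumr; apply: eq_bigr => j _.
by rewrite coefE mulrA.
Qed.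

Lemma coef_ge1 (R : realType) r (t : 'rV[int]_r) j :
  coef R t j != 0 -> 1 <= `|coef R t j|.
Proof.
rewrite /coef; case: insubP => [i _ _|_]; last by rewrite eqxx.
rewrite intr_eq0 -intr_norm -[1]/(1%:~R) ler_int => t0.
by rewrite -gtz0_ge1 normr_gt0.
Qed.

Lemma first_coef (R : realType) r (t : 'rV[int]_r) : t != 0 ->
  exists j0, [/\ (j0 < r)%N, coef R t j0 != 0 &
    forall j, (j < j0)%N -> coef R t j = 0].
Proof.
move=> t0; have ex : exists j, coef R t j != 0.
  have [i ti] : exists i, t 0 i != 0.
    apply/existsP; apply: contra_neqT t0; rewrite negb_exists => /forallP h.
    by apply/rowP => i; rewrite mxE; apply/eqP; have := h i; rewrite negbK.
  by exists i; rewrite coefE intr_eq0.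
case: (ex_minnP ex) => j0 hj0 hmin; exists j0; split=> //.
  by move: hj0; rewrite /coef; case: insubP => [//|]; rewrite eqxx.
move=> j jj0; apply/eqP; apply: contraTT jj0 => /hmin.
by rewrite -leqNgt.
Qed.

(** Any common point x of the two intervals has P < x <= 2P and n^a < x <=
n^b. *)
Lemma range_of_n (R : realType) (a b P : R) (n : nat) : 0 < a -> 0 < b -> 1 <= P ->
  `]P, 2 * P] `&` `]n%:R `^ a, n%:R `^ b] !=set0 ->
  P `^ b^-1 <= n%:R /\ n%:R <= (2 * P) `^ a^-1.
Proof.
move=> a0 b0 P1 [x []]; rewrite /= !in_itv /= => /andP[Px xP] /andP[nx xn].
have P0 : 0 < P by rewrite (lt_le_trans _ P1).
have x0 : 0 < x := lt_trans P0 Px.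
have inv e : 0 < e -> (n%:R `^ e) `^ e^-1 = n%:R :> R.
  by move=> e0; rewrite -powRrM mulfV ?gt_eqF// powRr1.
split.
  rewrite -[leRHS](inv b)// ge0_ler_powR ?nnegrE ?invr_ge0 ?powR_ge0 ?(ltW b0) ?(ltW P0)//.
  by rewrite (le_trans (ltW Px)).
rewrite -[leLHS](inv a)// ge0_ler_powR ?nnegrE ?invr_ge0 ?powR_ge0 ?(ltW a0)//.
  by rewrite mulr_ge0// ltW.
by rewrite (le_trans (ltW nx)).
Qed.

(** P^(1/b) <= n and j0 < r give T >= P^(1/b - r) up to constants, where 1/b
- r > 0; half of this exponent absorbs the constants. The upper bound comes
from n <= (2P)^(1/a). *)
Lemma phase_size (R : realType) (r h : nat) (a b : R) (t : 'rV[int]_r) (j0 : nat) :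
  (0 < r)%N -> (0 < h)%N -> 0 < a -> 0 < b -> b < r%:R^-1 -> (j0 < r)%N ->
  coef R t j0 != 0 ->
  exists (A : nat) (de P0 : R), [/\ 0 < de <= 1, 1 <= P0 &
  forall (P : R) (n : nat), P0 <= P ->
    P `^ b^-1 <= n%:R -> n%:R <= (2 * P) `^ a^-1 ->
    P `^ de <= `|n%:R / h%:R * coef R t j0| * P ^- j0.+1 /\
    `|n%:R / h%:R * coef R t j0| <= P ^+ A].
Proof.
move=> r0 h0 a0 b0 br j0r cj0.
have rr0 : 0 < r%:R :> R by rewrite ltr0n.
have hr0 : 0 < h%:R :> R by rewrite ltr0n.
pose d0 := b^-1 - r%:R.
have d00 : 0 < d0 by rewrite subr_gt0 -[r%:R]invrK ltf_pV2 ?posrE ?invr_gt0.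
pose de := Num.min 1 (d0 / 2).
have de0 : 0 < de by rewrite lt_min ltr01 divr_gt0.
have ded : de <= d0 / 2 by rewrite ge_min lexx orbT.
have d20 : 0 < d0 / 2 by rewrite divr_gt0.
(* P^(d0/2) >= h compensates the denominator of the phase *)
have [P1 P11 hP1] := powR_unbounded h%:R d20.
pose D := `|coef R t j0|.
have D1 : 1 <= D by exact: coef_ge1.
pose m := Num.truncn a^-1.
have /andP[_ am] : m%:R <= a^-1 < m.+1%:R by apply: truncn_itv; rewrite invr_ge0 ltW.
pose P2 := D * 2 `^ a^-1.
have P20 : 0 <= P2 by rewrite mulr_ge0 ?powR_ge0// (le_trans _ D1).
exists m.+2, de, (P1 + P2); split.
- by rewrite de0 ge_min lexx.
- by rewrite (le_trans P11)// lerDl.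
move=> P n hP nb na.
have PP1 : P1 <= P by apply: le_trans hP; rewrite lerDl.
have PP2 : P2 <= P by apply: le_trans hP; rewrite lerDr (le_trans _ P11).
have Pge1 : 1 <= P := le_trans P11 PP1.
have P0 : 0 < P := lt_le_trans ltr01 Pge1.
have nE : `|n%:R / h%:R * coef R t j0| = n%:R / h%:R * D.
  by rewrite normrM ger0_norm// divr_ge0.
rewrite nE; split.
  have e1 : P `^ (b^-1) * P ^- j0.+1 >= P `^ d0.
    rewrite /d0 powRB; last by rewrite (gt_eqF P0) implybT.
    rewrite ler_pM2l ?powR_gt0// lef_pV2 ?posrE ?powR_gt0 ?exprn_gt0//.
    by rewrite powR_mulrn ?(ltW P0)// ler_weXn2l.
  have e2 : P `^ d0 = P `^ (d0 / 2) * P `^ (d0 / 2).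
    by rewrite -powR_split//; congr (_ `^ _); clear; lra.
  have e3 : P `^ de <= P `^ (d0 / 2) by rewrite ler_powR.
  have e4 : P `^ de * h%:R <= P `^ (b^-1) * P ^- j0.+1.
    by apply: le_trans e1; rewrite e2; apply: ler_pM; rewrite ?powR_ge0// hP1.
  apply: (@le_trans _ _ (n%:R / h%:R * P ^- j0.+1)).
    rewrite mulrAC ler_pdivlMr//; apply: (le_trans e4).
    by rewrite ler_wpM2r// invr_ge0 exprn_ge0// ltW.
  rewrite ler_wpM2r ?invr_ge0 ?exprn_ge0 ?(ltW P0)//.
  by rewrite ler_peMr// divr_ge0.
have h1 : 1 <= h%:R :> R by rewrite ler1n.
apply: (@le_trans _ _ (n%:R * D)).
  by rewrite ler_wpM2r ?(le_trans ler01 D1)// ler_pdivrMr// ler_peMr.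
apply: (@le_trans _ _ ((2 * P) `^ a^-1 * D)).
  by rewrite ler_wpM2r// (le_trans ler01 D1).
rewrite powRM ?(ltW P0)// mulrAC [X in X * _]mulrC exprS.
apply: ler_pM; rewrite ?powR_ge0//.
by rewrite -powR_mulrn ?(ltW P0)// ler_powR// ltW.
Qed.

Lemma twisted_sum_expi (R : realType) r (c : nat -> R) (w : nat -> R) (i1 i2 : nat) :
  \sum_(m < i2) (if (i1 <= m < i2)%N
      then (w m)%:C * expi2pi (invpoly r c m%:R) else 0) =
  (\sum_(m < i2) w m * twisted r c 0 i1 i2 m)
   +i* (\sum_(m < i2) w m * twisted r c (- (pi / 2)) i1 i2 m).
Proof.
rewrite -complex_sum; apply: eq_bigr => m _; rewrite /twisted.
case: ifP => _; last by rewrite !mulr0.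
rewrite /expi2pi add0r addrC cosBpihalf.
by apply/eqP; rewrite eq_complex /= !mul0r subr0 addr0 !eqxx.
Qed.

Theorem theorem3p1 (R : realType) (r : nat) (a b : R) (h : nat)
    (t : 'rV[int]_r) (hr : (1 <= r)%N) (ha : (r.+1)%:R^-1 < a) (hab : a < b)
    (hb : b < r%:R^-1) (hh : (2 <= h)%N) (ht : t != 0) :
  exists eta B : R, [/\ 0 < eta, 0 < B &
    forall (n : nat) (P : R) (I : interval R),
      (0 < n)%N -> 1 <= P ->
      `]P, 2 * P] `&` `]n%:R `^ a, n%:R `^ b] !=set0 ->
      [set` I] `<=` `]P, 2 * P] `&` `]n%:R `^ a, n%:R `^ b] ->
      `| \sum_(p \in [set p : nat | prime p /\ p%:R \in I])
           (ln p%:R : R)%:C * expi2pi (phase h t n (p%:R : R)) |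
        <= (B * P `^ (1 - eta))%:C
      /\
      `| \sum_(m \in [set m : nat | m%:R \in I])
           (mangoldt R m)%:C * expi2pi (phase h t n (m%:R : R)) |
        <= (B * P `^ (1 - eta))%:C].
Proof.
have a0 : 0 < a by apply: lt_trans ha; rewrite invr_gt0.
have b0 : 0 < b := lt_trans a0 hab.
have h0 : (0 < h)%N by exact: leq_trans hh.
have [j0 [j0r cj0 cz]] := first_coef R ht.
have [A [de [P0 [hde P01 hsize]]]] := phase_size hr h0 a0 b0 hb j0r cj0.
pose D := \sum_(j < r) `|coef R t j|.
have D0 : 0 <= D by rewrite sumr_ge0.
have [C [eta [C0 /andP[eta0 eta1] hC]]] := mangoldt_phase_sum r A D0 hde.
have [C3 C30 hC3] := nonprime_mangoldt_bound R.
(* the trivial bound i2^2 for P <= P0 *)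
pose E := 9 * P0 ^+ 2.
have E0 : 0 <= E by rewrite mulr_ge0// sqr_ge0.
exists eta, (2 * (C + E + C3)); split=> //.
  by rewrite mulr_gt0// ltr_wpDl ?addr_ge0// ltW.
move=> n P I n0 P1 meet sub.
have [nb na] := range_of_n a0 b0 P1 meet.
have [i1 [i2 [Pi iP mI]]] : exists i1 i2 : nat, [/\ P < i1%:R, i2%:R <= 2 * P + 1 &
    forall m : nat, (m%:R \in I) = (i1 <= m < i2)%N].
  by apply: nat_interval => // x /sub [].
have i3P : i2%:R <= 3 * P by apply: (le_trans iP); clear -P1; lra.
pose c j := n%:R / h%:R * coef R t j.
have cz' j : (j < j0)%N -> c j = 0 by move=> jj0; rewrite /c cz// mulr0.
have cD j : (j < r)%N -> `|c j| <= D * `|c j0|.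
  move=> jr; rewrite /c !normrM mulrCA ler_wpM2l ?mulr_ge0//.
  apply: (@le_trans _ _ D).
    by rewrite /D (bigD1 (Ordinal jr))//= lerDl sumr_ge0.
  by rewrite ler_peMr// coef_ge1.
have Peta : 1 <= P `^ (1 - eta).
  by apply: powR_ge1 => //; rewrite subr_ge0; clear -eta1; lra.
have P34 : P `^ (3 / 4) <= P `^ (1 - eta).
  by apply: ler_powR => //; clear -eta1; lra.
have Lbound phi : `|\sum_(m < i2) mangoldt R m * twisted r c phi i1 i2 m|
    <= (C + E) * P `^ (1 - eta).
  have [big|small] := leP P0 P.
    have [T1 T2] := hsize P n big nb na.
    apply: (le_trans (hC c j0 P phi i1 i2 j0r cz' cD P1 Pi iP T1 T2)).
    by rewrite ler_wpM2r ?powR_ge0// lerDl.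
  apply: (le_trans (mangoldt_phase_sum_trivial _ _ _ _ _)).
  apply: (@le_trans _ _ E).
    have -> : E = (3 * P0) ^+ 2 by rewrite /E exprMn -natrX.
    rewrite lerXn2r ?nnegrE//; first by rewrite mulr_ge0// (le_trans _ P01).
    by apply: (le_trans i3P); rewrite ler_pM2l// ltW.
  apply: (@le_trans _ _ (E * P `^ (1 - eta))); first by rewrite ler_peMr.
  by rewrite ler_wpM2r ?powR_ge0// lerDr ltW.
have Pbound phi : `|\sum_(m < i2) (if prime m then mangoldt R m else 0)
      * twisted r c phi i1 i2 m| <= (C + E + C3) * P `^ (1 - eta).
  apply: (le_trans (prime_phase_sum_le _ _ _ _ _)).
  rewrite [leRHS]mulrDl; apply: lerD (Lbound phi) _.
  by apply: (le_trans (hC3 P i2 P1 i3P)); rewrite ler_pM2l.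
have Lbound' phi : `|\sum_(m < i2) mangoldt R m * twisted r c phi i1 i2 m|
    <= (C + E + C3) * P `^ (1 - eta).
  apply: (le_trans (Lbound phi)).
  by rewrite ler_wpM2r ?powR_ge0// lerDl ltW.
rewrite -mulrA; split.
- rewrite (@fsbig_nat_bounded _ _ (fun p => prime p && (i1 <= p < i2)%N) i2).
  + have -> : \sum_(p < i2) (if prime p && (i1 <= p < i2)%N
        then (ln p%:R)%:C * expi2pi (phase h t n p%:R) else 0) =
      \sum_(m < i2) (if (i1 <= m < i2)%N then
        (if prime m then mangoldt R m else 0)%:C * expi2pi (invpoly r c m%:R) else 0).
      apply: eq_bigr => m _; case: (i1 <= m < i2)%N; rewrite ?andbF// andbT.
      rewrite phaseE -/c; case: ifP => [pm|_]; last by rewrite mul0r.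
      by have := @mangoldtX R m 1 pm isT; rewrite expn1 => ->.
    rewrite (twisted_sum_expi r c (fun m => if prime m then mangoldt R m else 0)).
    exact: complex_norm_le.
  + by move=> p; rewrite /= mI; split=> [[-> ->]|/andP[]].
  + by move=> p /andP[_ /andP[]].
- rewrite (@fsbig_nat_bounded _ _ (fun m => (i1 <= m < i2)%N) i2).
  + have -> : \sum_(m < i2) (if (i1 <= m < i2)%N
        then (mangoldt R m)%:C * expi2pi (phase h t n m%:R) else 0) =
      \sum_(m < i2) (if (i1 <= m < i2)%N then
        (mangoldt R m)%:C * expi2pi (invpoly r c m%:R) else 0).
      by apply: eq_bigr => m _; rewrite phaseE.
    rewrite (twisted_sum_expi r c (mangoldt R)); exact: complex_norm_le.
  + by move=> m; rewrite /= mI.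
  + by move=> m /andP[].
Qed.
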